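(* Assume $0<\alpha_k\le\frac12$ for all integers $k\ge0$, $\sum_{k=0}^\infty\alpha_k=\infty$ and $\sum_{k=0}^\infty\alpha_k^2<\infty$. Let $(\mathbf{x}_k)$ be the projected SGD iterates and $\tau_k$, $\mathbf{b}_k$ be as defined in the context. (1) If Assumption A1, A2 or A3 holds, then $$\lim_{N\to\infty}\frac1{\tau_N}\sum_{k=0}^{N-1}\alpha_k\,\mathbb{E}\Big[\mathrm{dist}\big(-\nabla\bar f(\mathbf{x}_k),\overline{\partial}_{\mathbf{b}_k}\mathcal{I}_{\mathcal{X}}(\mathbf{x}_k)\big)^2\Big]=0\quad\text{and}\quad\lim_{k\to\infty}\mathbb{E}[\mathbf{b}_k]=0.$$ (2) If Assumption A1 holds, then with probability $1$, $$\lim_{N\to\infty}\frac1{\tau_N}\sum_{k=0}^{N-1}\alpha_k\,\mathrm{dist}\big(-\nabla\bar f(\mathbf{x}_k),\overline{\partial}_{\mathbf{b}_k}\mathcal{I}_{\mathcal{X}}(\mathbf{x}_k)\big)^2=0\quad\text{and}\quad\lim_{k\to\infty}\mathbf{b}_k=0.$$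
   Context: **Setting.** $\mathcal{X}\subset\mathbb{R}^n$ is compact and convex with diameter $D$ and contains a ball of radius $r>0$ around the origin. $\bar f(x)=\mathbb{E}[f(x,\mathbf{z})]$; $\nabla f(x,z)$ means $\nabla_x f(x,z)$, which is $\ell$-Lipschitz in $x$ and in $z$: $\|\nabla f(x_1,z)-\nabla f(x_2,z)\|\le\ell\|x_1-x_2\|$ and $\|\nabla f(x,z_1)-\nabla f(x,z_2)\|\le\ell\|z_1-z_2\|$ (Euclidean norms). Consequently $\nabla\bar f$ is $\ell$-Lipschitz and bounded on $\mathcal{X}$. The data $\mathbf{z}_0,\mathbf{z}_1,\dots$ satisfy $\mathbb{E}[\nabla f(x,\mathbf{z}_k)]=\nabla\bar f(x)$ for all $x\in\mathcal{X}$ and $k$. The initial state $\mathbf{x}_0\in\mathcal{X}$ is independent of $(\mathbf{z}_k)_{k\ge0}$. Projected SGD with deterministic step sizes $\alpha_k$ is $\mathbf{x}_{k+1}=\Pi_{\mathcal{X}}(\mathbf{x}_k-\alpha_k\nabla f(\mathbf{x}_k,\mathbf{z}_k))$, with $\Pi$ the Euclidean projection. **Assumptions on the data.** A1: $\nabla f(x,\mathbf{z}_k)=\nabla\bar f(x)+\mathbf{z}_k$, where the $\mathbf{z}_k$ are IID zero-mean random vectors in $\mathbb{R}^n$, independent of $\mathbf{x}_0$, and for some $\hat\sigma>0$, $\mathbb{E}[e^{v^\top\mathbf{z}_k}]\le e^{\frac12\hat\sigma^2\|v\|^2}$ for all $v\in\mathbb{R}^n$. A2: the $\mathbf{z}_k$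 are independent and $\mathbb{E}[\|\nabla f(x,\mathbf{z}_k)-\nabla\bar f(x)\|^2]\le\sigma^2$ for all $x\in\mathcal{X}$ and all $k$. A3: $\mathbf{z}_k$ is independent of $\mathbf{x}_0$ and $L$-mixing: there are an increasing family of $\sigma$-algebras $\mathcal{F}_k$ and a decreasing family $\mathcal{F}_k^+$, with $\mathcal{F}_k,\mathcal{F}_k^+$ independent for every $k\ge0$, such that $\mathbf{z}_k$ is $\mathcal{F}_k$-measurable, $\sup_{k\ge0}\mathbb{E}^{1/m}[\|\mathbf{z}_k\|^m]<\infty$ for all $m\ge1$, and $\Psi_m(\mathbf{z})=\sum_{\tau=0}^\infty\psi_m(\tau,\mathbf{z})<\infty$ for all $m\ge1$, where $\psi_m(\tau,\mathbf{z})=\sup_{k\ge\tau}\mathbb{E}^{1/m}[\|\mathbf{z}_k-\mathbb{E}[\mathbf{z}_k\mid\mathcal{F}^+_{k-\tau}]\|^m]$. **Geometry.** For $x\in\mathcal{X}$: $\mathcal{N}_{\mathcal{X}}(x)=\{\phi:\phi^\top x\ge\phi^\top z\ \forall z\in\mathcal{X}\}$ is the normal cone ($\mathcal{N}_{\mathcal{X}}(x)=\emptyset$ if $x\notin\mathcal{X}$), and $T_{\mathcal{X}}(x)$ is the tangent cone, the closure of $\{t(y-x):y\in\mathcal{X},t\ge0\}$. For $\epsilon\ge0$, the Goldstein subdifferential of the convex indicator $\mathcal{I}_{\mathcal{X}}$ is $\overline{\partial}_\epsilon\mathcal{I}_{\mathcal{X}}(x)=\mathrm{conv}\big(\bigcup_{\|y-x\|\le\epsilon}\mathcal{N}_{\mathcal{X}}(y)\big)$.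 $\mathrm{dist}$ is Euclidean distance to a set. **Time embedding and restarted processes.** $\tau_k=\sum_{j=0}^{k-1}\alpha_j$; $\mathbf{x}^A_t=\mathbf{x}_k$ for $t\in[\tau_k,\tau_{k+1})$. Break points: $s_0=0$ and $s_{i+1}=\max\{\tau_j:\tau_j-s_i\le1\}$. For $t\in[s_i,s_{i+1}]$, $\mathbf{x}^{C_i}_t$ solves $\frac{d}{dt}\mathbf{x}^{C_i}_t=\Pi_{T_{\mathcal{X}}(\mathbf{x}^{C_i}_t)}(-\nabla\bar f(\mathbf{x}^{C_i}_t))$ (absolutely continuous solution, ODE holding for a.e. $t$) with $\mathbf{x}^{C_i}_{s_i}=\mathbf{x}^A_{s_i}$. $\mathbf{x}^J_t=\mathbf{x}^{C_i}_t$ for $t\in[s_i,s_{i+1})$. $\mathbf{b}_k=\sup_{t\in[\tau_k,\tau_{k+1})}\|\mathbf{x}^J_t-\mathbf{x}^A_{\tau_k}\|$. *)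

(* Defs.v *)
From HB Require Import structures.
From mathcomp Require Import all_boot all_order all_algebra.
From mathcomp Require Import all_classical all_reals all_analysis.
Import Order.TTheory GRing.Theory Num.Theory.
Import numFieldNormedType.Exports.

Set Implicit Arguments.
Unset Strict Implicit.
Unset Printing Implicit Defensive.

Local Open Scope classical_set_scope.
Local Open Scope ring_scope.

Section Euclidean.
Context {R : realType} {n : nat}.
Implicit Types (u v x y : 'rV[R]_n) (A S X : set 'rV[R]_n).

(* The library norm `|v| on 'rV[R]_n is the sup norm. It induces the Euclidean
   topology, so compactness, closures, differentiability and Borel sets below
   are the library ones; all metric quantities use [enorm]. *)
Definition dot u v : R := \sum_(i < n) u 0 i * v 0 i.

Definition enorm v : R := Num.sqrt (dot v v).

Definition dist_to x S : R := inf [set enorm (x - y) | y in S].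

(* The nearest point of A, which exists and is unique when A is nonempty,
   closed and convex. *)
Definition eproj A v : 'rV[R]_n :=
  xget 0 [set y | A y /\ forall a, A a -> enorm (v - y) <= enorm (v - a)].

Definition normal_cone X x : set 'rV[R]_n :=
  [set phi | X x /\ forall a, X a -> dot phi a <= dot phi x].

Definition tangent_cone X x : set 'rV[R]_n :=
  closure [set v | exists t y, [/\ 0 <= t, X y & v = t *: (y - x)]].

Definition convex_hull S : set 'rV[R]_n :=
  smallest (@convex_set R 'rV[R]_n) S.

Definition goldstein_indicator X (eps : R) x : set 'rV[R]_n :=
  convex_hull (\bigcup_(y in [set y | enorm (y - x) <= eps]) normal_cone X y).

Definition grad (g : 'rV[R]_n -> R) x : 'rV[R]_n :=
  \row_i 'D_(delta_mx 0 i) g x.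

Definition absolutely_continuous_on (a b : R) (y : R -> 'rV[R]_n) :=
  forall eps : R, 0 < eps -> exists2 delta : R, 0 < delta &
  forall (m : nat) (u v : 'I_m -> R),
    (forall i, [/\ a <= u i, u i <= v i & v i <= b]) ->
    trivIset setT (fun i => `]u i, v i[%classic) ->
    \sum_(i < m) (v i - u i) < delta ->
    \sum_(i < m) enorm (y (v i) - y (u i)) < eps.

Definition projected_gradient_flow X (g : 'rV[R]_n -> 'rV[R]_n) (a b : R)
    (y : R -> 'rV[R]_n) :=
  [/\ forall t, a <= t <= b -> X (y t),
      absolutely_continuous_on a b y &
      {ae @lebesgue_measure R, forall t : R, a < t < b ->
         is_derive t (1 : R) y (eproj (tangent_cone X (y t)) (- g (y t)))}].

End Euclidean.

Definition gradx {R : realType} {n p : nat} (f : 'rV[R]_n -> 'rV[R]_p -> R)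
    (x : 'rV[R]_n) (z : 'rV[R]_p) : 'rV[R]_n :=
  grad (fun y => f y z) x.

Section Probability.
Context {d : measure_display} {T : measurableType d} {R : realType}.
Variable P : probability T R.
Local Open Scope ereal_scope.

Definition borel {p : nat} : set (set 'rV[R]_p) := <<s open >>.

Definition sigma_of {p : nat} (Y : T -> 'rV[R]_p) : set (set T) :=
  preimage_set_system setT Y borel.

Definition random_vector {p : nat} (Y : T -> 'rV[R]_p) :=
  sigma_of Y `<=` measurable.

Definition sigma_of_seq {p : nat} (z : nat -> T -> 'rV[R]_p) : set (set T) :=
  <<s \bigcup_k sigma_of (z k) >>.

Definition independent_systems (F G : set (set T)) :=
  forall A B, F A -> G B -> P (A `&` B) = P A * P B.

Definition independent_seq {p : nat} (z : nat -> T -> 'rV[R]_p) :=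
  forall (J : seq nat) (B : nat -> set 'rV[R]_p), uniq J ->
    (forall k, borel (B k)) ->
    P (\bigcap_(k in [set` J]) (z k @^-1` B k)) =
    \prod_(k <- J) P (z k @^-1` B k).

Definition identically_distributed {p : nat} (z : nat -> T -> 'rV[R]_p) :=
  forall (j k : nat) (B : set 'rV[R]_p), borel B ->
    P (z j @^-1` B) = P (z k @^-1` B).

Definition vintegrable {p : nat} (Y : T -> 'rV[R]_p) :=
  forall i, P.-integrable setT (fun w => (Y w ord0 i)%:E).

Definition vmean {p : nat} (Y : T -> 'rV[R]_p) : 'rV[R]_p :=
  \row_i fine 'E_P[(fun w => Y w ord0 i)].

(* Y is a version of E[Z | G]. *)
Definition is_condexp {p : nat} (G : set (set T)) (Z Y : T -> 'rV[R]_p) :=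
  [/\ sigma_of Y `<=` G, vintegrable Y &
      forall A i, G A ->
        \int[P]_(w in A) (Y w ord0 i)%:E = \int[P]_(w in A) (Z w ord0 i)%:E].

Definition sub_sigma_algebra_of (F : set (set T)) :=
  sigma_algebra setT F /\ F `<=` measurable.

(* E^{1/m}[ ||Y||^m ] *)
Definition moment {p : nat} (m : R) (Y : T -> 'rV[R]_p) : \bar R :=
  'N[P]_(m%:E)[(fun w => (enorm (Y w))%:E)].

(* [zc k j] stands for E[z_k | F^+_j]. *)
Definition mixing_coef {p : nat} (z : nat -> T -> 'rV[R]_p)
    (zc : nat -> nat -> T -> 'rV[R]_p) (m : R) (tau : nat) : \bar R :=
  ereal_sup [set moment m (fun w => z k w - zc k (k - tau)%N w)%R
            | k in [set k | (tau <= k)%N]].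

(* Conditional expectations of an integrable variable exist and are a.s.
   unique, so the choice of the versions [zc] is immaterial. *)
Definition L_mixing {p : nat} (z : nat -> T -> 'rV[R]_p) :=
  exists (F Fp : nat -> set (set T)) (zc : nat -> nat -> T -> 'rV[R]_p),
  [/\ forall k, sub_sigma_algebra_of (F k) /\ sub_sigma_algebra_of (Fp k),
      forall j k, (j <= k)%N -> F j `<=` F k /\ Fp k `<=` Fp j,
      forall k, independent_systems (F k) (Fp k) /\ sigma_of (z k) `<=` F k,
      forall k j, is_condexp (Fp j) (z k) (zc k j) &
      forall m : R, (1 <= m)%R ->
        ereal_sup (range (fun k => moment m (z k))) < +oo /\
        \sum_(0 <= tau <oo) mixing_coef z zc m tau < +oo].

Definition mean_fun {n p : nat} (f : 'rV[R]_n -> 'rV[R]_p -> R)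
    (z : T -> 'rV[R]_p) (x : 'rV[R]_n) : R :=
  fine 'E_P[(fun w => f x (z w))].

Section Assumptions.
Context {n p : nat}.
Variables (X : set 'rV[R]_n) (G : 'rV[R]_n -> 'rV[R]_p -> 'rV[R]_n).
Variables (gbar : 'rV[R]_n -> 'rV[R]_n) (x0 : T -> 'rV[R]_n).
Variable z : nat -> T -> 'rV[R]_p.

(* Additive noise forces the data to have the dimension of the state. *)
Definition assumption_A1 :=
  [/\ exists e : p = n, forall x k w, X x ->
        G x (z k w) = (gbar x + castmx (erefl 1%N, e) (z k w))%R,
      independent_seq z /\ identically_distributed z,
      forall k, vintegrable (z k) /\ vmean (z k) = 0%R,
      independent_systems (sigma_of x0) (sigma_of_seq z) &
      exists2 sigma : R, (0 < sigma)%R & forall k (v : 'rV[R]_p),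
        'E_P[(fun w => expR (dot v (z k w)))] <=
        (expR (2^-1 * sigma ^+ 2 * enorm v ^+ 2))%:E].

Definition assumption_A2 :=
  independent_seq z /\
  exists sigma : R, forall x k, X x ->
    'E_P[(fun w => enorm (G x (z k w) - gbar x) ^+ 2)%R] <= (sigma ^+ 2)%:E.

Definition assumption_A3 :=
  independent_systems (sigma_of x0) (sigma_of_seq z) /\ L_mixing z.

End Assumptions.
End Probability.

Section Paths.
Context {R : realType} {n : nat}.
Variable alpha : nat -> R.

Fixpoint psgd {p : nat} (X : set 'rV[R]_n)
    (G : 'rV[R]_n -> 'rV[R]_p -> 'rV[R]_n) (x0 : 'rV[R]_n)
    (z : nat -> 'rV[R]_p) (k : nat) : 'rV[R]_n :=
  if k is j.+1 then
    let x := psgd X G x0 z j in eproj X (x - alpha j *: G x (z j))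
  else x0.

Definition tau (k : nat) : R := \sum_(0 <= j < k) alpha j.

Definition embed (x : nat -> 'rV[R]_n) (t : R) : 'rV[R]_n :=
  x (xget 0%N [set k | tau k <= t < tau k.+1]).

(* The supremum is attained as soon as the steps are positive with divergent
   sum. *)
Fixpoint breakpoint (i : nat) : R :=
  if i is j.+1 then
    sup [set tau k | k in [set k | tau k - breakpoint j <= 1]]
  else 0.

Definition restarted (xC : nat -> R -> 'rV[R]_n) (t : R) : 'rV[R]_n :=
  xC (xget 0%N [set i | breakpoint i <= t < breakpoint i.+1]) t.

Definition deviation (x : nat -> 'rV[R]_n) (xC : nat -> R -> 'rV[R]_n)
    (k : nat) : R :=
  sup [set enorm (restarted xC t - embed x (tau k))
      | t in [set t | tau k <= t < tau k.+1]].

End Paths.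

(* Main.v *)
(* On the window [s_i, s_(i+1)] let e_k be the distance between x_k and the
   restarted flow y at time tau_k. Since the projection is non-expansive and the
   flow satisfies the variational inequality of X,
     e_(k+1)^2 <= (1 + C alpha_k) e_k^2 - 2 alpha_k <x_k - y, W_k>
                  + O(alpha_k^2),
   with W_k = G(x_k, z_k) - g(x_k), so by Gronwall only the sums of the noise
   terms matter. The window is cut into finitely many short pieces; on a piece
   x_k - y and the state inside W_k are frozen at their initial values, and the
   frozen state is replaced by a point s of a finite net of X. What remains are
   sums of alpha_k (G(s, z_k) - g(s)) with s deterministic, whose variance tends
   to 0: the summands are uncorrelated under A1 and A2, and under A3 their
   correlation decays with the lag. For independent data the variances are
   moreover summable over the windows, because sum alpha_k^2 is finite, which
   gives almost sure convergence.

   At almost every time, -g(y) minus the velocity of the flow lies in the normal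
   cone at y, a point at distance at most b_k from x_k. Hence the gap is at most
   M b_k + |y'|, and the integral of |y'|^2 is the decrease of the objective
   along the flow; each restart costs at most a multiple of the tracking error. *)

Require Import Defs.
From HB Require Import structures.
From mathcomp Require Import all_boot all_order all_algebra.
From mathcomp Require Import all_classical all_reals all_analysis.
From mathcomp Require Import measurable_realfun finmap ring lra.
Import Order.TTheory GRing.Theory Num.Theory.
Import numFieldNormedType.Exports.
Local Open Scope classical_set_scope.
Local Open Scope ring_scope.

Set Implicit Arguments.
Unset Strict Implicit.
Unset Printing Implicit Defensive.

(** * Euclidean geometry *)

Section Euclidean.
Context {R : realType} {n : nat}.
Implicit Types (u v w x y : 'rV[R]_n) (A S X : set 'rV[R]_n).

(** The obstacle is dependence: [x k] is built from all earlier data, so under A3 the noise at [x k]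
    has no martingale structure. At deterministic states second moments suffice, and A1, A2 and A3
    enter only through variances and covariances. Freezing costs the square of the distance moved on
    a piece. The noise is unbounded, so that distance is random too; it is controlled by
    [noise_size], a Lipschitz function of the datum whose weighted sums obey the same variance
    bounds. Its mean contributes a term proportional to the length of the piece, and the remainder
    joins the noise sums in [fluctuation]. Two points are technical. The flow is differentiable only
    almost everywhere, so its estimates rest on a monotonicity theorem for absolutely continuous
    functions. And the flow is not assumed measurable in the sample point, so deviations and gaps
    are integrated as lower integrals and always compared with integrable majorants. *)

Lemma dotC u v : dot u v = dot v u.
Proof. by apply: eq_bigr => i _; rewrite mulrC. Qed.

Lemma dotDl u v w : dot (u + v) w = dot u w + dot v w.
Proof. by rewrite -big_split; apply: eq_bigr => i _; rewrite mxE mulrDl. Qed.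

Lemma dotDr u v w : dot w (u + v) = dot w u + dot w v.
Proof. by rewrite !(dotC w) dotDl. Qed.

Lemma dotZl (a : R) u v : dot (a *: u) v = a * dot u v.
Proof. by rewrite mulr_sumr; apply: eq_bigr => i _; rewrite mxE mulrA. Qed.

Lemma dotZr (a : R) u v : dot u (a *: v) = a * dot u v.
Proof. by rewrite !(dotC u) dotZl. Qed.

Lemma dotNl u v : dot (- u) v = - dot u v.
Proof. by rewrite -scaleN1r dotZl mulN1r. Qed.

Lemma dotNr u v : dot u (- v) = - dot u v.
Proof. by rewrite -scaleN1r dotZr mulN1r. Qed.

Lemma dot0l v : dot 0 v = 0.
Proof. by rewrite -(scale0r 0) dotZl mul0r. Qed.

Lemma dot0r v : dot v 0 = 0.
Proof. by rewrite dotC dot0l. Qed.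

Definition dotE := (dotDl, dotDr, dotNl, dotNr, dotZl, dotZr, dot0l, dot0r).

Lemma dot_sqrD u v : dot (u + v) (u + v) = dot u u + 2 * dot u v + dot v v.
Proof. by rewrite !dotE (dotC v u); ring. Qed.

Lemma dot_sqrB u v : dot (u - v) (u - v) = dot u u - 2 * dot u v + dot v v.
Proof. by rewrite !dotE (dotC v u); ring. Qed.

Lemma dot_suml (I : Type) (r : seq I) (P : pred I) (F : I -> 'rV[R]_n) v :
  dot (\sum_(i <- r | P i) F i) v = \sum_(i <- r | P i) dot (F i) v.
Proof. exact: (big_morph (dot ^~ v) (fun a b => dotDl a b v) (dot0l v)). Qed.

Lemma dot_sumr (I : Type) (r : seq I) (P : pred I) (F : I -> 'rV[R]_n) v :
  dot v (\sum_(i <- r | P i) F i) = \sum_(i <- r | P i) dot v (F i).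
Proof. by rewrite dotC dot_suml; apply: eq_bigr => i _; rewrite dotC. Qed.

Lemma dot_ge0 v : 0 <= dot v v.
Proof. by apply: sumr_ge0 => i _; rewrite -expr2 sqr_ge0. Qed.

Lemma enorm_ge0 v : 0 <= enorm v.
Proof. exact: sqrtr_ge0. Qed.
Hint Resolve enorm_ge0 : core.

Lemma enorm2 v : enorm v ^+ 2 = dot v v.
Proof. by rewrite sqr_sqrtr // dot_ge0. Qed.

Lemma enorm0 : enorm (0 : 'rV[R]_n) = 0.
Proof. by rewrite /enorm dot0l sqrtr0. Qed.

Lemma enormN v : enorm (- v) = enorm v.
Proof. by rewrite /enorm dotNl dotNr opprK. Qed.

Lemma enormC u v : enorm (u - v) = enorm (v - u).
Proof. by rewrite -opprB enormN. Qed.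

Lemma enormZ (a : R) v : enorm (a *: v) = `|a| * enorm v.
Proof.
by rewrite /enorm dotZl dotZr mulrA -expr2 sqrtrM ?sqr_ge0 // sqrtr_sqr.
Qed.

Lemma enorm_coord v i : `|v 0 i| <= enorm v.
Proof.
rewrite -(@ler_pXn2r _ 2%N) ?nnegrE // enorm2 /dot (bigD1 i) //=.
rewrite real_normK ?num_real // -expr2 lerDl.
by apply: sumr_ge0 => j _; rewrite -expr2 sqr_ge0.
Qed.

Lemma enorm_eq0 v : enorm v = 0 -> v = 0.
Proof.
move=> v0; apply/rowP => i; rewrite mxE; apply/eqP.
by rewrite -normr_le0 -v0 enorm_coord.
Qed.

Lemma cauchy_schwarz u v : dot u v <= enorm u * enorm v.
Proof.
have [u0|u0] := eqVneq (enorm u) 0.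
  by rewrite (enorm_eq0 u0) dot0l mulr_ge0.
have [v0|v0] := eqVneq (enorm v) 0.
  by rewrite (enorm_eq0 v0) dot0r mulr_ge0.
have up : 0 < enorm u by rewrite lt_def u0 /=.
have vp : 0 < enorm v by rewrite lt_def v0 /=.
have := dot_ge0 (enorm v *: u - enorm u *: v).
rewrite !dotE (dotC v u) -!enorm2.
set a := enorm u; set b := enorm v; set c := dot u v => H.
have : 0 <= 2 * (a * b) * (a * b - c) by lra.
by rewrite pmulr_rge0 ?subr_ge0 // mulr_gt0 // mulr_gt0.
Qed.

Lemma cauchy_schwarz_abs u v : `|dot u v| <= enorm u * enorm v.
Proof.
rewrite ler_norml cauchy_schwarz andbT lerNl -dotNl.
by rewrite (le_trans (cauchy_schwarz _ _)) // enormN.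
Qed.

Lemma ler_enormD u v : enorm (u + v) <= enorm u + enorm v.
Proof.
rewrite -(@ler_pXn2r _ 2%N) ?nnegrE ?addr_ge0 //.
rewrite enorm2 !dotE (dotC v u) -!enorm2.
by have := cauchy_schwarz u v; lra.
Qed.

Lemma ler_enormB u v : enorm (u - v) <= enorm u + enorm v.
Proof. by rewrite (le_trans (ler_enormD _ _)) // enormN. Qed.

Lemma ler_enorm_dist w u v : enorm (u - v) <= enorm (u - w) + enorm (w - v).
Proof. by rewrite -[u - v](subrKA w) ler_enormD. Qed.

Lemma ler_dist_enorm u v : `|enorm u - enorm v| <= enorm (u - v).
Proof.
rewrite ler_distlC; apply/andP; split.
  by have := ler_enormD (u - v) v; rewrite subrK; lra.
by have := ler_enormD (v - u) u; rewrite subrK enormC; lra.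
Qed.

Lemma ler_enorm_sum (I : Type) (r : seq I) (P : pred I) (F : I -> 'rV[R]_n) :
  enorm (\sum_(i <- r | P i) F i) <= \sum_(i <- r | P i) enorm (F i).
Proof.
elim/big_rec2: _ => [|i a b _ H]; first by rewrite enorm0.
by rewrite (le_trans (ler_enormD _ _)) // lerD2l.
Qed.

Lemma enorm_sum_coord v : enorm v <= \sum_i `|v 0 i|.
Proof.
have -> : enorm v = enorm (\sum_i v 0 i *: delta_mx 0 i : 'rV[R]_n).
  by rewrite -row_sum_delta.
apply: le_trans (ler_enorm_sum _ _ _) _; apply: ler_sum => i _.
rewrite enormZ /enorm /dot (bigD1 i) //= big1 => [|j ji].
  by rewrite !mxE !eqxx /= mulr1 addr0 sqrtr1 mulr1.
by rewrite !mxE eqxx (negbTE ji) /= mulr0.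
Qed.

Lemma norm_coord v i : `|v 0 i| <= `|v|.
Proof.
by rewrite [leRHS]/Num.norm /= mx_normrE (le_bigmax _ _ (ord0, i)).
Qed.

Lemma norm_le_enorm v : `|v| <= enorm v.
Proof.
rewrite [leLHS]/Num.norm /= mx_normrE; apply/bigmax_leP; split => // -[i j] _ /=.
by rewrite (ord1 i) enorm_coord.
Qed.

Lemma enorm_le_norm v : enorm v <= n%:R * `|v|.
Proof.
apply: le_trans (enorm_sum_coord v) _.
have -> : n%:R * `|v| = \sum_(i < n) `|v|.
  by rewrite sumr_const card_ord mulr_natl.
by apply: ler_sum => i _; exact: norm_coord.
Qed.

Lemma lipschitz_continuous (phi : 'rV[R]_n -> R) (L : R) :
  (forall u v, `|phi u - phi v| <= L * enorm (u - v)) -> continuous phi.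
Proof.
move=> H u; apply/(@cvgrPdist_le _ _ _ (nbhs u) (nbhs_filter u)) => e e0.
(* The factor [n] passes from the sup norm of the library balls to [enorm]; the added 1 keeps the
   divisor positive. *)
pose M := `|L| * n%:R + 1.
have M0 : 0 < M by rewrite ltr_wpDl // mulr_ge0.
apply/nbhs_ballP; exists (e / M) => /=; first by rewrite divr_gt0.
move=> v; rewrite -ball_normE /= => /ltW; rewrite ler_pdivlMr // => uv.
apply: le_trans (H _ _) _; apply: le_trans uv.
apply: le_trans (ler_wpM2r (enorm_ge0 _) (ler_norm L)) _.
apply: le_trans (ler_wpM2l (normr_ge0 _) (enorm_le_norm _)) _.
by rewrite mulrA [leRHS]mulrC ler_wpM2r // lerDl.
Qed.

Lemma continuous_enormB x : continuous (fun v => enorm (x - v)).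
Proof.
apply: (@lipschitz_continuous _ 1) => u v.
rewrite mul1r; apply: le_trans (ler_dist_enorm _ _) _.
by rewrite opprB addrC subrKA enormC.
Qed.

Lemma compact_enorm_bounded X : compact X ->
  exists2 M : R, 0 < M & forall x, X x -> enorm x <= M.
Proof.
move=> /compact_bounded [M [_ H]].
exists (n%:R * (`|M| + 1) + 1); first by rewrite ltr_wpDl // mulr_ge0.
move=> x Xx; apply: le_trans (enorm_le_norm x) _.
apply: ler_wpDr => //; rewrite ler_wpM2l //.
by apply: H => //; rewrite (le_lt_trans (ler_norm M)) // ltrDl.
Qed.

Lemma compact_net X (e : R) : compact X -> 0 < e ->
  exists F : seq 'rV[R]_n, (forall x, x \in F -> X x) /\
    forall x, X x -> exists2 a, a \in F & enorm (x - a) <= e.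
Proof.
(* A sup-norm ball of radius [d] lies in the Euclidean ball of radius [n * d <= e]. *)
move=> cX e0; pose d := e / (n%:R + 1).
have n1 : 0 < n%:R + 1 :> R by rewrite ltr_wpDl.
have d0 : 0 < d by rewrite divr_gt0.
move: cX; rewrite compact_cover => /(_ _ X (fun x => ball x d)).
case=> [i _||D DX cov]; first exact: ball_open.
  by move=> x Xx; exists x => //; exact: ballxx.
exists (enum_fset D); split => [x xD|x Xx]; first by have /set_mem := DX _ xD.
have [a /= aD] := cov _ Xx; rewrite -ball_normE /= distrC => xa.
exists a => //; apply: le_trans (enorm_le_norm _) _.
apply: (@le_trans _ _ (n%:R * d)); first by rewrite ler_wpM2l // ltW.
rewrite /d mulrA ler_pdivrMr // mulrC ler_wpM2l ?(ltW e0) //; lra.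
Qed.

Lemma convex_setE A : @convex_set R 'rV[R]_n A -> forall u v (t : R),
  A u -> A v -> 0 <= t <= 1 -> A (u + t *: (v - u)).
Proof.
move=> cA u v t Au Av t01.
have t01' : Itv.spec (@Itv.num_sem R) (Itv.Real `[0%Z, 1%Z]) t.
  by rewrite /= /Itv.num_sem /= in_itv /= num_real.
pose l : {i01 R} := Itv.mk t01'.
have /set_mem := cA v u l (mem_set Av) (mem_set Au).
suff <- : t *: v + (1 - t) *: u = u + t *: (v - u) by [].
by rewrite scalerBl scale1r scalerBr addrC -addrA [- _ + _]addrC.
Qed.

End Euclidean.
#[export] Hint Extern 0 (is_true (0 <= enorm _)) => exact: enorm_ge0 : core.

(** * Projections on convex sets and tangent cones *)

Section Projection.
Context {R : realType} {n : nat}.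
Implicit Types (u v w x y a p : 'rV[R]_n) (A S X : set 'rV[R]_n).

(** Only points at least as close to [v] as a fixed [a0] compete, and these form a compact set. *)
Lemma nearest_point_exists A v : A !=set0 -> closed A ->
  exists y, A y /\ forall a, A a -> enorm (v - y) <= enorm (v - a).
Proof.
move=> [a0 Aa0] clA.
pose B := A `&` [set y | enorm (v - y) <= enorm (v - a0)].
have clB : closed B.
  apply: closedI => //.
  have -> : [set y | enorm (v - y) <= enorm (v - a0)] =
    (fun y => enorm (v - y)) @^-1` [set z | z <= enorm (v - a0)] by [].
  apply: preimage_closed; last exact: closed_le.
  by move=> y _; exact: continuous_enormB.
have bB : bounded_set B.
  exists (enorm (v - a0) + enorm v); split; first exact: num_real.
  move=> M lM y [_ /= yv]; apply: le_trans (norm_le_enorm y) _.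
  apply: le_trans (ltW lM); rewrite -[y](subrK v).
  apply: le_trans (ler_enormD _ _) _; by rewrite lerD2r (enormC y).
have B0 : B !=set0 by exists a0; split => /=.
have cB : {within B, continuous (fun y => enorm (v - y))}.
  by apply: continuous_subspaceT; exact: continuous_enormB.
have [y /set_mem [Ay /= ya] H] := EVT_min_rV B0 (bounded_closed_compact bB clB) cB.
exists y; split => // a Aa.
have [va|va] := leP (enorm (v - a)) (enorm (v - a0)).
  by apply: H; apply: mem_set; split.
by rewrite (le_trans ya) // ltW.
Qed.

Lemma eproj_nearest A v : A !=set0 -> closed A ->
  A (eproj A v) /\ forall a, A a -> enorm (v - eproj A v) <= enorm (v - a).
Proof. by move=> A0 cA; exact: (xgetPex 0 (nearest_point_exists v A0 cA)). Qed.

(** First-order optimality in one direction [w], kept free of any set so that it serves projections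
    on [X] and on tangent cones. The bound [t <= 1] allows [w] to be [a - p] in a convex set or
    [- p] in a cone. *)
Lemma nearest_dot_le0 v p w :
  (forall t : R, 0 < t <= 1 -> enorm (v - p) <= enorm (v - (p + t *: w))) ->
  dot (v - p) w <= 0.
Proof.
move=> H; rewrite leNgt; apply/negP => c0.
set c := dot (v - p) w in c0; have q0 := dot_ge0 w; set q := dot w w in q0.
(* Then [t * q = c - t * c < 2 * c], so a step of length [t] along [w] gets strictly closer. Adding
   [c] to the denominator keeps [t <= 1] and covers [q = 0]. *)
pose t := c / (c + q).
have cq : 0 < c + q by rewrite ltr_wpDr.
have t0 : 0 < t by rewrite divr_gt0.
have t1 : t <= 1 by rewrite ler_pdivrMr // mul1r lerDl.
have tE : t * (c + q) = c by rewrite divfK // gt_eqF.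
have := H t; rewrite t0 t1 => /(_ isT).
rewrite -(@ler_pXn2r _ 2%N) ?nnegrE // opprD addrA !enorm2.
rewrite (dot_sqrB (v - p)) !dotZr dotZl -/c -/q => K.
have : 0 <= t * (t * q - 2 * c) by lra.
by rewrite pmulr_rge0 //; nra.
Qed.

Lemma eproj_dot_le0 X v a : closed X -> @convex_set R 'rV[R]_n X -> X a ->
  X (eproj X v) /\ dot (v - eproj X v) (a - eproj X v) <= 0.
Proof.
move=> clX cX Xa.
have [Xp H] := @eproj_nearest X v (ex_intro _ a Xa) clX; split => //.
apply: nearest_dot_le0 => t /andP[t0 t1]; apply: H.
by apply: (convex_setE cX) => //; rewrite ltW.
Qed.

Lemma eproj_contract X v a : closed X -> @convex_set R 'rV[R]_n X -> X a ->
  dot (eproj X v - a) (eproj X v - a) <= dot (v - a) (v - a).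
Proof.
move=> clX cX Xa; have [_] := eproj_dot_le0 v clX cX Xa.
set y := eproj X v => H.
have {}H : 0 <= dot (v - y) (y - a) by rewrite -(opprB a y) (dotNr (v - y)) oppr_ge0.
by have := dot_ge0 (v - y); rewrite -[v - a](subrKA y) (dot_sqrD (v - y)); lra.
Qed.

Lemma closure_stable A (phi : 'rV[R]_n -> 'rV[R]_n) p : continuous phi ->
  (forall u, A u -> A (phi u)) -> closure A p -> closure A (phi p).
Proof.
move=> cphi H clp B Bp; have [q [Aq Bq]] := clp _ (cphi p _ Bp).
by exists (phi q); split; [exact: H|].
Qed.

Lemma tangent_coneZ X y s p : 0 <= s ->
  tangent_cone X y p -> tangent_cone X y (s *: p).
Proof.
move=> s0; apply: closure_stable; first exact: scaler_continuous.
move=> _ [t [z [t0 Xz ->]]]; exists (s * t), z; split => //.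
  exact: mulr_ge0.
by rewrite scalerA.
Qed.

(** By convexity, [t (z - y) + s (a - y)] is [s + t] times the direction from [y] to a point between
    [z] and [a]; the closure inherits this stability. *)
Lemma tangent_coneD X y s a p : @convex_set R 'rV[R]_n X -> 0 <= s -> X a ->
  tangent_cone X y p -> tangent_cone X y (p + s *: (a - y)).
Proof.
move=> cX s0 Xa.
apply: (@closure_stable _ (fun p => p + s *: (a - y))) => [q|].
  exact: (@cvgD _ _ _ (nbhs q) (nbhs_filter q) id (fun=> s *: (a - y)) q _
    (@cvg_id _ _) (@cvg_cst _ _ _ _ (nbhs_filter q))).
move=> _ [t [z [t0 Xz ->]]].
have [st0|st0] := eqVneq (s + t) 0.
  have [-> ->] : s = 0 /\ t = 0 by split; lra.
  by exists 0, a; split => //; rewrite !scale0r addr0.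
have stp : 0 < s + t by rewrite lt_def st0 addr_ge0.
exists (s + t), (z + (s / (s + t)) *: (a - z)); split; first exact: ltW.
  apply: (convex_setE cX) => //; rewrite divr_ge0 ?(ltW stp) //=.
  by rewrite ler_pdivrMr // mul1r lerDl.
apply/rowP => i; rewrite !mxE; field; exact: st0.
Qed.

(** Moreau decomposition of [v] along the tangent cone and its polar. Moving from [p] along [a - y]
    gives normality; moving along [p] and along [- p] gives orthogonality. *)
Lemma eproj_tangent_cone X y v : @convex_set R 'rV[R]_n X -> X y ->
  let p := eproj (tangent_cone X y) v in
  dot (v - p) p = 0 /\ normal_cone X y (v - p).
Proof.
move=> cX Xy p.
have T0 : tangent_cone X y 0.
  by apply: subset_closure; exists 0, y; split => //; rewrite scale0r.
have [Tp H] := eproj_nearest v (ex_intro _ 0 T0) (@closed_closure _ _).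
rewrite -/p in Tp H; split; last first.
  split => // a Xa; rewrite -subr_le0 -dotNr -dotDr.
  apply: nearest_dot_le0 => t /andP[t0 _]; apply: H.
  by apply: tangent_coneD => //; exact: ltW.
apply/eqP; rewrite eq_le -[X in _ && X]oppr_le0 -dotNr.
apply/andP; split; apply: nearest_dot_le0 => t /andP[t0 t1]; apply: H.
  by rewrite -{1}[p]scale1r -scalerDl; apply: tangent_coneZ => //; lra.
by rewrite scalerN -{1}[p]scale1r -scalerBl; apply: tangent_coneZ => //; lra.
Qed.

Lemma eproj_tangent_norm X y v : @convex_set R 'rV[R]_n X -> X y ->
  enorm (eproj (tangent_cone X y) v) <= enorm v.
Proof.
move=> cX Xy; have [] := eproj_tangent_cone v cX Xy.
set p := eproj _ _ => H _.
rewrite -(@ler_pXn2r _ 2%N) ?nnegrE // !enorm2.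
have := dot_ge0 (v - p); move: H.
by rewrite !dotE (dotC p v); lra.
Qed.

End Projection.

(** * Absolutely continuous functions *)

Section AbsoluteContinuity.
Context {R : realType}.
Implicit Types (a b c : R) (h k : R -> R).

(** Supremum argument. The local hypothesis compares only points on opposite sides of [t], since a
    derivative at [t] says nothing about two points on the same side. *)
Lemma locally_nonincreasing_le k a b : a <= b ->
  (forall t, a <= t <= b -> exists2 r : R, 0 < r & forall s s',
     a <= s -> s <= t -> t <= s' -> s' <= b -> t - r < s -> s' < t + r ->
     k s' <= k s) ->
  k b <= k a.
Proof.
move=> ab loc; pose S := [set t | a <= t <= b /\ k t <= k a].
have Sa : S a by split; rewrite ?lexx.
have ubS : has_ubound S by exists b => t [/andP[]].
have supS : has_sup S by split; [exists a|].
have aS : a <= sup S by apply: ub_le_sup.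
have Sb : sup S <= b by apply: ge_sup; [exists a|move=> t [/andP[]]].
have [|r r0 H] := loc (sup S); first by rewrite aS.
have [t0 [/andP[at0 t0b] kt0] t0S] := sup_adherent r0 supS.
have t0le : t0 <= sup S by apply: ub_le_sup => //; split; rewrite ?at0.
have ext s : sup S <= s -> s <= b -> s < sup S + r -> s <= sup S.
  move=> Ss sb sr; apply: ub_le_sup => //; split.
    by rewrite (le_trans aS).
  by apply: le_trans kt0; apply: H.
have [bS|Sb'] := leP b (sup S).
  by apply: le_trans kt0; apply: H; rewrite ?(le_lt_trans bS) ?ltrDl.
(* If [sup S < b], this point lies beyond the supremum and still belongs to [S]. *)
have := ext (Num.min b (sup S + r / 2)).
rewrite le_min Sb lerDl ge_min lexx gt_min ltrD2l ge_min.
by move=> /(_ _ isT _); lra.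
Qed.

Definition ac_on a b h := forall eps : R, 0 < eps ->
  exists2 delta : R, 0 < delta &
  forall (m : nat) (u v : 'I_m -> R),
    (forall i, [/\ a <= u i, u i <= v i & v i <= b]) ->
    trivIset setT (fun i => `]u i, v i[%classic) ->
    \sum_(i < m) (v i - u i) < delta ->
    \sum_(i < m) `|h (v i) - h (u i)| < eps.

Lemma sum_itv_le_measure (m : nat) (u v : 'I_m -> R) (U : set R) :
  measurable U -> (forall i, u i <= v i) ->
  (forall i, `]u i, v i[%classic `<=` U) ->
  trivIset setT (fun i => `]u i, v i[%classic) ->
  ((\sum_(i < m) (v i - u i))%:E <= lebesgue_measure U)%E.
Proof.
move=> mU uv sU tI.
have -> : (\sum_(i < m) (v i - u i))%:E =
    (\sum_(i < m) lebesgue_measure (`]u i, v i[%classic : set R))%E.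
  rewrite -sumEFin; apply: eq_bigr => i _; rewrite lebesgue_measure_itv /= lte_fin.
  have := uv i; rewrite le_eqVlt => /orP[/eqP ->|->//].
  by rewrite ltxx subrr.
have mI i : measurable (`]u i, v i[%classic : set R) by exact: measurable_itv.
have mB : measurable (\big[setU/set0]_(i < m) (`]u i, v i[%classic : set R)).
  by apply: bigsetU_measurable => i _; exact: mI.
rewrite -measure_semi_additive_ord //; apply: le_measure; [exact: mem_set | exact: mem_set |].
by elim/big_ind: _ => // A B AU BU; rewrite subUset.
Qed.

Section NullCover.
Variables (a b eps delta : R) (h : R -> R) (U : set R).
Hypothesis mU : measurable U.
Hypothesis Udelta : (lebesgue_measure U < delta%:E)%E.
Hypothesis Hac : forall (m : nat) (u v : 'I_m -> R),
    (forall i, [/\ a <= u i, u i <= v i & v i <= b]) ->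
    trivIset setT (fun i => `]u i, v i[%classic) ->
    \sum_(i < m) (v i - u i) < delta ->
    \sum_(i < m) `|h (v i) - h (u i)| < eps.

Let admissible t m (u v : 'I_m -> R) :=
  [/\ forall i, [/\ a <= u i, u i <= v i & v i <= t],
      forall i, `]u i, v i[%classic `<=` U &
      trivIset setT (fun i => `]u i, v i[%classic)].

Let sums t : set R := [set x | exists m (u v : 'I_m -> R),
  admissible t u v /\ x = \sum_(i < m) `|h (v i) - h (u i)|].

(* The variation of h over the part of [a, t] covered by U. *)
Let V t := sup (sums t).

Let sums0 t : sums t 0.
Proof.
exists 0%N, (fun=> 0), (fun=> 0); split; last by rewrite big_ord0.
by split=> [[]|[]|[]].
Qed.

Let sums_lt t x : t <= b -> sums t x -> x < eps.
Proof.
move=> tb [m [u [v [[uv uvU tI] ->]]]]; apply: Hac => // [i|].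
  by have [? ? ?] := uv i; split => //; apply: le_trans tb.
rewrite -lte_fin; apply: le_lt_trans Udelta; apply: sum_itv_le_measure => // i.
by have [] := uv i.
Qed.

Let has_sup_sums t : t <= b -> has_sup (sums t).
Proof.
move=> tb; split; first by exists 0.
by exists eps => x /(sums_lt tb)/ltW.
Qed.

Let V_ge0 t : t <= b -> 0 <= V t.
Proof. by move=> /has_sup_sums[_ ub]; exact: ub_le_sup. Qed.

Let V_le t : t <= b -> V t <= eps.
Proof.
by move=> tb; apply: ge_sup => [|x /(sums_lt tb)/ltW //]; exists 0.
Qed.

Let V_mono s t : s <= t -> t <= b -> V s <= V t.
Proof.
move=> st tb; apply: ge_sup; first by exists 0.
move=> x [m [u [v [[uv uvU tI] xE]]]]; apply: ub_le_sup.
  by have [] := has_sup_sums tb.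
exists m, u, v; split => //; split => // i.
by have [? ? ?] := uv i; split => //; apply: le_trans st.
Qed.

(** A family counted by [V s] stays admissible when []s, t[] is added to it, here at index 0 with
    the old intervals shifted by one. *)
Let V_superadd s t : a <= s -> s <= t -> t <= b -> `]s, t[%classic `<=` U ->
  V s + `|h t - h s| <= V t.
Proof.
move=> as_ st tb stU; rewrite -lerBrDr; apply: ge_sup; first by exists 0.
move=> x [m [u [v [[uv uvU tI] xE]]]]; rewrite lerBrDr.
pose ext (f : 'I_m -> R) (y : R) (i : 'I_m.+1) :=
  if unlift ord0 i is Some j then f j else y.
have ext0 f y : ext f y ord0 = y by rewrite /ext unlift_none.
have extS f y j : ext f y (lift ord0 j) = f j by rewrite /ext liftK.
apply: ub_le_sup; first by have [] := has_sup_sums tb.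
exists m.+1, (ext u s), (ext v t); split; last first.
  rewrite big_ord_recl !ext0 xE addrC; congr (_ + _).
  by apply: eq_bigr => j _; rewrite !extS.
split=> [i|i|].
- case: (unliftP ord0 i) => [j|] ->; rewrite ?extS ?ext0 //.
  by have [? ? ?] := uv j; split => //; apply: le_trans st.
- by case: (unliftP ord0 i) => [j|] ->; rewrite ?extS ?ext0.
- apply/trivIsetP => i j _ _.
  case: (unliftP ord0 i) => [i'|] ->; case: (unliftP ord0 j) => [j'|] ->;
    rewrite ?extS ?ext0 ?eqxx // => ij.
  + move/trivIsetP : tI => /(_ i' j' I I); apply; apply: contra ij.
    by move=> /eqP ->.
  + rewrite -subset0 => y [/=]; rewrite !in_itv /= => /andP[_ yv] /andP[sy _].
    by have [_ _ vs] := uv i'; lra.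
  + rewrite -subset0 => y [/=]; rewrite !in_itv /= => /andP[sy _] /andP[_ yv].
    by have [_ _ vs] := uv j'; lra.
Qed.

(* [h - eps t - V] is locally nonincreasing: [V_superadd]
   controls h near the points of U, and its derivative is negative elsewhere. *)
Lemma null_cover_le : open U -> a <= b -> 0 < eps ->
  (forall t, a <= t <= b -> ~ U t -> exists2 dh, is_derive t (1 : R) h dh & dh <= 0) ->
  h b - h a <= eps * (b - a) + eps.
Proof.
move=> oU ab eps0 Hd.
pose k t := h t - eps * t - V t.
suff : k b <= k a.
  by have := V_ge0 ab; have := V_le (lexx b); rewrite /k; nra.
apply: locally_nonincreasing_le => // t /andP[at_ tb].
have [Ut|nUt] := pselect (U t).
  have /nbhs_ballP [r /= r0 rU] : nbhs t U by exact: open_nbhs_nbhs.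
  exists r => // s s' as_ st ts' s'b rs rs'.
  have : V s + `|h s' - h s| <= V s'.
    apply: V_superadd => //; first exact: le_trans ts'.
    move=> y; rewrite /= in_itv /= => /andP[sy ys']; apply: rU.
    by rewrite /ball /= ltr_distlC; apply/andP; split; lra.
  by have := ler_norm (h s' - h s); rewrite /k; nra.
(* Off [U], the slope function of [h] at [t] is continuous there with value at most 0, so it stays
   below [eps] nearby. *)
have [dh /is_derive1_caratheodory [g [gE cg gt]] dh0] := Hd t (introT andP (conj at_ tb)) nUt.
have [r /= r0 rg] : exists2 r : R, 0 < r & forall y, `|t - y| < r -> g y < eps.
  have : \forall y \near t, g y < eps.
    by apply: cvgr_lt cg _ _; rewrite gt; exact: le_lt_trans dh0 _.
  by move=> /nbhs_ballP [r /= r0 H]; exists r.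
exists r => // s s' as_ st ts' s'b rs rs'.
have gs : g s < eps by apply: rg; rewrite ltr_distlC; apply/andP; split; lra.
have gs' : g s' < eps by apply: rg; rewrite ltr_distlC; apply/andP; split; lra.
have := gE s; have := gE s'; have := V_mono (le_trans st ts') s'b.
rewrite /k => HV E1 E2.
have : g s' * (s' - t) <= eps * (s' - t) by rewrite ler_wpM2r ?subr_ge0 // ltW.
have : g s * (t - s) <= eps * (t - s) by rewrite ler_wpM2r ?subr_ge0 // ltW.
by lra.
Qed.

End NullCover.

(** Outer regularity covers the exceptional null set by an open set of measure below the [delta] of
    absolute continuity; [null_cover_le] then gives a bound that vanishes with [eps]. *)
Lemma ac_on_derive_le0 a b h : a <= b -> ac_on a b h ->
  {ae @lebesgue_measure R, forall t, a < t < b ->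
     exists2 dh, is_derive t (1 : R) h dh & dh <= 0} ->
  h b <= h a.
Proof.
move=> ab Hac [M [mM M0 HM]].
suff H eps : 0 < eps -> h b - h a <= eps * (b - a) + eps.
  rewrite leNgt; apply/negP => hab.
  have c0 : 0 < b - a + 1 by rewrite ltr_wpDl // subr_ge0.
  (* With this [eps] the bound equals half of [h b - h a], a contradiction. *)
  have := H ((h b - h a) / (2 * (b - a + 1))).
  rewrite divr_gt0 ?mulr_gt0 ?subr_gt0 // => /(_ isT).
  set e := _ / _ => He.
  have : e * (2 * (b - a + 1)) = h b - h a by rewrite divfK // mulf_neq0 // gt_eqF.
  by lra.
move=> eps0; have [delta d0 Hd] := Hac _ eps0.
pose M' : set R := M.
have mM' : measurable M' by exact: mM.
have M'0 : lebesgue_measure M' = 0%E by exact: M0.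
(* The endpoints join the exceptional set, because the derivative is known only inside the
   interval. *)
pose N : set R := M' `|` [set a] `|` [set b].
have mMa : measurable (M' `|` [set a]) by exact: measurableU.
have mN : measurable N by exact: measurableU.
have N0 : lebesgue_measure N = 0%E.
  rewrite /N measureU0 //; last exact: lebesgue_measure_set1.
  by rewrite measureU0 //; exact: lebesgue_measure_set1.
have Nfin : (lebesgue_measure N < +oo)%E by rewrite N0.
have [U [oU NU Ulow]] := lebesgue_regularity_outer mN Nfin d0.
have mU : measurable U by exact: measurable_realfun.open_measurable.
have Ud : (lebesgue_measure U < delta%:E)%E.
  rewrite -(setDUK NU) setUC; have mD : measurable (U `\` N) by exact: measurableD.
  by rewrite measureU0.
apply: (null_cover_le mU Ud Hd) => // t /andP[at_ tb] nUt.
apply: contrapT => nd; apply: nUt; apply: NU.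
have [->|ta] := eqVneq t a; first by left; right.
have [->|tb'] := eqVneq t b; first by right.
left; left; apply: HM => /= H; apply: nd; apply: H.
by rewrite !lt_def ta at_ eq_sym tb' tb.
Qed.

Lemma ac_on_derive_le a b h c : a <= b -> ac_on a b h ->
  {ae @lebesgue_measure R, forall t, a < t < b ->
     exists2 dh, is_derive t (1 : R) h dh & dh <= c} ->
  h b - h a <= c * (b - a).
Proof.
move=> ab Hac Hd.
suff : h b - c * b <= h a - c * a by lra.
apply: (@ac_on_derive_le0 a b (fun t => h t - c * t)) => //.
  move=> eps e0; have [delta d0 H] := Hac (eps / 2) ltac:(lra).
  have c1 : 0 < `|c| + 1 by rewrite ltr_wpDl.
  exists (Num.min delta (eps / 2 / (`|c| + 1))).
    by rewrite lt_min d0 divr_gt0 //; lra.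
  move=> m u v uv tI; rewrite lt_min => /andP[s1 s2].
  apply: (@le_lt_trans _ _ (\sum_(i < m) `|h (v i) - h (u i)| +
      (`|c| + 1) * \sum_(i < m) (v i - u i))).
    rewrite mulr_sumr -big_split; apply: ler_sum => i _ /=.
    have [_ uvi _] := uv i.
    rewrite (_ : h (v i) - c * v i - _ = (h (v i) - h (u i)) - c * (v i - u i)); last ring.
    apply: le_trans (ler_normB _ _) _; rewrite lerD2l normrM.
    by rewrite (ger0_norm (x := v i - u i)) ?subr_ge0 // ler_wpM2r ?subr_ge0 // lerDl.
  have := H m u v uv tI s1; move: s2; rewrite ltr_pdivlMr // mulrC; lra.
case: Hd => M [mM M0 HM]; exists M; split => // t nH; apply: HM => H; apply: nH => tab.
have [dh dhE dhc] := H tab.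
exists (dh - c); last lra.
have -> : dh - c = dh - c *: (1 : R) by rewrite /GRing.scale /= mulr1.
by apply: is_deriveB; apply: is_deriveZ.
Qed.

End AbsoluteContinuity.

(** * Projected gradient flows *)

Section Derivatives.
Context {R : realType} {n : nat}.
Implicit Types (s p x c : 'rV[R]_n).

Lemma is_derive_coord s p i :
  is_derive s p (fun v : 'rV[R]_n => v 0 i : R) (p 0 i).
Proof.
apply: DeriveDef; first exact/diff_derivable/differentiable_coord.
apply: lim_near_cst => //; near=> h.
have h0 : h != 0 by near: h; exact: nbhs_dnbhs_neq.
by rewrite /= !mxE addrK /GRing.scale /= mulKf.
Unshelve. all: by end_near. Qed.

Lemma is_derive_ext (V W : normedModType R) (phi psi : V -> W) (u v : V) (d e : W) :
  is_derive u v phi d -> phi =1 psi -> d = e -> is_derive u v psi e.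
Proof. by move=> H /funext <- <-. Qed.

Lemma is_derive_dotr c s p : is_derive s p (dot c) (dot c p).
Proof.
have K i : is_derive s p (fun v : 'rV[R]_n => c 0 i * v 0 i : R) (c 0 i * p 0 i).
  exact: (is_deriveZ (c 0 i) (is_derive_coord s p i)).
by apply: (is_derive_ext (is_derive_sum K)) => // v; rewrite fct_sumE.
Qed.

Lemma differentiable_dotr c s : differentiable (dot c) s.
Proof.
have K i : differentiable (fun v : 'rV[R]_n => c 0 i * v 0 i : R) s.
  by apply: differentiableM => //; exact: differentiable_coord.
have := differentiable_sum K; congr (differentiable _ _).
by apply/funext => v; rewrite fct_sumE.
Qed.

Lemma is_derive_sqr_dist x s p :
  is_derive s p (fun v => dot (v - x) (v - x)) (2 * dot (s - x) p).
Proof.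
have K i : is_derive s p (fun v : 'rV[R]_n => (v 0 i - x 0 i) * (v 0 i - x 0 i) : R)
    ((s 0 i - x 0 i) *: p 0 i + (s 0 i - x 0 i) *: p 0 i).
  have H : is_derive s p (fun v : 'rV[R]_n => v 0 i - x 0 i) (p 0 i).
    by rewrite -[p 0 i]subr0; apply: is_deriveB; exact: is_derive_coord.
  exact: is_deriveM.
apply: (is_derive_ext (is_derive_sum K)) => [v|].
  by rewrite fct_sumE; apply: eq_bigr => i _; rewrite !mxE.
rewrite mulr_sumr; apply: eq_bigr => i _; rewrite !mxE /GRing.scale /=; ring.
Qed.

Lemma differentiable_sqr_dist x s : differentiable (fun v => dot (v - x) (v - x)) s.
Proof.
have K i : differentiable (fun v : 'rV[R]_n => (v 0 i - x 0 i) * (v 0 i - x 0 i) : R) s.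
  have H : differentiable (fun v : 'rV[R]_n => v 0 i - x 0 i) s.
    by apply: differentiableB => //; exact: differentiable_coord.
  exact: differentiableM.
have := differentiable_sum K; congr (differentiable _ _).
by apply/funext => v; rewrite fct_sumE; apply: eq_bigr => i _; rewrite !mxE.
Qed.

Lemma derive_grad (phi : 'rV[R]_n -> R) s p : differentiable phi s ->
  'D_p phi s = dot (grad phi s) p.
Proof.
move=> dphi; rewrite deriveE // [in LHS](row_sum_delta p) linear_sum.
by apply: eq_bigr => i _; rewrite linearZ /= mxE deriveE // mulrC.
Qed.

End Derivatives.

Section Flow.
Context {R : realType} {n : nat}.
Variables (X : set 'rV[R]_n) (g : 'rV[R]_n -> 'rV[R]_n) (a b : R) (y : R -> 'rV[R]_n).
Hypothesis cX : @convex_set R 'rV[R]_n X.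
Hypothesis flow : projected_gradient_flow X g a b y.

Let vel t := eproj (tangent_cone X (y t)) (- g (y t)).

(** Integrated chain rule: [phi] is Lipschitz on [X], so [phi \o y] is absolutely continuous and a
    bound on its derivative integrates. Linear forms, the squared distance and the objective are the
    three choices of [phi] made below. *)
Lemma flow_le (phi : 'rV[R]_n -> R) (L c u v : R) :
  (forall s s', X s -> X s' -> `|phi s - phi s'| <= L * enorm (s - s')) ->
  (forall s, X s -> differentiable phi s) ->
  a <= u -> u <= v -> v <= b ->
  (forall t, u < t < v -> 'D_(vel t) phi (y t) <= c) ->
  phi (y v) - phi (y u) <= c * (v - u).
Proof.
move=> Lphi dphi au uv vb Hc; case: flow => yX acy dy.
apply: (@ac_on_derive_le _ u v (phi \o y)) => //.
  move=> eps e0; have L1 : 0 < `|L| + 1 by rewrite ltr_wpDl.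
  have [delta d0 H] := acy (eps / (`|L| + 1)) (divr_gt0 e0 L1).
  exists delta => // m s t st tI /H {}H.
  apply: (@le_lt_trans _ _ ((`|L| + 1) * \sum_(i < m) enorm (y (t i) - y (s i)))).
    rewrite mulr_sumr; apply: ler_sum => i _ /=.
    have [us sti tv] := st i.
    apply: le_trans (Lphi _ _ _ _) _; first by apply: yX; lra.
      by apply: yX; lra.
    by rewrite ler_wpM2r // (le_trans (ler_norm L)) // lerDl.
  rewrite mulrC -ltr_pdivlMr //; apply: H => // i.
  by have [? ? ?] := st i; split; lra.
case: dy => M [mM M0 HM]; exists M; split => // t nH; apply: HM => H; apply: nH.
move=> /andP[ut tv]; have tab : a < t < b by apply/andP; split; lra.
have := H tab => -[dyt Dyt].
have dphit : differentiable phi (y t) by apply/dphi/yX; lra.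
have dyt' : differentiable y t by exact/derivable1_diffP.
exists ('D_(vel t) phi (y t)); last by apply: Hc; rewrite ut.
apply: DeriveDef; first exact/derivable1_diffP/differentiable_comp.
rewrite deriveE; last exact: differentiable_comp.
have E : 'd y t (1 : R) = vel t by rewrite -deriveE // Dyt.
by rewrite diff_comp //= E deriveE.
Qed.

Lemma flow_mem t : a <= t <= b -> X (y t).
Proof. by case: flow => + _ _; exact. Qed.

(** Testing with the linear form of the displacement [c] itself gives
    [enorm c ^+ 2 <= enorm c * U * (v - u)]. *)
Lemma flow_speed (U : R) u v : (forall s, X s -> enorm (g s) <= U) ->
  a <= u -> u <= v -> v <= b -> enorm (y v - y u) <= U * (v - u).
Proof.
move=> gU au uv vb; set c := y v - y u.
have [c0|c0] := eqVneq (enorm c) 0.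
  rewrite c0 mulr_ge0 ?subr_ge0 //; apply: le_trans (gU (y u) _) => //.
  by apply: flow_mem; lra.
have cp : 0 < enorm c by rewrite lt_def c0 /=.
have : dot c (y v) - dot c (y u) <= (enorm c * U) * (v - u).
  apply: (@flow_le (dot c) (enorm c)) => //.
  - by move=> s s' _ _; rewrite -dotNr -dotDr cauchy_schwarz_abs.
  - by move=> s _; exact: differentiable_dotr.
  - move=> t tuv; have [_ ->] := is_derive_dotr c (y t) (vel t).
    have Xt : X (y t) by apply: flow_mem; lra.
    apply: le_trans (cauchy_schwarz _ _) _; rewrite ler_wpM2l //.
    by apply: le_trans (eproj_tangent_norm _ cX Xt) _; rewrite enormN gU.
rewrite -dotNr -dotDr -/c -enorm2 expr2 -mulrA ler_pM2l //.
Qed.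

(** The vector [- g (y t) - vel t] is normal at [y t]; comparing [y t] with [x] in the normal cone
    inequality gives [dot (y t - x) (vel t) <= dot (x - y t) (g (y t))]. *)
Lemma flow_dist_le (x : 'rV[R]_n) (D c u v : R) : X x ->
  (forall s s', X s -> X s' -> enorm (s - s') <= D) ->
  a <= u -> u <= v -> v <= b ->
  (forall t, u < t < v -> dot (x - y t) (g (y t)) <= c) ->
  dot (y v - x) (y v - x) <= dot (y u - x) (y u - x) + 2 * c * (v - u).
Proof.
move=> Xx XD au uv vb Hc.
suff : dot (y v - x) (y v - x) - dot (y u - x) (y u - x) <= 2 * c * (v - u) by lra.
apply: (@flow_le (fun v => dot (v - x) (v - x)) (2 * D)) => //.
- move=> s s' Xs Xs'.
  have -> : dot (s - x) (s - x) - dot (s' - x) (s' - x) =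
      dot (s - s') (s - x) + dot (s - s') (s' - x).
    by rewrite !dotE (dotC x s) (dotC x s') (dotC s' s); ring.
  have := XD _ _ Xs Xx; have := XD _ _ Xs' Xx.
  have := cauchy_schwarz_abs (s - s') (s - x).
  have := cauchy_schwarz_abs (s - s') (s' - x).
  have := ler_normD (dot (s - s') (s - x)) (dot (s - s') (s' - x)).
  have := enorm_ge0 (s - s').
  by move: (enorm (s - s')) (enorm (s - x)) (enorm (s' - x)) => A B C; nra.
- by move=> s _; exact: differentiable_sqr_dist.
- move=> t tuv; have [_ ->] := is_derive_sqr_dist x (y t) (vel t).
  have Xt : X (y t) by apply: flow_mem; lra.
  have [_ [_ /(_ _ Xx)]] := eproj_tangent_cone (- g (y t)) cX Xt.
  rewrite -/(vel t) => H; rewrite ler_pM2l //; apply: le_trans (Hc t tuv).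
  move: H; rewrite !(dotDl, dotNl, dotDr, dotNr) (dotC x) (dotC (y t) (vel t)).
  by rewrite (dotC x) (dotC (y t) (g _)); lra.
Qed.

(** By orthogonality in the Moreau decomposition, the derivative of the objective along the flow is
    minus the squared speed. *)
Lemma flow_energy_le (phi : 'rV[R]_n -> R) (L m u v : R) :
  (forall s s', X s -> X s' -> `|phi s - phi s'| <= L * enorm (s - s')) ->
  (forall s, X s -> differentiable phi s) -> (forall s, X s -> grad phi s = g s) ->
  a <= u -> u <= v -> v <= b -> 0 <= m ->
  (forall t, u < t < v -> m <= enorm (eproj (tangent_cone X (y t)) (- g (y t)))) ->
  m ^+ 2 * (v - u) <= phi (y u) - phi (y v).
Proof.
move=> Lphi dphi gphi au uv vb m0 Hm.
suff : phi (y v) - phi (y u) <= - m ^+ 2 * (v - u) by lra.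
apply: (flow_le Lphi dphi) => // t tuv.
have Xt : X (y t) by apply: flow_mem; lra.
rewrite derive_grad ?gphi //; last exact: dphi.
have [+ _] := eproj_tangent_cone (- g (y t)) cX Xt.
rewrite -/(vel t) !(dotDl, dotNl) -enorm2.
have : m ^+ 2 <= enorm (vel t) ^+ 2 by rewrite ler_pXn2r ?nnegrE // Hm.
by lra.
Qed.

End Flow.

(** * Time scale and step sizes *)

Lemma nat_interval_exists (K : nat -> nat) (k : nat) : K 0%N = 0%N ->
  (forall i, K i < K i.+1)%N -> exists i, (K i <= k < K i.+1)%N.
Proof.
move=> K0 KS; have Kge i : (i <= K i)%N.
  by elim: i => // i IH; rewrite (leq_ltn_trans IH).
have [j jk jmin] : exists2 j, (k < K j)%N & forall i, (k < K i)%N -> (j <= i)%N.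
  have ex : exists j, (k < K j)%N by exists k.+1.
  by case: (ex_minnP ex) => j jk jmin; exists j.
case: j jk jmin => [|i] ik imin; first by rewrite K0 in ik.
exists i; rewrite ik andbT leqNgt; apply/negP => /imin.
by rewrite ltnn.
Qed.

Section Time.
Context {R : realType} {n : nat}.
Variable alpha : nat -> R.
Hypothesis alpha_bnd : forall k, 0 < alpha k <= 2^-1.
Local Notation tau := (tau alpha).

Let alpha_gt0 k : 0 < alpha k.
Proof. by case/andP: (alpha_bnd k). Qed.

Lemma tau0 : tau 0 = 0.
Proof. by rewrite /Defs.tau big_nil. Qed.

Lemma tauS k : tau k.+1 = tau k + alpha k.
Proof. by rewrite /Defs.tau big_nat_recr. Qed.

Lemma tauB m k : (m <= k)%N -> tau k - tau m = \sum_(m <= j < k) alpha j.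
Proof.
by move=> mk; rewrite /Defs.tau (big_cat_nat (leq0n _) mk) //= [X in X - _]addrC addrK.
Qed.

Lemma tau_ltS k : tau k < tau k.+1.
Proof. by rewrite tauS ltrDl. Qed.

Lemma tau_lt m k : (tau m < tau k) = (m < k)%N.
Proof. by apply: (leW_mono (le_mono _)) => i j; exact: (homo_ltn lt_trans tau_ltS). Qed.

Lemma tau_le m k : (tau m <= tau k) = (m <= k)%N.
Proof. by apply: le_mono => i j; exact: (homo_ltn lt_trans tau_ltS). Qed.

Lemma tau_ge0 k : 0 <= tau k.
Proof. by rewrite -tau0 tau_le. Qed.

Lemma tau_index_unique (t : R) k :
  tau k <= t < tau k.+1 -> xget 0%N [set j | tau j <= t < tau j.+1] = k.
Proof.
move=> ktk; have /andP[kt tk] := ktk.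
set S := [set j | _]; have Sk : S k by exact: ktk.
rewrite (xget_unique _ Sk) // => j /andP[jt tj].
have jk : (j < k.+1)%N by rewrite -tau_lt (le_lt_trans jt).
have kj : (k < j.+1)%N by rewrite -tau_lt (le_lt_trans kt).
by apply/eqP; rewrite eqn_leq -(ltnS j) jk -ltnS kj.
Qed.

Lemma embed_tau (x : nat -> 'rV[R]_n) k : embed alpha x (tau k) = x k.
Proof. by rewrite /embed (@tau_index_unique _ k) // lexx tau_ltS. Qed.

Hypothesis tau_unbounded : forall M, exists N, M < tau N.

(** The last index [k'] within time 1 exists because [tau] is unbounded. One more step, of length at
    most 1/2, would exceed 1, so a window lasts at least 1/2; this lower bound later pays for the
    restarts. *)
Lemma next_breakpoint k : exists k', [/\ (k < k')%N,
  2^-1 <= tau k' - tau k <= 1 &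
  sup [set tau j | j in [set j | tau j - tau k <= 1]] = tau k'].
Proof.
have [N HN] := tau_unbounded (tau k + 1).
pose Q := fun j => tau j - tau k <= 1.
have exQ : exists j, Q j by exists k; rewrite /Q subrr.
have ubQ j : Q j -> (j <= N)%N.
  by rewrite /Q => Qj; rewrite ltnW // -tau_lt; lra.
case: (ex_maxnP exQ ubQ) => k' Qk' k'max; exists k'.
have nQ : ~ Q k'.+1 by move/k'max; rewrite ltnn.
move/negP: nQ; rewrite /Q -ltNge tauS => nQ; have /andP[_ a2] := alpha_bnd k'.
split.
- by rewrite -tau_lt; lra.
- by apply/andP; split; [lra|exact: Qk'].
- apply/eqP; rewrite eq_le; apply/andP; split.
    apply: ge_sup; first by exists (tau k'), k'.
    by move=> _ [j /= Qj <-]; rewrite tau_le; exact: k'max.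
  apply: ub_le_sup; last by exists k'.
  by exists (tau k') => _ [j /= Qj <-]; rewrite tau_le; exact: k'max.
Qed.

(* [K i] indexes the first iterate of the i-th window and [wi k] is the window
   of the k-th iterate. *)
Lemma windows : exists K wi : nat -> nat, [/\ K 0%N = 0%N,
  forall i, (K i < K i.+1)%N, forall i, breakpoint alpha i = tau (K i),
  forall i, 2^-1 <= tau (K i.+1) - tau (K i) <= 1 &
  forall k, (K (wi k) <= k < K (wi k).+1)%N].
Proof.
have [F HF] := choice next_breakpoint.
pose K i := iter i F 0%N.
have KS i : (K i < K i.+1)%N by have [] := HF (K i).
have [wi Hwi] := choice (fun k => @nat_interval_exists K k erefl KS).
exists K, wi; split => //.
  elim=> [|i IH]; first by rewrite /= tau0.
  by rewrite /= IH; have [_ _ ->] := HF (K i).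
by move=> i; have [] := HF (K i).
Qed.

Lemma restarted_window (K : nat -> nat) (xC : nat -> R -> 'rV[R]_n) i k t :
  (forall i, (K i < K i.+1)%N) -> (forall i, breakpoint alpha i = tau (K i)) ->
  (K i <= k < K i.+1)%N -> tau k <= t < tau k.+1 ->
  restarted alpha xC t = xC i t.
Proof.
move=> KS KE /andP[ik ki] /andP[kt tk].
have Kle := homo_leq (@leqnn) leq_trans (fun i => ltnW (KS i)).
have ikt : tau (K i) <= tau k by rewrite tau_le.
have kit : tau k.+1 <= tau (K i.+1) by rewrite tau_le.
rewrite /restarted (@xget_unique _ 0%N [set _ | _] i) //.
  rewrite /mkset !KE; apply/andP; split; first exact: le_trans kt.
  exact: lt_le_trans kit.
move=> j; rewrite /mkset !KE => /andP[jt tj].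
have h1 : (K j < K i.+1)%N.
  by rewrite -tau_lt (le_lt_trans jt) // (lt_le_trans tk).
have h2 : (K i < K j.+1)%N.
  by rewrite -tau_lt (le_lt_trans _ tj) // (le_trans _ kt).
apply/eqP; rewrite eqn_leq (leqNgt j) (leqNgt i); apply/andP; split; apply/negP => ij.
  by have := Kle _ _ ij; rewrite leqNgt h1.
by have := Kle _ _ ij; rewrite leqNgt h2.
Qed.

Lemma window_sum_split (K : nat -> nat) (F : nat -> R) i : K 0%N = 0%N ->
  (forall i, (K i < K i.+1)%N) ->
  \sum_(0 <= k < K i) F k = \sum_(0 <= j < i) \sum_(K j <= k < K j.+1) F k.
Proof.
move=> K0 KS; elim: i => [|i IH]; first by rewrite K0 !big_nil.
by rewrite big_nat_recr //= -IH -big_cat_nat // ltnW.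
Qed.

End Time.

(** * Consequences of the step size conditions *)

Section StepSizes.
Context {R : realType}.
Variable alpha : nat -> R.

Lemma series_pinfty_unbounded : (forall k, 0 < alpha k) ->
  (\sum_(0 <= k <oo) (alpha k)%:E = +oo)%E -> forall M, exists N, M < tau alpha N.
Proof.
move=> a0 aoo M; apply: contrapT => /forallNP HM.
suff : (\sum_(0 <= k <oo) (alpha k)%:E <= M%:E)%E by rewrite aoo leNgt ltry.
apply: lime_le; first by apply: is_cvg_nneseries => k _ _; rewrite lee_fin ltW.
apply: nearW => N; rewrite sumEFin lee_fin leNgt; apply/negP; exact: HM.
Qed.

Lemma nneseries_partial_bound (u : nat -> R) : (forall k, 0 <= u k) ->
  (\sum_(0 <= k <oo) (u k)%:E < +oo)%E ->
  exists2 A : R, 0 <= A & forall N, \sum_(0 <= k < N) u k <= A.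
Proof.
move=> u0; set s := (\sum_(0 <= k <oo) _)%E => soo.
have s0 : (0 <= s)%E by apply: nneseries_ge0 => k _ _; rewrite lee_fin.
have sf : s \is a fin_num by rewrite ge0_fin_numE.
exists (fine s); first exact: fine_ge0.
move=> N; rewrite -lee_fin fineK // -sumEFin.
by apply: nneseries_lim_ge => k _ _; rewrite lee_fin.
Qed.

Lemma bounded_series_cvg0 (u : nat -> R) (A : R) : (forall k, 0 <= u k) ->
  (forall N, \sum_(0 <= k < N) u k <= A) ->
  forall e, 0 < e -> exists k0, forall k, (k0 <= k)%N -> u k <= e.
Proof.
move=> u0 HA e e0.
have cs : cvgn (series u).
  apply: nondecreasing_is_cvgn; first exact: nondecreasing_series.
  by exists A => _ [N _ <-]; exact: HA.
have /cvgrPdist_lt /(_ e e0) [k0 _ H] := cvg_series_cvg_0 cs.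
by exists k0 => k /H; rewrite sub0r normrN ger0_norm // => /ltW.
Qed.

Lemma square_summable_cvg0 (A : R) : (forall k, 0 < alpha k) ->
  (forall N, \sum_(0 <= k < N) alpha k ^+ 2 <= A) ->
  forall e, 0 < e -> exists k0, forall k, (k0 <= k)%N -> alpha k <= e.
Proof.
move=> a0 HA e e0.
have [k0 H] := bounded_series_cvg0 (fun k => sqr_ge0 (alpha k)) HA (exprn_gt0 2 e0).
exists k0 => k /H; by rewrite ler_pXn2r ?nnegrE // ltW.
Qed.

Lemma weighted_cesaro (c : nat -> R) (C M eta : R) (N0 : nat) :
  (forall k, 0 < alpha k) -> (forall M, exists N, M < tau alpha N) ->
  0 < eta -> (forall k, c k <= M) -> (forall k, (N0 <= k)%N -> c k <= eta) ->
  exists N1, forall N, (N1 <= N)%N ->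
    (tau alpha N)^-1 * (C + \sum_(0 <= k < N) alpha k * c k) <= 2 * eta.
Proof.
move=> a0 aoo eta0 cM ceta.
(* [B] bounds the constant and the first [N0] terms; once [tau N] exceeds [B / eta] they cost at
   most one [eta], and the remaining terms another. *)
pose B := C + `|M| * tau alpha N0.
have [N1 HN1] := aoo (Num.max 0 (B / eta)).
exists (maxn N0 N1) => N; rewrite geq_max => /andP[N0N N1N].
have tm i j : (i <= j)%N -> tau alpha i <= tau alpha j.
  move=> ij; rewrite /tau (big_cat_nat (leq0n _) ij) //= lerDl; apply: sumr_ge0 => k _.
  exact: ltW.
have := lt_le_trans HN1 (tm _ _ N1N); rewrite gt_max => /andP[t0 tB].
rewrite mulrC ler_pdivrMr //.
have tN0 : 0 <= tau alpha N0 by apply: sumr_ge0 => k _; exact: ltW.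
have s1 : \sum_(0 <= k < N0) alpha k * c k <= `|M| * tau alpha N0.
  rewrite /tau mulr_sumr; apply: ler_sum => k _; rewrite mulrC.
  by rewrite ler_wpM2r ?(ltW (a0 k)) // (le_trans (cM k)) // ler_norm.
have s2 : \sum_(N0 <= k < N) alpha k * c k <= eta * tau alpha N.
  apply: (@le_trans _ _ (\sum_(N0 <= k < N) eta * alpha k)).
    rewrite big_nat_cond [leRHS]big_nat_cond; apply: ler_sum => k.
    rewrite andbT => /andP[N0k _]; rewrite mulrC ler_wpM2r ?ceta //.
    exact: ltW.
  rewrite -mulr_sumr ler_wpM2l ?(ltW eta0) // /tau (big_cat_nat (leq0n _) N0N) //= lerDr.
  by [].
rewrite (big_cat_nat (leq0n _) N0N) //=; move: tB; rewrite ltr_pdivrMr // /B => tB.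
lra.
Qed.

End StepSizes.

(** * Tracking the flow on one window *)

Lemma discrete_gronwall (R : realType) (alpha E : nat -> R) (B c : R) (K m : nat) :
  0 <= B -> 0 <= c -> (forall k, 0 <= alpha k) -> (K <= m)%N ->
  (forall j, (K <= j <= m)%N -> E j <= B + \sum_(K <= k < j) c * alpha k * E k) ->
  E m <= B * expR (c * \sum_(K <= k < m) alpha k).
Proof.
move=> B0 c0 a0 Km HE.
(* The induction runs on the right-hand side of the hypothesis, since [E] itself need not be
   monotone; each step uses [1 + x <= expR x]. *)
have H j : (K <= j)%N -> (j <= m)%N ->
    B + \sum_(K <= k < j) c * alpha k * E k <= B * expR (c * \sum_(K <= k < j) alpha k).
  move=> Kj; rewrite -(subnKC Kj); elim: (j - K)%N => [|i IH] im.
    by rewrite addn0 !big_geq // mulr0 expR0 mulr1 addr0.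
  have im' : (K + i <= m)%N by rewrite (leq_trans _ im) // addnS.
  rewrite addnS !big_nat_recr ?leq_addr //= mulrDr expRD mulrA addrA.
  have := IH im'; have := HE (K + i)%N; rewrite leq_addr im' => /(_ isT).
  set P := B + _; set Q := _ * expR _ => EP PQ.
  have Q0 : 0 <= Q by rewrite mulr_ge0 // expR_ge0.
  have ca : 0 <= c * alpha (K + i)%N by rewrite mulr_ge0.
  apply: (@le_trans _ _ (Q * (1 + c * alpha (K + i)%N))).
    by rewrite mulrDr mulr1 lerD // mulrC ler_wpM2r // (le_trans EP).
  by rewrite ler_wpM2l // expR_ge1Dx.
by apply: le_trans (H m Km (leqnn _)); apply: HE; rewrite Km leqnn.
Qed.

Lemma ler_sum_ord_nat (R : numDomainType) (F H : nat -> R) (i j : nat) :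
  (forall k, (i <= k < j)%N -> F k <= H k) ->
  \sum_(i <= k < j) F k <= \sum_(i <= k < j) H k.
Proof.
move=> FH; rewrite big_nat_cond [leRHS]big_nat_cond; apply: ler_sum => k.
by rewrite andbT; exact: FH.
Qed.

Section Window.
Context {R : realType} {n p : nat}.
Variables (alpha : nat -> R) (X : set 'rV[R]_n).
Variables (G : 'rV[R]_n -> 'rV[R]_p -> 'rV[R]_n) (g : 'rV[R]_n -> 'rV[R]_n).
Variables (M : R) (z : nat -> 'rV[R]_p) (x : nat -> 'rV[R]_n) (Gam : nat -> R).
Variables (K K' : nat) (y : R -> 'rV[R]_n).
Local Notation tau := (tau alpha).
Hypothesis alpha_bnd : forall k, 0 < alpha k <= 2^-1.
Hypothesis clX : closed X.
Hypothesis cX : @convex_set R 'rV[R]_n X.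
Hypothesis M1 : 1 <= M.
Hypothesis X_diam : forall s s', X s -> X s' -> enorm (s - s') <= M.
Hypothesis g_bnd : forall s, X s -> enorm (g s) <= M.
Hypothesis g_lip : forall s s', X s -> X s' -> enorm (g s - g s') <= M * enorm (s - s').
Hypothesis G_lip : forall s s' u, X s -> X s' ->
  enorm (G s u - G s' u) <= M * enorm (s - s').
Hypothesis Gam_ge : forall k, M <= Gam k.
Hypothesis G_bnd : forall s k, X s -> enorm (G s (z k)) <= Gam k.
Hypothesis W_bnd : forall s k, X s -> enorm (G s (z k) - g s) <= Gam k.
Hypothesis x0X : X (x 0%N).
Hypothesis xS : forall k, x k.+1 = eproj X (x k - alpha k *: G (x k) (z k)).
Hypothesis KK' : (K <= K')%N.
Hypothesis flow : projected_gradient_flow X g (tau K) (tau K') y.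
Hypothesis yK : y (tau K) = x K.

Let W s k := G s (z k) - g s.
Let v k := x k - y (tau k).
Let e k := enorm (v k).

Let alpha_gt0 k : 0 < alpha k.
Proof. by case/andP: (alpha_bnd k). Qed.

Lemma psgd_mem k : X (x k).
Proof.
elim: k => // k IH; rewrite xS.
by have [] := eproj_dot_le0 (x k - alpha k *: G (x k) (z k)) clX cX IH.
Qed.

Let yX k : (K <= k <= K')%N -> X (y (tau k)).
Proof.
by move=> /andP[Kk kK]; apply: (flow_mem flow); rewrite !(tau_le alpha_bnd) Kk.
Qed.

Let M_ge0 : 0 <= M.
Proof. exact: le_trans ler01 M1. Qed.

Let Gam0 k : 0 <= Gam k.
Proof. exact: le_trans (le_trans ler01 M1) (Gam_ge k). Qed.

Let Gam1 k : 1 <= Gam k.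
Proof. exact: le_trans (Gam_ge k). Qed.

Lemma psgd_step k : enorm (x k.+1 - x k) <= alpha k * Gam k.
Proof.
rewrite -(@ler_pXn2r _ 2%N) ?nnegrE ?mulr_ge0 ?(ltW (alpha_gt0 k)) // enorm2 xS.
apply: le_trans (eproj_contract _ clX cX (psgd_mem k)) _.
rewrite addrC addKr -enorm2 enormN enormZ (gtr0_norm (alpha_gt0 k)).
rewrite ler_pXn2r ?nnegrE ?mulr_ge0 ?(ltW (alpha_gt0 k)) //.
by rewrite ler_wpM2l ?(ltW (alpha_gt0 k)) // G_bnd //; exact: psgd_mem.
Qed.

Lemma psgd_move i k : (i <= k)%N -> enorm (x k - x i) <= \sum_(i <= j < k) alpha j * Gam j.
Proof.
move=> ik; rewrite -(subnKC ik); elim: (k - i)%N => [|j IH].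
  by rewrite addn0 subrr enorm0 big_geq.
rewrite addnS big_nat_recr ?leq_addr //= addrC.
apply: le_trans (ler_enorm_dist (x (i + j)%N) _ _) _.
by apply: lerD => //; exact: psgd_step.
Qed.

(** The speed [M] is at most [Gam], so the sum that bounds the motion of the iterates also bounds
    that of the flow. *)
Lemma flow_move i k : (K <= i)%N -> (i <= k)%N -> (k <= K')%N ->
  enorm (y (tau k) - y (tau i)) <= \sum_(i <= j < k) alpha j * Gam j.
Proof.
move=> Ki ik kK.
apply: le_trans (flow_speed cX flow g_bnd _ _ _) _; rewrite ?(tau_le alpha_bnd) //.
rewrite tauB // mulr_sumr; apply: ler_sum => j _; rewrite mulrC.
by rewrite ler_wpM2l // ltW.
Qed.

(** The step is split in two: the flow moves while [x k] stays fixed, then the iterate moves while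
    the flow stays at time [tau k.+1]. The term in [g (x k)] from the first half and the term in [G]
    from the second combine into the noise [W]. *)
Lemma tracking_step k : (K <= k < K')%N ->
  e k.+1 ^+ 2 <= e k ^+ 2 + 4 * M * alpha k * e k ^+ 2
    - 2 * (alpha k * dot (v k) (W (x k) k)) + 7 * M * (alpha k ^+ 2 * Gam k ^+ 2).
Proof.
have m1 := M1; have m0 := M_ge0.
move=> /andP[Kk kK].
have a0 := alpha_gt0 k; have /andP[_ a2] := alpha_bnd k.
have Xx := psgd_mem k.
have Xy0 : X (y (tau k)) by apply: yX; rewrite Kk ltnW.
have Xy1 : X (y (tau k.+1)) by apply: yX; rewrite kK ltnW.
have ek0 : 0 <= e k by exact: enorm_ge0.
(* [c] bounds [dot (x k - y t) (g (y t))] during the whole step: [M ^+ 2 * alpha k] comes from the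
   motion of the flow, and [M * (e k + M * alpha k) ^+ 2] from replacing [g (y t)] by [g (x k)],
   simplified with [alpha k <= 1/2]. *)
pose c := dot (v k) (g (x k)) + 2 * M * e k ^+ 2 + (M ^+ 2 + M ^+ 3) * alpha k.
have Hc t : tau k < t < tau k.+1 -> dot (x k - y t) (g (y t)) <= c.
  move=> /andP[kt tk1].
  have Kt : tau K <= tau k by rewrite tau_le.
  have tK : tau k.+1 <= tau K' by rewrite tau_le.
  have Xt : X (y t) by apply: (flow_mem flow); lra.
  have dyt : enorm (y t - y (tau k)) <= M * alpha k.
    apply: le_trans (flow_speed cX flow g_bnd Kt (ltW kt) _) _; first lra.
    by rewrite ler_wpM2l //; move: tk1; rewrite tauS; lra.
  set d := y t - y (tau k) in dyt *.
  have Exy : x k - y t = v k - d by apply/rowP => j; rewrite /v /d !mxE; ring.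
  rewrite Exy.
  have -> : dot (v k - d) (g (y t)) =
      dot (v k) (g (x k)) + dot (- d) (g (x k)) + dot (v k - d) (g (y t) - g (x k)).
    by rewrite !(dotDl, dotDr, dotNl, dotNr); ring.
  have h1 : dot (- d) (g (x k)) <= M ^+ 2 * alpha k.
    apply: le_trans (cauchy_schwarz _ _) _; rewrite enormN.
    apply: le_trans (ler_pM _ _ dyt (g_bnd Xx)) _ => //; lra.
  have h2 : dot (v k - d) (g (y t) - g (x k)) <= M * (e k + M * alpha k) ^+ 2.
    apply: le_trans (cauchy_schwarz _ _) _.
    have vd : enorm (v k - d) <= e k + M * alpha k.
      by apply: le_trans (ler_enormB _ _) _; rewrite lerD2l.
    have yx : enorm (g (y t) - g (x k)) <= M * (e k + M * alpha k).
      apply: le_trans (g_lip Xt Xx) _; rewrite ler_wpM2l //.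
      by rewrite enormC Exy.
    apply: le_trans (ler_pM _ _ vd yx) _ => //.
    by rewrite expr2 mulrCA.
  rewrite /c; have : (e k + M * alpha k) ^+ 2 <= 2 * e k ^+ 2 + M ^+ 2 * alpha k.
    have : 0 <= (e k - M * alpha k) ^+ 2 by exact: sqr_ge0.
    have : alpha k * alpha k <= alpha k / 2 by nra.
    have : 0 <= M ^+ 2 by exact: sqr_ge0.
    by rewrite !expr2; nra.
  move=> h3; have : M * (e k + M * alpha k) ^+ 2 <= M * (2 * e k ^+ 2 + M ^+ 2 * alpha k).
    by rewrite ler_wpM2l //; try lra.
  by move: h1 h2; rewrite (exprS M 2); lra.
have tS : tau k.+1 - tau k = alpha k by rewrite tauS addrC addKr.
have F := flow_dist_le cX flow Xx X_diam _ (ltW (tau_ltS alpha_bnd k)) _ Hc.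
rewrite !(tau_le alpha_bnd) tS in F; have {}F := F Kk kK.
have P := eproj_contract (x k - alpha k *: G (x k) (z k)) clX cX Xy1.
rewrite -xS in P; rewrite /e /v enorm2.
apply: le_trans P _.
have -> : x k - alpha k *: G (x k) (z k) - y (tau k.+1) =
    (x k - y (tau k.+1)) - alpha k *: G (x k) (z k) by rewrite addrAC.
rewrite (dot_sqrB (x k - _)) !(dotZr, dotZl) -enorm2 enormC enorm2.
have h4 : - dot (x k - y (tau k.+1)) (G (x k) (z k)) <=
    - dot (v k) (G (x k) (z k)) + M * alpha k * Gam k.
  have -> : x k - y (tau k.+1) = v k - (y (tau k.+1) - y (tau k)).
    by apply/rowP => j; rewrite /v !mxE; ring.
  rewrite dotDl opprD lerD2l -dotNl opprK.
  apply: le_trans (cauchy_schwarz _ _) _.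
  apply: ler_pM => //; last exact: G_bnd.
  apply: le_trans (flow_speed cX flow g_bnd _ _ _) _; rewrite ?(tau_le alpha_bnd) //.
  by rewrite tS.
have h5 : dot (G (x k) (z k)) (G (x k) (z k)) <= Gam k ^+ 2.
  by rewrite -enorm2 ler_pXn2r ?nnegrE // G_bnd.
have vW : dot (v k) (W (x k) k) = dot (v k) (G (x k) (z k)) - dot (v k) (g (x k)).
  by rewrite /W dotDr dotNr.
have ek : e k ^+ 2 = dot (y (tau k) - x k) (y (tau k) - x k).
  by rewrite /e /v enormC enorm2.
rewrite -/(v k) -/(e k) vW ek.
move: F h4 h5 Hc; rewrite /c ek.
move: (dot (x k - y (tau k.+1)) (G (x k) (z k))) (dot (v k) (G (x k) (z k))).
move: (dot (v k) (g (x k))) (dot (G (x k) (z k)) (G (x k) (z k))).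
move: (dot (y (tau k.+1) - x k) (y (tau k.+1) - x k)) => d1 b1 b2 b3 b4 F h4 h5 _.
(* Since [M <= Gam k] and [1 <= M], the left side is at most [2 + 2 M + 2 + 1 <= 7 M] times
   [Gam k ^+ 2]. *)
have h6 : 2 * M ^+ 2 + 2 * M ^+ 3 + 2 * M * Gam k + Gam k ^+ 2 <= 7 * M * Gam k ^+ 2.
  have MG : M ^+ 2 <= Gam k ^+ 2 by rewrite ler_pXn2r ?nnegrE //; lra.
  have MG' : M * Gam k <= Gam k ^+ 2 by rewrite expr2 ler_wpM2r.
  have G2 : 0 <= Gam k ^+ 2 by exact: sqr_ge0.
  have : M * M ^+ 2 <= M * Gam k ^+ 2 by rewrite ler_wpM2l //; try lra.
  by rewrite -exprS; nra.
have h7 : alpha k ^+ 2 * (2 * M ^+ 2 + 2 * M ^+ 3 + 2 * M * Gam k + Gam k ^+ 2) <=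
   alpha k ^+ 2 * (7 * M * Gam k ^+ 2) by rewrite ler_wpM2l // sqr_ge0.
have h8 : alpha k ^+ 2 * b2 <= alpha k ^+ 2 * Gam k ^+ 2 by rewrite ler_wpM2l // sqr_ge0.
have h9 : 2 * alpha k * (- b3) <= 2 * alpha k * (- b4 + M * alpha k * Gam k).
  by rewrite ler_wpM2l //; try lra.
move: h7 h8 h9; rewrite !expr2; lra.
Qed.

Lemma tracking_sum m : (K <= m <= K')%N ->
  e m ^+ 2 <= \sum_(K <= k < m) 4 * M * alpha k * e k ^+ 2
    - 2 * \sum_(K <= k < m) alpha k * dot (v k) (W (x k) k)
    + 7 * M * \sum_(K <= k < m) alpha k ^+ 2 * Gam k ^+ 2.
Proof.
have m1 := M1; have m0 := M_ge0.
move=> /andP[Km]; rewrite -(subnKC Km); elim: (m - K)%N => [|j IH] jK.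
  by rewrite addn0 !big_geq // /e /v yK subrr enorm0; lra.
have jK' : (K + j < K')%N by rewrite -addnS.
rewrite addnS !big_nat_recr ?leq_addr //=.
have := IH (ltnW jK'); have := @tracking_step (K + j)%N; rewrite leq_addr jK'.
by move=> /(_ isT); lra.
Qed.

Let A i j := \sum_(i <= k < j) alpha k * Gam k.

Let A_ge0 i j : 0 <= A i j.
Proof. by apply: sumr_ge0 => k _; rewrite mulr_ge0 // ltW. Qed.

Let A_mono i k j : (i <= k)%N -> (k <= j)%N -> A i k <= A i j.
Proof.
move=> ik kj; rewrite /A (big_cat_nat ik kj) /= lerDl; apply: sumr_ge0 => l _.
by rewrite mulr_ge0 // ltW.
Qed.

Let vM k : (K <= k <= K')%N -> enorm (v k) <= M.
Proof. by move=> kK; apply: X_diam; [exact: psgd_mem | exact: yX]. Qed.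

(** A bound without cancellation, reserved for the unfinished piece that contains the current
    index. *)
Lemma noise_crude i j : (K <= i)%N -> (j <= K')%N ->
  `|\sum_(i <= k < j) alpha k * dot (v k) (W (x k) k)| <= M * A i j.
Proof.
have m1 := M1; have m0 := M_ge0.
move=> Ki jK; apply: le_trans (ler_norm_sum _ _ _) _.
rewrite mulr_sumr; apply: ler_sum_ord_nat => k /andP[ik kj].
rewrite normrM (gtr0_norm (alpha_gt0 k)) mulrCA ler_wpM2l ?(ltW (alpha_gt0 k)) //.
apply: le_trans (cauchy_schwarz_abs _ _) _.
apply: ler_pM => //; last by apply: W_bnd; exact: psgd_mem.
by apply: vM; rewrite (leq_trans Ki ik) (leq_trans (ltnW kj)).
Qed.

Lemma noise_frozen i j : (K <= i)%N -> (i <= j)%N -> (j <= K')%N ->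
  `|\sum_(i <= k < j) alpha k * dot (v k) (W (x k) k)| <=
  4 * M * A i j ^+ 2 + M * enorm (\sum_(i <= k < j) alpha k *: W (x i) k).
Proof.
have m1 := M1; have m0 := M_ge0.
move=> Ki ij jK.
have -> : \sum_(i <= k < j) alpha k * dot (v k) (W (x k) k) =
   \sum_(i <= k < j) alpha k * (dot (v k - v i) (W (x k) k) +
       dot (v i) (W (x k) k - W (x i) k)) +
   dot (v i) (\sum_(i <= k < j) alpha k *: W (x i) k).
  rewrite dot_sumr -big_split; apply: eq_bigr => k _ /=.
  by rewrite !(dotDl, dotDr, dotNl, dotNr, dotZr); ring.
apply: le_trans (ler_normD _ _) _; apply: lerD; last first.
  apply: le_trans (cauchy_schwarz_abs _ _) _; rewrite ler_wpM2r //.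
  by apply: vM; rewrite Ki (leq_trans ij).
apply: le_trans (ler_norm_sum _ _ _) _.
(* Changing [v k] costs [2 A Gam] and changing the state inside [W] costs [2 M ^+ 2 A]; as
   [1 <= M <= Gam], both are at most [2 M A Gam]. *)
have -> : 4 * M * A i j ^+ 2 = \sum_(i <= k < j) alpha k * Gam k * (4 * M * A i j).
  by rewrite -mulr_suml -/(A i j) expr2; ring.
apply: ler_sum_ord_nat => k /andP[ik kj].
have kK : (k <= K')%N by rewrite (leq_trans (ltnW kj)).
rewrite normrM (gtr0_norm (alpha_gt0 k)) -mulrA ler_wpM2l ?(ltW (alpha_gt0 k)) //.
apply: le_trans (ler_normD _ _) _.
have xm : enorm (x k - x i) <= A i j.
  by apply: le_trans (psgd_move ik) _; apply: A_mono => //; exact: ltnW.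
have ym : enorm (y (tau k) - y (tau i)) <= A i j.
  by apply: le_trans (flow_move Ki ik kK) _; apply: A_mono => //; exact: ltnW.
have vm : enorm (v k - v i) <= 2 * A i j.
  have -> : v k - v i = (x k - x i) - (y (tau k) - y (tau i)).
    by rewrite /v; apply/rowP => l; rewrite !mxE; ring.
  by apply: le_trans (ler_enormB _ _) _; lra.
have Wm : enorm (W (x k) k - W (x i) k) <= 2 * M * A i j.
  have -> : W (x k) k - W (x i) k = (G (x k) (z k) - G (x i) (z k)) - (g (x k) - g (x i)).
    by rewrite /W; apply/rowP => l; rewrite !mxE; ring.
  apply: le_trans (ler_enormB _ _) _.
  have := G_lip (z k) (psgd_mem k) (psgd_mem i); have := g_lip (psgd_mem k) (psgd_mem i).
  have : M * enorm (x k - x i) <= M * A i j by rewrite ler_wpM2l //; try lra.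
  lra.
have t1 : `|dot (v k - v i) (W (x k) k)| <= 2 * A i j * Gam k.
  apply: le_trans (cauchy_schwarz_abs _ _) _; apply: ler_pM => //.
  by apply: W_bnd; exact: psgd_mem.
have t2 : `|dot (v i) (W (x k) k - W (x i) k)| <= M * (2 * M * A i j).
  apply: le_trans (cauchy_schwarz_abs _ _) _; apply: ler_pM => //.
  by apply: vM; rewrite Ki (leq_trans ij).
have : M * (2 * M * A i j) <= Gam k * (2 * M * A i j).
  by rewrite ler_wpM2r // mulr_ge0 //; lra.
have : 2 * A i j * Gam k <= 2 * A i j * Gam k * M.
  by rewrite ler_peMr // mulr_ge0 // mulr_ge0.
lra.
Qed.

(** The net point near [x i] depends on the path. Summing over all of [F] removes this dependence
    and leaves only deterministic states. *)
Lemma noise_net i j (F : seq 'rV[R]_n) (eps : R) : 0 <= eps ->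
  (forall s, s \in F -> X s) ->
  (forall s, X s -> exists2 s', s' \in F & enorm (s - s') <= eps) ->
  (K <= i)%N -> (i <= j)%N -> (j <= K')%N ->
  `|\sum_(i <= k < j) alpha k * dot (v k) (W (x k) k)| <=
  4 * M * A i j ^+ 2 + M * \sum_(s <- F) enorm (\sum_(i <= k < j) alpha k *: W s k)
    + 2 * M ^+ 2 * eps * (tau j - tau i).
Proof.
have m1 := M1; have m0 := M_ge0.
move=> eps0 FX net Ki ij jK; apply: le_trans (noise_frozen Ki ij jK) _.
rewrite -addrA lerD2l.
suff H : enorm (\sum_(i <= k < j) alpha k *: W (x i) k) <=
    \sum_(s <- F) enorm (\sum_(i <= k < j) alpha k *: W s k)
    + 2 * M * eps * (tau j - tau i).
  apply: le_trans (ler_wpM2l _ H) _; first lra.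
  by rewrite mulrDr lerD2l; lra.
have [s sF xs] := net _ (psgd_mem i).
apply: (@le_trans _ _ (enorm (\sum_(i <= k < j) alpha k *: W s k)
    + 2 * M * eps * (tau j - tau i))); last first.
  by rewrite lerD2r (big_rem s sF) /= lerDl sumr_ge0.
rewrite -lerBlDl.
apply: (@le_trans _ _ (enorm (\sum_(i <= k < j) alpha k *: W (x i) k -
     \sum_(i <= k < j) alpha k *: W s k))).
  by apply: le_trans (ler_dist_enorm _ _); exact: ler_norm.
rewrite -sumrB tauB // mulr_sumr; apply: le_trans (ler_enorm_sum _ _ _) _.
apply: ler_sum => k _; rewrite -scalerBr enormZ (gtr0_norm (alpha_gt0 k)) mulrC.
rewrite ler_wpM2r ?(ltW (alpha_gt0 k)) //.
have -> : W (x i) k - W s k = (G (x i) (z k) - G s (z k)) - (g (x i) - g s).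
  by rewrite /W; apply/rowP => l; rewrite !mxE; ring.
apply: le_trans (ler_enormB _ _) _.
have := G_lip (z k) (psgd_mem i) (FX _ sF); have := g_lip (psgd_mem i) (FX _ sF).
have : M * enorm (x i - s) <= M * eps by rewrite ler_wpM2l //; try lra.
lra.
Qed.

(** Up to an index [j], the noise is a sum over complete pieces, bounded by [noise_net], and over
    one unfinished piece, bounded by [noise_crude] through [Abar]. The [max] with 0 covers [J = 0],
    where [Abar] is unconstrained. *)
Lemma window_tracking (a : nat -> nat) (J : nat) (F : seq 'rV[R]_n) (eps Abar : R) :
  0 <= eps -> (forall s, s \in F -> X s) ->
  (forall s, X s -> exists2 s', s' \in F & enorm (s - s') <= eps) ->
  tau K' - tau K <= 1 -> a 0%N = K -> a J = K' -> (forall q, (a q <= a q.+1)%N) ->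
  (forall q, (q < J)%N -> A (a q) (a q.+1) <= Abar) ->
  forall m, (K <= m <= K')%N ->
  e m ^+ 2 <= (15 * M * \sum_(0 <= q < J) A (a q) (a q.+1) ^+ 2
    + 2 * M * \sum_(0 <= q < J) \sum_(s <- F)
         enorm (\sum_(a q <= k < a q.+1) alpha k *: W s k)
    + 4 * M ^+ 2 * eps + 2 * M * Num.max 0 Abar) * expR (4 * M).
Proof.
have m1 := M1; have m0 := M_ge0.
move=> eps0 FX net tK1 a0 aJ aS HA m /andP[Km mK].
pose P q := 4 * M * A (a q) (a q.+1) ^+ 2 + M * \sum_(s <- F)
         enorm (\sum_(a q <= k < a q.+1) alpha k *: W s k)
         + 2 * M ^+ 2 * eps * (tau (a q.+1) - tau (a q)).
have ale := homo_leq (@leqnn) leq_trans aS.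
have P0 q : 0 <= P q.
  have : 0 <= tau (a q.+1) - tau (a q) by rewrite subr_ge0 tau_le.
  have : 0 <= \sum_(s <- F) enorm (\sum_(a q <= k < a q.+1) alpha k *: W s k).
    by apply: sumr_ge0.
  have : 0 <= A (a q) (a q.+1) ^+ 2 by exact: sqr_ge0.
  move=> h1 h2 h3; rewrite /P !addr_ge0 ?mulr_ge0 ?sqr_ge0 //; lra.
have Ka q : (K <= a q)%N by rewrite -a0 ale.
have aK q : (q <= J)%N -> (a q <= K')%N by move=> qJ; rewrite -aJ ale.
pose Nz i j := \sum_(i <= k < j) alpha k * dot (v k) (W (x k) k).
have full q : (q <= J)%N -> `|Nz K (a q)| <= \sum_(0 <= l < q) P l.
  elim: q => [|q IH] qJ; first by rewrite /Nz a0 !big_geq // normr0.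
  rewrite big_nat_recr //= /Nz (big_cat_nat (Ka q) (aS q)) /=.
  apply: le_trans (ler_normD _ _) _; apply: lerD; first exact/IH/ltnW.
  exact: (noise_net eps0 FX net (Ka q) (aS q) (aK q.+1 qJ)).
pose Sum := \sum_(0 <= l < J) P l.
have noise j : (K <= j <= m)%N -> `|Nz K j| <= Sum + M * Num.max 0 Abar.
  move=> /andP[Kj jm]; have jK := leq_trans jm mK.
  have MA0 : 0 <= M * Num.max 0 Abar by rewrite mulr_ge0 ?le_max ?lexx //; lra.
  (* The pieces are half open, so the end [K'] lies in none of them; there all pieces are
     complete. *)
  have [jK'|jK'] := eqVneq j K'.
    by rewrite jK' -aJ ler_wpDr // full.
  have [q qJ /andP[qj jq]] : exists2 q, (q < J)%N & (a q <= j < a q.+1)%N.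
    have ex : exists q, (j < a q)%N by exists J; rewrite aJ ltn_neqAle jK'.
    case: (ex_minnP ex) => -[|q] jq qmin; first by move: jq; rewrite a0 ltnNge Kj.
    exists q.
      by rewrite -ltnS (leq_ltn_trans (qmin J _)) // aJ ltn_neqAle jK'.
    rewrite jq andbT leqNgt; apply/negP => /qmin; by rewrite ltnn.
  rewrite /Nz (big_cat_nat (Ka q) qj) /=; apply: le_trans (ler_normD _ _) _.
  apply: lerD.
    apply: le_trans (full q (ltnW qJ)) _.
    rewrite /Sum (big_cat_nat (leq0n q) (ltnW qJ)) /= lerDl; exact: sumr_ge0.
  apply: le_trans (noise_crude (Ka q) jK) _; rewrite ler_wpM2l //.
  rewrite le_max; apply/orP; right; apply: le_trans (HA q qJ).
  by apply: A_mono => //; exact: ltnW.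
(* On each piece, a sum of squares of nonnegative numbers is at most the square of their sum. *)
have quad : \sum_(K <= k < K') alpha k ^+ 2 * Gam k ^+ 2 <=
    \sum_(0 <= q < J) A (a q) (a q.+1) ^+ 2.
  have H q : (q <= J)%N -> \sum_(K <= k < a q) alpha k ^+ 2 * Gam k ^+ 2 <=
      \sum_(0 <= q < q) A (a q) (a q.+1) ^+ 2.
    elim: q => [|q IH] qJ; first by rewrite a0 !big_geq.
    rewrite big_nat_recr //= (big_cat_nat (Ka q) (aS q)) /=; apply: lerD.
      exact/IH/ltnW.
    rewrite [leRHS]expr2 {1}/A mulr_suml; apply: ler_sum_ord_nat => k /andP[qk kq].
    rewrite -exprMn expr2 ler_wpM2l ?mulr_ge0 ?(ltW (alpha_gt0 k)) //.
    rewrite /A (big_cat_nat qk (ltnW kq)) /= [X in _ + X]big_ltn // addrCA lerDl addr_ge0 //;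
      by apply: sumr_ge0 => l _; rewrite mulr_ge0 // ltW.
  by rewrite -aJ; exact: H.
have tele : \sum_(0 <= q < J) (tau (a q.+1) - tau (a q)) <= 1.
  by rewrite telescope_sumr // a0 aJ.
set SA := \sum_(0 <= q < J) A (a q) (a q.+1) ^+ 2 in quad *.
set SW := \sum_(0 <= q < J) \sum_(s <- F) _.
have SumE : Sum = 4 * M * SA + M * SW + 2 * M ^+ 2 * eps *
    \sum_(0 <= q < J) (tau (a q.+1) - tau (a q)).
  by rewrite /Sum /P [LHS]big_split /= [X in X + _ = _]big_split /= -!mulr_sumr.

have Sum_le : Sum <= 4 * M * SA + M * SW + 2 * M ^+ 2 * eps.
  by rewrite SumE lerD2l ler_piMr // !mulr_ge0 // sqr_ge0.
have SA0 : 0 <= SA by apply: sumr_ge0 => q _; exact: sqr_ge0.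
have SW0 : 0 <= SW by apply: sumr_ge0 => q _; exact: sumr_ge0.
have mx0 : 0 <= Num.max 0 Abar by rewrite le_max lexx.
set B := (_ + _ + _ + _).
have B0 : 0 <= B by rewrite /B !addr_ge0 // !mulr_ge0 ?sqr_ge0 //; lra.
have M40 : 0 <= 4 * M by lra.
have a0' k : 0 <= alpha k by exact: ltW.
have HE j : (K <= j <= m)%N ->
    e j ^+ 2 <= B + \sum_(K <= k < j) 4 * M * alpha k * e k ^+ 2.
  move=> /[dup] /noise; rewrite /Nz => Hj /andP[Kj jm].
  have := @tracking_sum j; rewrite Kj (leq_trans jm mK) => /(_ isT).
  have : \sum_(K <= k < j) alpha k ^+ 2 * Gam k ^+ 2 <= SA.
    apply: le_trans quad; rewrite [leRHS](big_cat_nat Kj (leq_trans jm mK)) /= lerDl.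
    by apply: sumr_ge0 => k _; rewrite mulr_ge0 ?sqr_ge0.
  move=> q1; have : 7 * M * \sum_(K <= k < j) alpha k ^+ 2 * Gam k ^+ 2 <= 7 * M * SA.
    by rewrite ler_wpM2l //; try lra.
  move: Hj; rewrite ler_norml => /andP[h1 _]; rewrite /B; lra.
apply: le_trans (discrete_gronwall B0 M40 a0' Km HE) _.
rewrite ler_wpM2l // ler_expR ler_piMr //; rewrite -tauB //.
by apply: le_trans tK1; rewrite lerD2r tau_le.
Qed.

End Window.

(** * Cutting a window into short pieces *)

Section Pieces.
Context {R : realType}.
Variable alpha : nat -> R.
Hypothesis alpha_bnd : forall k, 0 < alpha k <= 2^-1.
Local Notation tau := (tau alpha).

(** Piece [q] starts at the first index where the elapsed time reaches [q / J], or at [K'] if there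
    is none. A piece can overshoot [1 / J] by at most one step, whence [amax]; late pieces may be
    empty. *)
Lemma window_pieces (K K' J : nat) (amax : R) : (K <= K')%N -> (0 < J)%N ->
  tau K' - tau K <= 1 -> 0 <= amax -> (forall k, (K <= k)%N -> alpha k <= amax) ->
  exists a : nat -> nat, [/\ a 0%N = K, a J = K', forall q, (a q <= a q.+1)%N &
    forall q, tau (a q.+1) - tau (a q) <= J%:R^-1 + amax].
Proof.
move=> KK' J0 t1 am0 Ha.
have Jr : 0 < J%:R^-1 :> R by rewrite invr_gt0 ltr0n.
pose P q k := (K <= k)%N && ((k == K') || (q%:R * J%:R^-1 <= tau k - tau K)).
have exP q : exists k, P q k by exists K'; rewrite /P KK' eqxx.
have /choice [a Ha'] : forall q, exists k, P q k /\ forall j, P q j -> (k <= j)%N.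
  by move=> q; case: (ex_minnP (exP q)) => k Pk kmin; exists k.
have aK' q : (a q <= K')%N by apply: (Ha' q).2; rewrite /P KK' eqxx.
have aS q : (a q <= a q.+1)%N.
  apply: (Ha' q).2; have [/andP[Ka /orP[/eqP aE|aq]] _] := Ha' q.+1.
    by rewrite /P Ka aE eqxx.
  rewrite /P Ka; apply/orP; right; apply: le_trans aq.
  by rewrite ler_wpM2r ?(ltW Jr) // ler_nat.
exists a; split => //.
- apply/eqP; rewrite eqn_leq; apply/andP; split; last by have [/andP[]] := Ha' 0%N.
  by apply: (Ha' 0%N).2; rewrite /P leqnn mul0r subrr lexx orbT.
- have [/andP[Ka /orP aK] _] := Ha' J; case: aK => [/eqP //|].
  rewrite divff ?pnatr_eq0 -?lt0n // => aJ; apply/eqP.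
  rewrite eqn_leq aK' /= -(tau_le alpha_bnd); lra.
- move=> q; have := aS q; rewrite leq_eqVlt => /orP[/eqP <-|aq].
    by rewrite subrr addr_ge0 // ltW.
  have [/andP[Ka /orP[/eqP aE|tq]] _] := Ha' q.
    by move: aq; rewrite aE ltnNge aK'.
  have [_ amin] := Ha' q.+1.
  case E : (a q.+1) aq amin => [//|k] kq amin; rewrite ltnS in kq.
  have Kk := leq_trans Ka kq.
  have : ~~ P q.+1 k by apply/negP => /amin; rewrite ltnn.
  rewrite /P Kk /= negb_or => /andP[_]; rewrite -ltNge -natr1 mulrDl mul1r => tk.
  by rewrite tauS; have := Ha k Kk; lra.
Qed.

End Pieces.

(** Turns first powers into squares, whose expectations are variances, at the price of a constant
    that is chosen later. *)
Lemma amgm_norm (R : realType) (s kappa : R) : 0 < kappa -> `|s| <= kappa + s ^+ 2 / kappa.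
Proof.
move=> k0; rewrite -(ler_pM2r k0) mulrDl divfK ?gt_eqF // -(real_normK (num_real s)).
move: (normr_ge0 s); move: `|s| => a a0.
have ak : 0 <= a * kappa by rewrite mulr_ge0 // ltW.
by have := sqr_ge0 (a - kappa); rewrite !expr2; lra.
Qed.

(** * Tracking error in terms of centred sums *)

Section WindowFluctuation.
Context {R : realType} {n p : nat}.
Variables (alpha : nat -> R) (X : set 'rV[R]_n).
Variables (G : 'rV[R]_n -> 'rV[R]_p -> 'rV[R]_n) (g : 'rV[R]_n -> 'rV[R]_n).
Variables (M : R) (z : nat -> 'rV[R]_p) (x : nat -> 'rV[R]_n) (Gam mG : nat -> R).
Variables (K K' : nat) (y : R -> 'rV[R]_n).
Local Notation tau := (tau alpha).
Hypothesis alpha_bnd : forall k, 0 < alpha k <= 2^-1.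
Hypothesis clX : closed X.
Hypothesis cX : @convex_set R 'rV[R]_n X.
Hypothesis M1 : 1 <= M.
Hypothesis X_diam : forall s s', X s -> X s' -> enorm (s - s') <= M.
Hypothesis g_bnd : forall s, X s -> enorm (g s) <= M.
Hypothesis g_lip : forall s s', X s -> X s' -> enorm (g s - g s') <= M * enorm (s - s').
Hypothesis G_lip : forall s s' u, X s -> X s' ->
  enorm (G s u - G s' u) <= M * enorm (s - s').
Hypothesis Gam_ge : forall k, M <= Gam k.
Hypothesis G_bnd : forall s k, X s -> enorm (G s (z k)) <= Gam k.
Hypothesis W_bnd : forall s k, X s -> enorm (G s (z k) - g s) <= Gam k.
Hypothesis x0X : X (x 0%N).
Hypothesis xS : forall k, x k.+1 = eproj X (x k - alpha k *: G (x k) (z k)).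
Hypothesis KK' : (K <= K')%N.
Hypothesis flow : projected_gradient_flow X g (tau K) (tau K') y.
Hypothesis yK : y (tau K) = x K.

Definition noise_part (i j : nat) (s : 'rV[R]_n) (c : 'I_n) : R :=
  \sum_(i <= k < j) alpha k * (G s (z k) - g s) 0 c.

(** [mG] is meant to be the mean of [Gam], so this is the random part of the distance moved on a
    piece. *)
Definition size_part (i j : nat) : R := \sum_(i <= k < j) alpha k * (Gam k - mG k).

Definition fluctuation (a : nat -> nat) (J : nat) (F : seq 'rV[R]_n) : R :=
  \sum_(0 <= q < J) (size_part (a q) (a q.+1) ^+ 2 +
    \sum_(s <- F) \sum_(c < n) noise_part (a q) (a q.+1) s c ^+ 2).

(** Every other term on the right is deterministic and can be made small in turn: first by a large
    [J], then by a small [eps], which fixes the net [F], and last by a small [kappa], whose factor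
    depends on [J] and [F]. *)
Lemma window_tracking_fluctuation (a : nat -> nat) (J : nat) (F : seq 'rV[R]_n)
    (eps kappa Mg : R) :
  0 <= eps -> 0 < kappa -> 0 <= Mg -> (0 < J)%N -> (forall k, mG k <= Mg) ->
  (forall s, s \in F -> X s) ->
  (forall s, X s -> exists2 s', s' \in F & enorm (s - s') <= eps) ->
  tau K' - tau K <= 1 -> a 0%N = K -> a J = K' -> (forall q, (a q <= a q.+1)%N) ->
  (forall q, tau (a q.+1) - tau (a q) <= 2 * J%:R^-1) ->
  forall m, (K <= m <= K')%N ->
  enorm (x m - y (tau m)) ^+ 2 <=
    ((120 * M * Mg ^+ 2 + 4 * M * Mg) * J%:R^-1
     + 2 * M * (J%:R * (size F)%:R * n%:R + 1) * kappa + 4 * M ^+ 2 * eps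
     + (30 * M + 2 * M / kappa) * fluctuation a J F) * expR (4 * M).
Proof.
move=> eps0 k0 Mg0 J0 HmG FX net t1 a0 aJ aS at2 m Km.
have m1 := M1; have m0 : 0 <= M by lra.
have Jr : 0 < J%:R^-1 :> R by rewrite invr_gt0 ltr0n.
have JJ : J%:R * J%:R^-1 = 1 :> R by rewrite divff // pnatr_eq0 -lt0n.
have al0 k : 0 <= alpha k by case/andP: (alpha_bnd k) => /ltW.
pose th := 2 * J%:R^-1 : R.
have th0 : 0 <= th by rewrite /th; lra.
pose A q := \sum_(a q <= k < a q.+1) alpha k * Gam k.
pose S0 q := size_part (a q) (a q.+1).
have A0 q : 0 <= A q.
  by apply: sumr_ge0 => k _; rewrite mulr_ge0 // (le_trans m0).
have HA q : A q <= `|S0 q| + Mg * th.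
  apply: (@le_trans _ _ (S0 q + Mg * (tau (a q.+1) - tau (a q)))).
    rewrite tauB // mulr_sumr -big_split; apply: ler_sum => k _ /=.
    have : alpha k * mG k <= alpha k * Mg by rewrite ler_wpM2l.
    lra.
  by rewrite lerD ?ler_norm // ler_wpM2l.
pose ZS := \sum_(0 <= q < J) S0 q ^+ 2.
pose ZN := \sum_(0 <= q < J) \sum_(s <- F) \sum_(c < n)
  noise_part (a q) (a q.+1) s c ^+ 2.
have ZE : fluctuation a J F = ZS + ZN by rewrite /fluctuation big_split.
have ZS0 : 0 <= ZS by apply: sumr_ge0 => q _; exact: sqr_ge0.
have ZN0 : 0 <= ZN.
  by do 3 (apply: sumr_ge0 => ? _); exact: sqr_ge0.
(* The maximum over the pieces is replaced by the sum [ZS] of all squares. *)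
have Abar q : (q < J)%N -> A q <= Mg * th + kappa + ZS / kappa.
  move=> qJ; apply: le_trans (HA q) _; rewrite addrC -!addrA lerD2l.
  apply: le_trans (amgm_norm _ k0) _; rewrite lerD2l ler_wpM2r ?invr_ge0 ?(ltW k0) //.
  rewrite /ZS (big_cat_nat (leq0n q) (ltnW qJ)) /= [X in _ + X]big_ltn //=.
  by rewrite addrCA lerDl addr_ge0 // sumr_ge0 // => ? _; exact: sqr_ge0.
have mx : Num.max 0 (Mg * th + kappa + ZS / kappa) = Mg * th + kappa + ZS / kappa.
  apply/max_idPr; rewrite !addr_ge0 ?mulr_ge0 ?invr_ge0 //; exact: ltW.
have := window_tracking alpha_bnd clX cX M1 X_diam g_bnd g_lip G_lip Gam_ge G_bnd W_bnd
  x0X xS flow yK eps0 FX net t1 a0 aJ aS Abar Km.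
rewrite mx => H; apply: le_trans H _; rewrite ler_wpM2r ?expR_ge0 //.
set SA := \sum_(0 <= q < J) _ ^+ 2; set SW := \sum_(0 <= q < J) \sum_(s <- F) enorm _.
have hSA : SA <= 2 * ZS + 8 * Mg ^+ 2 * J%:R^-1.
  have -> : 8 * Mg ^+ 2 * J%:R^-1 = \sum_(0 <= q < J) 2 * (Mg * th) ^+ 2.
    rewrite sumr_const_nat subn0 -[in RHS]mulr_natl /th.
    transitivity (8 * Mg ^+ 2 * J%:R^-1 * (J%:R * J%:R^-1)); last ring.
    by rewrite JJ mulr1.
  rewrite /ZS mulr_sumr -big_split; apply: ler_sum => q _ /=.
  have : A q ^+ 2 <= (`|S0 q| + Mg * th) ^+ 2.
    by rewrite ler_pXn2r ?nnegrE // ?HA // addr_ge0 // mulr_ge0.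
  have : 0 <= (`|S0 q| - Mg * th) ^+ 2 by exact: sqr_ge0.
  rewrite -[S0 q ^+ 2](real_normK (num_real _)) -/(A q).
  rewrite sqrrB sqrrD; lra.
have hSW : SW <= J%:R * (size F)%:R * n%:R * kappa + ZN / kappa.
  have -> : J%:R * (size F)%:R * n%:R * kappa = \sum_(0 <= q < J) (size F)%:R * n%:R * kappa.
    by rewrite sumr_const_nat subn0 -[RHS]mulr_natl; ring.
  rewrite /ZN mulr_suml -big_split; apply: ler_sum => q _ /=.
  have -> : (size F)%:R * n%:R * kappa = \sum_(s <- F) n%:R * kappa.
    by rewrite big_const_seq count_predT iter_addr_0 -[RHS]mulr_natl; ring.
  rewrite mulr_suml -big_split; apply: ler_sum => s _ /=.
  have -> : n%:R * kappa = \sum_(c < n) kappa.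
    by rewrite sumr_const card_ord -[RHS]mulr_natl.
  rewrite mulr_suml -big_split; apply: le_trans (enorm_sum_coord _) _.
  apply: ler_sum => c _ /=.
  have <- : noise_part (a q) (a q.+1) s c =
      (\sum_(a q <= k < a q.+1) alpha k *: (G s (z k) - g s)) 0 c.
    by rewrite summxE; apply: eq_bigr => k _; rewrite !mxE.
  exact: amgm_norm.
have h1 : 15 * M * SA <= 15 * M * (2 * ZS + 8 * Mg ^+ 2 * J%:R^-1).
  by rewrite ler_wpM2l // mulr_ge0.
have h2 : 2 * M * SW <= 2 * M * (J%:R * (size F)%:R * n%:R * kappa + ZN / kappa).
  by rewrite ler_wpM2l // mulr_ge0.
have h3 : 0 <= 30 * M * ZN by rewrite !mulr_ge0.
rewrite ZE; move: h1 h2; rewrite /th; lra.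
Qed.

End WindowFluctuation.

(** * The subdifferential gap along a path *)

Section Gap.
Context {R : realType} {n : nat}.
Variables (alpha : nat -> R) (X : set 'rV[R]_n) (phi : 'rV[R]_n -> R) (M : R).
Variables (x : nat -> 'rV[R]_n) (y : nat -> R -> 'rV[R]_n) (K wi : nat -> nat).
Local Notation tau := (tau alpha).
Local Notation g := (grad phi).
Hypothesis alpha_bnd : forall k, 0 < alpha k <= 2^-1.
Hypothesis cX : @convex_set R 'rV[R]_n X.
Hypothesis M1 : 1 <= M.
Hypothesis X_diam : forall s s', X s -> X s' -> enorm (s - s') <= M.
Hypothesis g_bnd : forall s, X s -> enorm (g s) <= M.
Hypothesis g_lip : forall s s', X s -> X s' -> enorm (g s - g s') <= M * enorm (s - s').
Hypothesis phi_lip : forall s s', X s -> X s' -> `|phi s - phi s'| <= M * enorm (s - s').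
Hypothesis phi_diff : forall s, X s -> differentiable phi s.
Hypothesis xX : forall k, X (x k).
Hypothesis K0 : K 0%N = 0%N.
Hypothesis KS : forall i, (K i < K i.+1)%N.
Hypothesis KE : forall i, breakpoint alpha i = tau (K i).
Hypothesis Kt : forall i, 2^-1 <= tau (K i.+1) - tau (K i) <= 1.
Hypothesis Kwi : forall k, (K (wi k) <= k < K (wi k).+1)%N.
Hypothesis flow : forall i,
  projected_gradient_flow X g (tau (K i)) (tau (K i.+1)) (y i).
Hypothesis yK : forall i, y i (tau (K i)) = x (K i).

Local Notation b := (deviation alpha x y).
Let gap k := dist_to (- g (x k)) (goldstein_indicator X (b k) (x k)).

Let M0 : 0 <= M.
Proof. exact: le_trans ler01 M1. Qed.

Let alpha_gt0 k : 0 < alpha k.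
Proof. by case/andP: (alpha_bnd k). Qed.

Lemma dist_to_ge0 (v : 'rV[R]_n) S : 0 <= dist_to v S.
Proof.
rewrite /dist_to; have [->|S0] := eqVneq S set0.
  by rewrite image_set0 inf0.
apply: lb_le_inf; first by apply: image_nonempty; exact/set0P.
by move=> _ [s _ <-].
Qed.

Lemma dist_to_le (v s : 'rV[R]_n) (S : set 'rV[R]_n) : S s -> dist_to v S <= enorm (v - s).
Proof.
move=> Ss; apply: ge_inf; last by exists s.
by exists 0 => _ [u _ <-].
Qed.

Let window_tau k t : tau k <= t < tau k.+1 ->
  tau (K (wi k)) <= t <= tau (K (wi k).+1).
Proof.
move=> /andP[kt tk]; have /andP[a1 a2] := Kwi k.
apply/andP; split; first by apply: le_trans kt; rewrite tau_le.
by apply: ltW; apply: lt_le_trans tk _; rewrite tau_le.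
Qed.

Let restartedE k t : tau k <= t < tau k.+1 -> restarted alpha y t = y (wi k) t.
Proof. by move=> kt; exact: (restarted_window alpha_bnd _ KS KE (Kwi k)). Qed.

Let has_sup_dev k : has_sup [set enorm (restarted alpha y t - embed alpha x (tau k))
      | t in [set t | tau k <= t < tau k.+1]].
Proof.
split.
  exists (enorm (restarted alpha y (tau k) - embed alpha x (tau k))), (tau k) => //=.
  by rewrite lexx tau_ltS.
exists M => _ [t /= kt <-]; rewrite (restartedE kt) embed_tau //; apply: X_diam => //.
exact: (flow_mem (flow (wi k)) (window_tau kt)).
Qed.

Lemma deviation_ge k t : tau k <= t < tau k.+1 -> enorm (y (wi k) t - x k) <= b k.
Proof.
move=> kt; apply: ub_le_sup; first by have [] := has_sup_dev k.
by exists t => //; rewrite (restartedE kt) embed_tau.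
Qed.

Lemma deviation_ge0 k : 0 <= b k.
Proof.
by apply: le_trans (@deviation_ge k (tau k) _) => //; rewrite lexx tau_ltS.
Qed.

Lemma deviation_le k (B : R) :
  (forall t, tau k <= t < tau k.+1 -> enorm (y (wi k) t - x k) <= B) -> b k <= B.
Proof.
move=> H; apply: ge_sup; first by have [] := has_sup_dev k.
by move=> _ [t kt <-]; rewrite (restartedE kt) embed_tau // H.
Qed.

Lemma deviation_diam k : b k <= M.
Proof.
apply: deviation_le => t kt; apply: X_diam => //.
exact: (flow_mem (flow (wi k)) (window_tau kt)).
Qed.

Lemma deviation_tracking k :
  b k <= enorm (x k - y (wi k) (tau k)) + M * alpha k.
Proof.
apply: deviation_le => t /[dup] kt /andP[t1 t2].
apply: le_trans (ler_enorm_dist (y (wi k) (tau k)) _ _) _.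
rewrite addrC (enormC _ (x k)) lerD2l.
have /andP[w1 w2] := window_tau kt; have /andP[a1 a2] := Kwi k.
apply: le_trans (flow_speed cX (flow (wi k)) g_bnd _ t1 w2) _.
  by rewrite tau_le.
by rewrite ler_wpM2l //; move: t2; rewrite tauS; lra.
Qed.

Lemma gap_energy k :
  alpha k * gap k ^+ 2 <= 2 * M ^+ 2 * (alpha k * b k ^+ 2) +
    2 * (phi (y (wi k) (tau k)) - phi (y (wi k) (tau k.+1))).
Proof.
have m0 := M0; have a0 := alpha_gt0 k.
have gap0 : 0 <= gap k by exact: dist_to_ge0.
have b0 := deviation_ge0 k.
(* [m] bounds the speed from below throughout the step. At each flow point [s], the normal vector
   [- g s - q] lies in the Goldstein set, hence [gap k <= M * b k + enorm q]. *)
pose m := Num.max 0 (gap k - M * b k).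
have m_ge0 : 0 <= m by rewrite le_max lexx.
have gapm : gap k <= M * b k + m.
  by rewrite /m; have [] := leP 0 (gap k - M * b k); nra.
have /andP[a1 a2] := Kwi k.
have e : m ^+ 2 * (tau k.+1 - tau k) <=
    phi (y (wi k) (tau k)) - phi (y (wi k) (tau k.+1)).
  apply: (flow_energy_le cX (flow (wi k)) phi_lip phi_diff) => //.
  - by rewrite tau_le.
  - exact/ltW/tau_ltS.
  - by rewrite tau_le.
  move=> t /andP[t1 t2]; have kt : tau k <= t < tau k.+1 by rewrite ltW.
  rewrite /m ge_max enorm_ge0 /= lerBlDl.
  set s := y (wi k) t; set q := eproj _ _.
  have Xs : X s by exact: (flow_mem (flow (wi k)) (window_tau kt)).
  have [_ nc] := eproj_tangent_cone (- g s) cX Xs.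
  apply: le_trans (@dist_to_le _ (- g s - q) _ _) _.
    by apply: sub_gen_smallest; exists s => //; exact: deviation_ge.
  rewrite (_ : - g (x k) - (- g s - q) = (g s - g (x k)) + q); last first.
    by apply/rowP => j; rewrite !mxE; ring.
  apply: le_trans (ler_enormD _ _) _; rewrite lerD2r.
  apply: le_trans (g_lip Xs (xX k)) _; rewrite ler_wpM2l //.
  exact: deviation_ge.
move: e; rewrite tauS [tau k + _ - _]addrC addKr => e.
have : gap k ^+ 2 <= 2 * M ^+ 2 * b k ^+ 2 + 2 * m ^+ 2.
  have : gap k ^+ 2 <= (M * b k + m) ^+ 2 by rewrite ler_pXn2r ?nnegrE // addr_ge0 // mulr_ge0.
  by have := sqr_ge0 (M * b k - m); rewrite sqrrB sqrrD exprMn; lra.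
by move=> /(ler_wpM2l (ltW a0)); lra.
Qed.

Variable rho : nat -> R.
Hypothesis rho_ge : forall i m, (K i <= m <= K i.+1)%N -> enorm (x m - y i (tau m)) <= rho i.

Let rho0 i : 0 <= rho i.
Proof. by apply: le_trans (@rho_ge i (K i) _) => //; rewrite leqnn ltnW. Qed.

Let potential_drop k := phi (y (wi k) (tau k)) - phi (y (wi k) (tau k.+1)).

Let wiE i k : (K i <= k < K i.+1)%N -> wi k = i.
Proof.
move=> /andP[ik ki]; have /andP[a1 a2] := Kwi k.
have Kle := homo_leq (@leqnn) leq_trans (fun i => ltnW (KS i)).
apply/eqP; rewrite eqn_leq (leqNgt (wi k)) (leqNgt i).
apply/andP; split; apply/negP => wk; have ij := Kle _ _ wk.
  by have := leq_trans ij a1; rewrite leqNgt ki.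
by have := leq_trans ij ik; rewrite leqNgt a2.
Qed.

Let drop_partial i m : (K i <= m <= K i.+1)%N ->
  \sum_(K i <= k < m) potential_drop k = phi (x (K i)) - phi (y i (tau m)).
Proof.
move=> /andP[im mi].
rewrite -yK (telescope_sumr_eq (fun k => - phi (y i (tau k)))) //.
  by rewrite opprK addrC.
move=> k /andP[ik km]; rewrite /potential_drop (@wiE i) ?ik ?(leq_trans km) //.
by rewrite opprK addrC.
Qed.

(** The drops telescope inside a window, and a restart changes the objective by at most [M * rho i].
    As a window lasts at least 1/2, [rho i] is at most twice its weighted sum over the window. *)
Let drop_windows i : \sum_(0 <= k < K i) potential_drop k <=
  phi (x 0%N) - phi (x (K i)) + 2 * M * \sum_(0 <= k < K i) alpha k * rho (wi k).
Proof.
have m0 := M0.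
elim: i => [|i IH]; first by rewrite K0 !big_geq // subrr mulr0 addr0.
have Ki := KS i.
rewrite !(big_cat_nat (leq0n (K i)) (ltnW Ki)) /=.
rewrite drop_partial; last by rewrite leqnn ltnW.
have XyK : X (y i (tau (K i.+1))).
  by apply: (flow_mem (flow i)); rewrite lexx tau_le // ltnW.
have h1 : phi (x (K i.+1)) - phi (y i (tau (K i.+1))) <= M * rho i.
  apply: le_trans (ler_norm _) _; apply: le_trans (phi_lip (xX _) XyK) _.
  by rewrite ler_wpM2l // rho_ge // leqnn ltnW.
have h2 : rho i <= 2 * \sum_(K i <= k < K i.+1) alpha k * rho (wi k).
  have -> : \sum_(K i <= k < K i.+1) alpha k * rho (wi k) =
      (tau (K i.+1) - tau (K i)) * rho i.
    rewrite tauB ?(ltnW Ki) // mulr_suml [LHS]big_nat_cond [RHS]big_nat_cond.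
    by apply: eq_bigr => k; rewrite andbT => /wiE ->.
  have /andP[k1 _] := Kt i; have := rho0 i; nra.
have := ler_wpM2l m0 h2; lra.
Qed.

Lemma gap_sum N :
  \sum_(0 <= k < N) alpha k * gap k ^+ 2 <=
  6 * M ^+ 4 * (1 + \sum_(0 <= k < N) alpha k * (rho (wi k) + alpha k)).
Proof.
have m0 := M0; have m1 := M1.
have a0 k : 0 <= alpha k by exact: ltW.
pose SR m m' := \sum_(m <= k < m') alpha k * rho (wi k).
pose SA := \sum_(0 <= k < N) alpha k ^+ 2.
have SR0 m m' : 0 <= SR m m' by apply: sumr_ge0 => k _; rewrite mulr_ge0.
have SA0 : 0 <= SA by apply: sumr_ge0 => k _; exact: sqr_ge0.
have -> : \sum_(0 <= k < N) alpha k * (rho (wi k) + alpha k) = SR 0%N N + SA.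
  by rewrite -big_split; apply: eq_bigr => k _; rewrite mulrDr expr2.
have h1 : \sum_(0 <= k < N) alpha k * b k ^+ 2 <= M * SR 0%N N + M ^+ 2 * SA.
  rewrite !mulr_sumr -big_split; apply: ler_sum => k _ /=.
  have /andP[k1 k2] := Kwi k.
  have h1 : b k <= rho (wi k) + M * alpha k.
    by apply: le_trans (deviation_tracking k) _; rewrite lerD2r rho_ge // k1 ltnW.
  (* One factor is bounded by the diameter, so [rho] enters to the first power and only its
     expectation will be needed. *)
  have h2 : b k ^+ 2 <= M * (rho (wi k) + M * alpha k).
    rewrite expr2; apply: ler_pM => //; [exact: deviation_ge0 | exact: deviation_ge0|].
    exact: deviation_diam.
  have := ler_wpM2l (a0 k) h2; rewrite !expr2; lra.
have h2 : \sum_(0 <= k < N) potential_drop k <= M ^+ 2 + 2 * M * SR 0%N N.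
  (* For [N.+1] the last step is [N]; its window may be cut at [N.+1], and the windows before it are
     covered by [drop_windows]. *)
  case: N @SA SA0 h1 => [|N] SA SA0 h1.
    by rewrite big_geq // addr_ge0 ?mulr_ge0 // sqr_ge0.
  have /andP[k1 k2] := Kwi N; set i := wi N in k1 k2.
  have iN : (K i <= N.+1)%N by exact: leqW.
  rewrite (big_cat_nat (leq0n (K i)) iN) /= drop_partial; last by rewrite iN.
  have Xy : X (y i (tau N.+1)).
    by apply: (flow_mem (flow i)); rewrite !tau_le // iN.
  have h3 : phi (x 0%N) - phi (y i (tau N.+1)) <= M ^+ 2.
    apply: le_trans (ler_norm _) _; apply: le_trans (phi_lip (xX _) Xy) _.
    by rewrite expr2 ler_wpM2l // X_diam.
  have h4 : SR 0%N N.+1 = SR 0%N (K i) + SR (K i) N.+1 by rewrite /SR -big_cat_nat.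
  have := drop_windows i; rewrite -/(SR 0%N (K i)) h4.
  have := SR0 (K i) N.+1 => h5.
  have : 0 <= M * SR (K i) N.+1 by rewrite mulr_ge0.
  lra.
have h3 : \sum_(0 <= k < N) alpha k * gap k ^+ 2 <=
   2 * M ^+ 2 * \sum_(0 <= k < N) alpha k * b k ^+ 2 + 2 * \sum_(0 <= k < N) potential_drop k.
  by rewrite !mulr_sumr -big_split; apply: ler_sum => k _; exact: gap_energy.
(* The coefficients [2 M ^+ 2], [2 M ^+ 3 + 4 M] and [2 M ^+ 4] are all at most [6 M ^+ 4]. *)
have M2 : 1 <= M ^+ 2 by rewrite exprn_ege1.
have M4 : M ^+ 4 = M ^+ 2 * M ^+ 2 by rewrite -exprD.
have M24 : M ^+ 2 <= M ^+ 4 by rewrite M4 ler_peMl // sqr_ge0.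
have M34 : M ^+ 3 <= M ^+ 4 by rewrite (exprS M 3) ler_peMl // exprn_ge0.
have M14 : M <= M ^+ 4 by rewrite (exprS M 3) ler_peMr // exprn_ege1.
have h4 : 2 * M ^+ 2 * \sum_(0 <= k < N) alpha k * b k ^+ 2 <=
    2 * M ^+ 2 * (M * SR 0%N N + M ^+ 2 * SA).
  by rewrite ler_wpM2l // mulr_ge0 // sqr_ge0.
have M3 : M ^+ 3 = M ^+ 2 * M by rewrite exprSr.
have h5 : (2 * M ^+ 3 + 4 * M) * SR 0%N N <= 6 * M ^+ 4 * SR 0%N N.
  by rewrite ler_wpM2r //; lra.
have h6 : 0 <= M ^+ 4 * SA by rewrite mulr_ge0 // exprn_ge0.
move: h5 h6; rewrite M3 M4 in M24 M34 M14 *; lra.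
Qed.

End Gap.

(** * Expectations of square integrable variables *)

Section RandomVectors.
Context {d : measure_display} {T : measurableType d} {R : realType} {p : nat}.
Implicit Types (Y : T -> 'rV[R]_p) (phi : 'rV[R]_p -> R).

(** [borel] is a bare set system; it becomes a measurable structure through [g_sigma_algebraType],
    where it is enough to test open intervals. *)
Lemma borel_preimage phi (A : set R) : continuous phi -> measurable A ->
  borel (phi @^-1` A).
Proof.
move=> cphi mA.
have mphi : measurable_fun (setT : set (g_sigma_algebraType (@open 'rV[R]_p)))
    (phi : g_sigma_algebraType (@open 'rV[R]_p) -> R).
  apply: (measurability _ (RGenOpens.measurableE R)).
  move=> _ [_ [a [b ->] <-]]; rewrite setTI; apply: sub_sigma_algebra.
  by move/continuousP : cphi; apply; exact: interval_open.
by have := mphi measurableT A mA; rewrite setTI.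
Qed.

Lemma sigma_of_preimage phi Y (A : set R) : continuous phi -> measurable A ->
  sigma_of Y ((phi \o Y) @^-1` A).
Proof.
by move=> cphi mA; exists (phi @^-1` A); [exact: borel_preimage | rewrite setTI].
Qed.

Lemma random_vector_measurable phi Y : continuous phi -> random_vector Y ->
  measurable_fun setT (phi \o Y).
Proof. by move=> cphi rY _ A mA; rewrite setTI; apply/rY/sigma_of_preimage. Qed.

End RandomVectors.

Section SquareIntegrable.
Context {d : measure_display} {T : measurableType d} {R : realType}.
Variable P : probability T R.
Implicit Types X Y : T -> R.

Definition L1 X := P.-integrable setT (EFin \o X).
Definition L2 X := measurable_fun setT X /\ L1 (fun w => X w ^+ 2).
Definition Ex X : R := Rintegral P setT X.

Lemma L1_le X Y : measurable_fun setT X -> (forall w, `|X w| <= Y w) -> L1 Y -> L1 X.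
Proof.
move=> mX XY; apply: le_integrable => //; first exact/measurable_EFinP.
by move=> w _; rewrite /= lee_fin (le_trans (XY w)) // ler_norm.
Qed.

Lemma L1_measurable X : L1 X -> measurable_fun setT X.
Proof. by move=> /measurable_int /measurable_EFinP. Qed.

Lemma L1_cst (c : R) : L1 (cst c).
Proof. exact: finite_measure_integrable_cst. Qed.

Lemma L1D X Y : L1 X -> L1 Y -> L1 (fun w => X w + Y w).
Proof. by move=> iX iY; exact: (integrableD measurableT iX iY). Qed.

Lemma L1Z (c : R) X : L1 X -> L1 (fun w => c * X w).
Proof. by move=> iX; exact: (integrableZl measurableT c iX). Qed.

Lemma L1_sum (I : Type) (s : seq I) (F : I -> T -> R) :
  (forall i, L1 (F i)) -> L1 (fun w => \sum_(i <- s) F i w).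
Proof.
move=> iF; elim: s => [|i s IH].
  by under eq_fun do rewrite big_nil; exact: (L1_cst 0).
by under eq_fun do rewrite big_cons; exact: L1D.
Qed.

Lemma L2M X Y : L2 X -> L2 Y -> L1 (fun w => X w * Y w).
Proof.
move=> [mX X2] [mY Y2]; apply: (@L1_le _ (fun w => X w ^+ 2 + Y w ^+ 2)).
- exact: measurable_funM.
- move=> w; rewrite normrM.
  rewrite -[X w ^+ 2](real_normK (num_real _)) -[Y w ^+ 2](real_normK (num_real _)).
  have := sqr_ge0 (`|X w| - `|Y w|).
  have : 0 <= `|X w| * `|Y w| by rewrite mulr_ge0.
  by rewrite sqrrB; lra.
- exact: L1D.
Qed.

Lemma L2_cst (c : R) : L2 (cst c).
Proof. by split; [exact: measurable_cst | exact: (L1_cst (c ^+ 2))]. Qed.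

Lemma L2_L1 X : L2 X -> L1 X.
Proof.
move=> /L2M /(_ (L2_cst 1)); apply: eq_integrable => // w _.
by rewrite /= mulr1.
Qed.

Lemma L2_le X Y : measurable_fun setT X -> (forall w, `|X w| <= Y w) -> L2 Y -> L2 X.
Proof.
move=> mX XY [mY Y2]; split => //; apply: L1_le Y2 => [|w].
  exact: measurable_funX.
by rewrite normrX ler_pXn2r ?nnegrE // (le_trans _ (XY w)).
Qed.

Lemma L2D X Y : L2 X -> L2 Y -> L2 (fun w => X w + Y w).
Proof.
move=> LX LY; split; first by apply: measurable_funD; [case: LX | case: LY].
have := L1D (L1D (proj2 LX) (proj2 LY)) (L1Z 2 (L2M LX LY)).
by apply: eq_integrable => // w _ /=; congr EFin; ring.
Qed.

Lemma L2Z (c : R) X : L2 X -> L2 (fun w => c * X w).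
Proof.
move=> [mX X2]; split; first exact: measurable_funM.
have := L1Z (c ^+ 2) X2; apply: eq_integrable => // w _ /=; congr EFin; ring.
Qed.

Lemma L2B X Y : L2 X -> L2 Y -> L2 (fun w => X w - Y w).
Proof.
move=> LX LY; have := L2D LX (L2Z (-1) LY); congr L2.
by apply/funext => w; rewrite mulN1r.
Qed.

Lemma L2_sum (I : Type) (s : seq I) (F : I -> T -> R) :
  (forall i, L2 (F i)) -> L2 (fun w => \sum_(i <- s) F i w).
Proof.
move=> iF; elim: s => [|i s IH].
  by under eq_fun do rewrite big_nil; exact: (L2_cst 0).
by under eq_fun do rewrite big_cons; exact: L2D.
Qed.

Lemma Ex_cst (c : R) : Ex (cst c) = c.
Proof.
rewrite /Ex Rintegral_cst // -[RHS]mulr1; congr (_ * _).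
exact: (congr1 fine (probability_setT P)).
Qed.

Lemma ExD X Y : L1 X -> L1 Y -> Ex (fun w => X w + Y w) = Ex X + Ex Y.
Proof. by move=> iX iY; rewrite /Ex RintegralD. Qed.

Lemma ExZ (c : R) X : L1 X -> Ex (fun w => c * X w) = c * Ex X.
Proof. by move=> iX; rewrite /Ex RintegralZl. Qed.

Lemma ExB X Y : L1 X -> L1 Y -> Ex (fun w => X w - Y w) = Ex X - Ex Y.
Proof. by move=> iX iY; rewrite /Ex RintegralB. Qed.

Lemma Ex_sum (I : Type) (s : seq I) (F : I -> T -> R) :
  (forall i, L1 (F i)) -> Ex (fun w => \sum_(i <- s) F i w) = \sum_(i <- s) Ex (F i).
Proof.
move=> iF; elim: s => [|i s IH].
  by under eq_fun do rewrite big_nil; rewrite big_nil (Ex_cst 0).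
under eq_fun do rewrite big_cons.
by rewrite big_cons ExD ?IH //; exact: L1_sum.
Qed.

Lemma Ex_le X Y : L1 X -> L1 Y -> (forall w, X w <= Y w) -> Ex X <= Ex Y.
Proof. by move=> iX iY XY; apply: le_Rintegral. Qed.

Lemma Ex_ge0 X : (forall w, 0 <= X w) -> 0 <= Ex X.
Proof. by move=> X0; apply: Rintegral_ge0. Qed.

Lemma EFin_Ex X : L1 X -> (Ex X)%:E = (\int[P]_w (X w)%:E)%E.
Proof. by move=> iX; rewrite /Ex /Rintegral fineK //; exact: integrable_fin_num. Qed.

Lemma L1_ge0 X : measurable_fun setT X -> (forall w, 0 <= X w) ->
  (\int[P]_w (X w)%:E < +oo)%E -> L1 X.
Proof.
move=> mX X0 iX; apply/integrableP; split; first exact/measurable_EFinP.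
under eq_integral do rewrite /= ger0_norm ?X0 //.
exact: iX.
Qed.

Lemma Ex_le_bound X (B : R) : measurable_fun setT X -> (forall w, 0 <= X w) ->
  (\int[P]_w (X w)%:E <= B%:E)%E -> L1 X /\ Ex X <= B.
Proof.
move=> mX X0 XB; have iX : L1 X by apply: L1_ge0 => //; exact: le_lt_trans XB (ltry _).
by split => //; rewrite -lee_fin EFin_Ex.
Qed.

Lemma Ex_variance X : L2 X -> Ex (fun w => (X w - Ex X) ^+ 2) <= Ex (fun w => X w ^+ 2).
Proof.
move=> LX; set m := Ex X.
have -> : (fun w => (X w - m) ^+ 2) = (fun w => (X w ^+ 2 + (- 2 * m) * X w) + cst (m ^+ 2) w).
  by apply/funext => w; rewrite /=; ring.
have i1 := proj2 LX; have i2 := L1Z (- 2 * m) (L2_L1 LX).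
rewrite ExD; [|exact: L1D|exact: L1_cst].
rewrite ExD // ExZ ?Ex_cst -/m; last exact: L2_L1.
by have := sqr_ge0 m; lra.
Qed.

(** A weighted form of Cauchy-Schwarz; under mixing the free weight [t] is matched to the mixing
    coefficient. *)
Lemma Ex_mul_le (t : R) X Y : 0 < t -> L2 X -> L2 Y ->
  `|Ex (fun w => X w * Y w)| <= t * Ex (fun w => X w ^+ 2) + t^-1 * Ex (fun w => Y w ^+ 2).
Proof.
move=> t0 LX LY; have iXY := L2M LX LY.
have h w : `|X w * Y w| <= t * X w ^+ 2 + t^-1 * Y w ^+ 2.
  rewrite -(ler_pM2l t0) mulrDr [t * (t^-1 * _)]mulrA divff ?gt_eqF // mul1r.
  rewrite normrM -[X w ^+ 2](real_normK (num_real _)) -[Y w ^+ 2](real_normK (num_real _)).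
  have h2 : 0 <= (t * `|X w|) * `|Y w| by rewrite !mulr_ge0 // ltW.
  have := sqr_ge0 (t * `|X w| - `|Y w|); rewrite sqrrB; lra.
rewrite -!ExZ; [|exact: (proj2 LY)|exact: (proj2 LX)].
rewrite -ExD; [|exact/L1Z/(proj2 LX)|exact/L1Z/(proj2 LY)].
have iB : L1 (fun w => t * X w ^+ 2 + t^-1 * Y w ^+ 2).
  by apply: L1D; apply: L1Z; [exact: (proj2 LX)|exact: (proj2 LY)].
rewrite ler_norml; apply/andP; split.
  have -> : - Ex (fun w => t * X w ^+ 2 + t^-1 * Y w ^+ 2) =
      Ex (fun w => (-1) * (t * X w ^+ 2 + t^-1 * Y w ^+ 2)) by rewrite ExZ // mulN1r.
  apply: Ex_le => //; first exact: L1Z.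
  by move=> w; have := h w; rewrite ler_norml mulN1r => /andP[].
by apply: Ex_le => // w; have := h w; rewrite ler_norml => /andP[].
Qed.

(** By independence the joint law agrees with the product of the marginal laws on rectangles, hence
    everywhere; Fubini then separates the factors. *)
Lemma Ex_independent_mul X Y : L2 X -> L2 Y ->
  (forall A B, measurable A -> measurable B ->
     P ((X @^-1` A) `&` (Y @^-1` B)) = (P (X @^-1` A) * P (Y @^-1` B))%E) ->
  Ex (fun w => X w * Y w) = Ex X * Ex Y.
Proof.
move=> LX LY ind; have iX := L2_L1 LX; have iY := L2_L1 LY; have iXY := L2M LX LY.
have mX : measurable_fun setT X by case: LX.
have mY : measurable_fun setT Y by case: LY.
pose X' : {mfun T >-> R} := mfun_Sub (mem_set mX).
pose Y' : {mfun T >-> R} := mfun_Sub (mem_set mY).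
have mXY : measurable_fun setT (fun w => (X w, Y w)) by exact: measurable_fun_pair.
pose XY' : {mfun T >-> (R * R)%type} := mfun_Sub (mem_set mXY).
pose m1 := distribution P X'; pose m2 := distribution P Y'; pose m := distribution P XY'.
have mE : forall A, measurable A -> (m1 \x m2)%E A = m A.
  by apply: product_measure_unique => A B mA mB; rewrite /m1 /m2 /m /distribution /pushforward /= -ind.
pose f (u : R * R) := (u.1 * u.2)%:E.
have mf : measurable_fun setT f.
  by apply/measurable_EFinP; apply: measurable_funM.
have iXY' : P.-integrable setT (f \o XY') by exact: iXY.
have imf : m.-integrable setT f by exact: (integrable_pushforward (phi := XY')).
have ipf : (m1 \x m2)%E.-integrable setT f.
  apply/integrableP; split => //; case/integrableP : imf => _; apply: le_lt_trans.
  by rewrite (@eq_measure_integral _ _ _ _ m) // => A mA _; exact: mE.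
have E1 : (\int[m]_u f u = \int[P]_w (X w * Y w)%:E)%E.
  by rewrite /m integral_distribution.
have E2 : (\int[m1 \x m2]_u f u = \int[m]_u f u)%E.
  by apply: eq_measure_integral => A mA _; exact: mE.
have E3 : (\int[m1]_a \int[m2]_b f (a, b) = \int[m1 \x m2]_u f u)%E.
  exact: (integral12_prod_meas1 ipf).
have EY : (\int[m2]_b b%:E = (Ex Y)%:E)%E.
  by rewrite /m2 integral_distribution //= EFin_Ex.
have EX : (\int[m1]_a a%:E = (Ex X)%:E)%E.
  by rewrite /m1 integral_distribution //= EFin_Ex.
have mid : measurable_fun [set: R] (EFin \o @id R).
  by apply/measurable_EFinP; exact: measurable_id.
have im2 : m2.-integrable setT (EFin \o @id R).
  by apply: (integrable_pushforward (phi := Y')) => //; exact: iY.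
have im1 : m1.-integrable setT (EFin \o @id R).
  by apply: (integrable_pushforward (phi := X')) => //; exact: iX.
apply: EFin_inj; rewrite EFin_Ex // -E1 -E2 -E3.
under eq_integral => a _.
  under eq_integral do rewrite /f /= EFinM.
  rewrite integralZl // EY; over.
by rewrite /= integralZr // EX EFinM.
Qed.

End SquareIntegrable.

(** * Weighted sums of weakly correlated variables *)

Section WeightedSums.
Context {d : measure_display} {T : measurableType d} {R : realType}.
Variables (P : probability T R) (alpha : nat -> R) (V : nat -> T -> R) (B : R).
Hypothesis alpha_ge0 : forall k, 0 <= alpha k.
Hypothesis LV : forall k, L2 P (V k).
Hypothesis VB : forall k, Ex P (fun w => V k w ^+ 2) <= B.

Definition weighted_sum i j w := \sum_(i <= k < j) alpha k * V k w.

Lemma L2_weighted_sum i j : L2 P (weighted_sum i j).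
Proof. by apply: L2_sum => k; exact: L2Z. Qed.

Lemma B_ge0 : 0 <= B.
Proof. by apply: le_trans (VB 0); apply: Ex_ge0 => w; exact: sqr_ge0. Qed.

Lemma Ex_weighted_sum_step i j : (i <= j)%N ->
  Ex P (fun w => weighted_sum i j.+1 w ^+ 2) <=
  Ex P (fun w => weighted_sum i j w ^+ 2)
  + 2 * alpha j * (\sum_(i <= l < j) alpha l * Ex P (fun w => V l w * V j w))
  + alpha j ^+ 2 * B.
Proof.
move=> ij; have LS := L2_weighted_sum i j.
have -> : (fun w => weighted_sum i j.+1 w ^+ 2) = (fun w =>
   (weighted_sum i j w ^+ 2 + 2 * alpha j * (weighted_sum i j w * V j w))
   + alpha j ^+ 2 * V j w ^+ 2).
  by apply/funext => w; rewrite /weighted_sum big_nat_recr //=; ring.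
have i1 := proj2 LS; have i2 := L2M LS (LV j); have i3 := proj2 (LV j).
rewrite ExD; [|by apply: L1D => //; exact: L1Z | exact: L1Z].
rewrite ExD //; last exact: L1Z.
rewrite (ExZ _ i2) (ExZ _ i3); apply: lerD; last by rewrite ler_wpM2l // sqr_ge0.
rewrite lerD2l le_eqVlt; apply/orP; left; apply/eqP; congr (_ * _).
have -> : (fun w => weighted_sum i j w * V j w) =
    (fun w => \sum_(i <= l < j) alpha l * (V l w * V j w)).
  by apply/funext => w; rewrite mulr_suml; apply: eq_bigr => l _; rewrite mulrA.
rewrite Ex_sum; last by move=> l; apply: L1Z; exact: L2M.
by apply: eq_bigr => l _; rewrite ExZ //; exact: L2M.
Qed.

Lemma Ex_uncorrelated_sum i j :
  (forall l k, (l < k)%N -> Ex P (fun w => V l w * V k w) = 0) ->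
  Ex P (fun w => weighted_sum i j w ^+ 2) <= B * \sum_(i <= k < j) alpha k ^+ 2.
Proof.
move=> unc; have [ij|ji] := leqP i j; last first.
  rewrite /weighted_sum (big_geq (ltnW ji)) mulr0.
  have -> : (fun w => (\sum_(i <= k < j) alpha k * V k w) ^+ 2) = cst 0.
    by apply/funext => w; rewrite big_geq ?(ltnW ji) // expr0n.
  by rewrite Ex_cst.
rewrite -(subnKC ij); elim: (j - i)%N => [|m IH].
  rewrite addn0 big_geq // mulr0.
  have -> : (fun w => weighted_sum i i w ^+ 2) = cst 0.
    by apply/funext => w; rewrite /weighted_sum big_geq // expr0n.
  by rewrite Ex_cst.
rewrite addnS; apply: le_trans (Ex_weighted_sum_step (leq_addr _ _)) _.
rewrite big_nat_cond big1 => [|l]; last first.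
  by rewrite andbT => /andP[_ lj]; rewrite unc // mulr0.
rewrite mulr0 addr0 big_nat_recr ?leq_addr //= mulrDr [alpha _ ^+ 2 * B]mulrC.
by rewrite lerD2r.
Qed.

Variable rho : nat -> R.
Hypothesis Vrho : forall l k, (l < k)%N -> `|Ex P (fun w => V l w * V k w)| <= rho (k - l)%N.
Hypothesis rho0 : forall e, 0 < e -> exists s, forall t, (s <= t)%N -> rho t <= e.
Hypothesis alpha0 : forall e, 0 < e -> exists k0, forall k, (k0 <= k)%N -> alpha k <= e.

(** The covariances are split by lag. There are at most [s] short lags and their steps are small; at
    long lags [rho] is small and the total weight is at most 1. *)
Lemma Ex_decorrelated_sum e : 0 < e -> exists k0, forall i j, (k0 <= i)%N ->
  \sum_(i <= k < j) alpha k <= 1 -> Ex P (fun w => weighted_sum i j w ^+ 2) <= e.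
Proof.
move=> e0; have B0 := B_ge0.
have e4 : 0 < e / 4 by lra.
have [s Hs] := rho0 e4.
(* With [am = e / D], the short lags and the diagonal contribute at most [e / 2], and the long lags
   the other [e / 2]. *)
pose D := 4 * (s%:R * (2 * B) + B) + 1.
have D0 : 0 < D by rewrite /D ltr_wpDl // mulr_ge0 // addr_ge0 // mulr_ge0 // mulr_ge0.
have [am [am0 amD [k0 Hk0]]] : exists am, [/\ 0 <= am, am * D = e &
    exists k0, forall k, (k0 <= k)%N -> alpha k <= am].
  exists (e / D); split; [by rewrite divr_ge0 // ltW | by rewrite divfK // gt_eqF |].
  exact: alpha0 (divr_gt0 e0 D0).
exists k0 => i j k0i aij.
have [ij|ji] := leqP i j; last first.
  have -> : (fun w => weighted_sum i j w ^+ 2) = cst 0.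
    by apply/funext => w; rewrite /weighted_sum big_geq ?(ltnW ji) // expr0n.
  by rewrite Ex_cst ltW.
have cB l k : `|Ex P (fun w => V l w * V k w)| <= 2 * B.
  apply: le_trans (Ex_mul_le ltr01 (LV l) (LV k)) _.
  by have := VB l; have := VB k; rewrite invr1; lra.
suff H m : (i + m <= j)%N -> Ex P (fun w => weighted_sum i (i + m) w ^+ 2) <=
    \sum_(i <= k < (i + m)) alpha k * (2 * (am * s%:R * (2 * B) + e / 4) + am * B).
  have := H (j - i)%N; rewrite (subnKC ij) => /(_ (leqnn _)) H'.
  apply: le_trans H' _; rewrite -mulr_suml.
  apply: (@le_trans _ _ (1 * (2 * (am * s%:R * (2 * B) + e / 4) + am * B))).
    apply: ler_wpM2r => //.
    have t1 : 0 <= am * s%:R * (2 * B) by rewrite !mulr_ge0.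
    by have t2 : 0 <= am * B; [rewrite mulr_ge0 | lra].
  move: amD; have : 0 <= am * (s%:R * (2 * B)) by rewrite !mulr_ge0.
  have : 0 <= am * B by rewrite mulr_ge0.
  by rewrite /D; lra.
elim: m => [|m IH] imj.
  rewrite addn0 big_geq //.
  have -> : (fun w => weighted_sum i i w ^+ 2) = cst 0.
    by apply/funext => w; rewrite /weighted_sum big_geq // expr0n.
  by rewrite Ex_cst.
have imj' : (i + m <= j)%N by rewrite (leq_trans _ imj) // addnS.
set k := (i + m)%N in IH imj' *; rewrite addnS -/k big_nat_recr ?leq_addr //=.
apply: le_trans (Ex_weighted_sum_step (leq_addr _ _)) _.
rewrite -/k -addrA; apply: lerD; first exact: IH.
have akm : alpha k <= am by apply: Hk0; rewrite (leq_trans k0i) // leq_addr.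
have hs : \sum_(i <= l < k) alpha l * Ex P (fun w => V l w * V k w) <=
    am * s%:R * (2 * B) + e / 4.
  (* Indices from [r] on have lag at most [s]. The subtraction truncates at 0, which is harmless
     because of the maximum with [i]. *)
  pose r := maxn i (k - s).
  have ir : (i <= r)%N by exact: leq_maxl.
  have rk : (r <= k)%N by rewrite geq_max leq_addr leq_subr.
  rewrite (big_cat_nat ir rk) /= addrC; apply: lerD.
    apply: (@le_trans _ _ (\sum_(r <= l < k) am * (2 * B))).
      rewrite big_nat_cond [leRHS]big_nat_cond; apply: ler_sum => l.
      rewrite andbT => /andP[rl lk].
      apply: le_trans (ler_wpM2l (alpha_ge0 l) (ler_norm _)) _.
      apply: ler_pM => //.
      by apply: Hk0; rewrite (leq_trans k0i) // (leq_trans ir).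
    rewrite sumr_const_nat -[leLHS]mulr_natl mulrA [am * s%:R]mulrC.
    rewrite ler_wpM2r ?mulr_ge0 // ler_wpM2r // ler_nat leq_subLR.
    by rewrite addnC -leq_subLR leq_maxr.
  apply: (@le_trans _ _ (\sum_(i <= l < r) alpha l * (e / 4))).
    rewrite big_nat_cond [leRHS]big_nat_cond; apply: ler_sum => l.
    rewrite andbT => /andP[il lr]; rewrite ler_wpM2l //.
    have lk : (l < k)%N by exact: leq_trans rk.
    apply: le_trans (ler_norm _) _; apply: le_trans (Vrho lk) _; apply: Hs.
    move: lr; rewrite /r ltnNge geq_max il /= -ltnNge ltn_subRL => lsk.
    by rewrite leq_subRL ?(ltnW lk) // addnC ltnW.
  rewrite -mulr_suml -[leRHS]mul1r ler_wpM2r //; first lra.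
  apply: le_trans aij; rewrite (big_cat_nat ir (leq_trans rk imj')) /= lerDl.
  exact: sumr_ge0.
have h1 := ler_wpM2l (alpha_ge0 k) hs.
have h2 : alpha k * (alpha k * B) <= alpha k * (am * B).
  by rewrite ler_wpM2l // ler_wpM2r.
by rewrite expr2; lra.
Qed.

End WeightedSums.

(** * Covariance decay of functions of the data *)

Section Decorrelation.
Context {d : measure_display} {T : measurableType d} {R : realType} {p : nat}.
Variables (P : probability T R) (z : nat -> T -> 'rV[R]_p).
Hypothesis rz : forall k, random_vector (z k).
Implicit Types phi : 'rV[R]_p -> R.

Definition centered phi k w := phi (z k w) - Ex P (phi \o z k).

Definition bounded_second_moment phi B :=
  forall k, L2 P (phi \o z k) /\ Ex P (fun w => phi (z k w) ^+ 2) <= B.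

(** The common consequence of independence, where [rho] is 0, and of mixing, where [rho] comes from
    the mixing coefficients. *)
Definition decorrelated phi := exists (B : R) (rho : nat -> R),
  [/\ bounded_second_moment phi B,
      forall l k, (l < k)%N ->
        `|Ex P (fun w => centered phi l w * centered phi k w)| <= rho (k - l)%N &
      forall e, 0 < e -> exists s, forall t, (s <= t)%N -> rho t <= e].

Lemma L2_centered phi B k : bounded_second_moment phi B -> L2 P (centered phi k).
Proof. by move=> /(_ k) [H _]; apply: L2B => //; exact: L2_cst. Qed.

Lemma Ex_centered_sqr phi B k : bounded_second_moment phi B ->
  Ex P (fun w => centered phi k w ^+ 2) <= B.
Proof. by move=> /(_ k) [H]; apply: le_trans; exact: Ex_variance. Qed.

Lemma Ex_centered phi B k : bounded_second_moment phi B -> Ex P (centered phi k) = 0.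
Proof.
move=> /(_ k) [/L2_L1 H _].
rewrite /centered (ExB (Y := cst (Ex P (phi \o z k)))) //; last exact: L1_cst.
by rewrite Ex_cst subrr.
Qed.

Lemma continuous_shift phi (c : R) : continuous phi -> continuous (fun u => phi u - c).
Proof.
move=> cphi u; apply: (@cvgB _ _ _ (nbhs u) (nbhs_filter u)); first exact: cphi.
exact: (@cvg_cst _ _ _ _ (nbhs_filter u)).
Qed.

Lemma independent_uncorrelated phi B : continuous phi -> independent_seq P z ->
  bounded_second_moment phi B ->
  forall l k, (l < k)%N -> Ex P (fun w => centered phi l w * centered phi k w) = 0.
Proof.
move=> cphi ind mB l k lk.
rewrite Ex_independent_mul; [|exact: L2_centered mB|exact: L2_centered mB|].
  by rewrite !(Ex_centered _ mB) mul0r.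
move=> A A' mA mA'.
pose psi j u := phi u - Ex P (phi \o z j).
have cpsi j : continuous (psi j) by exact: continuous_shift.
have [lk' kl'] : l != k /\ k != l by rewrite neq_ltn lk gtn_eqF.
(* Independence is tested on the list [[:: l; k]]; every index other than [l] receives the set meant
   for [k]. *)
pose C j := if j == l then psi l @^-1` A else psi k @^-1` A'.
have := ind [:: l; k] C; rewrite /= inE lk' => /(_ isT) H.
rewrite !big_cons big_nil mule1 in H; rewrite /C eqxx (negbTE kl') in H.
rewrite -/(psi l @^-1` A) in H.
rewrite -[RHS]H => [|j]; last by case: ifP => _; exact: borel_preimage.
congr (P _); apply/seteqP; split => [w [Aw A'w] j /=|w Hw].
  by rewrite !inE => /orP[|] /eqP -> /=; rewrite ?eqxx ?(negbTE kl').
split.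
  by have := Hw l; rewrite /= inE eqxx; apply.
by have := Hw k; rewrite /= !inE eqxx orbT (negbTE kl'); apply.
Qed.

Lemma independent_decorrelated phi B : continuous phi -> independent_seq P z ->
  bounded_second_moment phi B -> decorrelated phi.
Proof.
move=> cphi ind mB; exists B, (fun=> 0); split => //.
  by move=> l k lk; rewrite (independent_uncorrelated cphi ind mB lk) normr0.
by move=> e e0; exists 0%N => t _; exact: ltW.
Qed.

Lemma moment_ge0 (m : R) (Y : T -> 'rV[R]_p) : (0 <= moment P m Y)%E.
Proof. exact: Lnorm_ge0. Qed.

Lemma moment2_le (Y : T -> 'rV[R]_p) (c : R) : (moment P 2 Y <= c%:E)%E ->
  (\int[P]_w (enorm (Y w) ^+ 2)%:E <= (c ^+ 2)%:E)%E.
Proof.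
move=> Yc; have M0 := moment_ge0 2 Y.
have Mfin : moment P 2 Y \is a fin_num by rewrite ge0_fin_numE // (le_lt_trans Yc) // ltry.
have -> : (\int[P]_w (enorm (Y w) ^+ 2)%:E = moment P 2 Y `^ 2)%E.
  rewrite /moment poweR_Lnorm //; apply: eq_integral => w _.
  rewrite abse_EFin ger0_norm //.
  exact: (esym (etrans (poweR_EFin _ _) (congr1 EFin (powR_mulrn 2 (enorm_ge0 (Y w)))))).
have [a aE] : exists a, moment P 2 Y = a%:E by exists (fine (moment P 2 Y)); rewrite fineK.
move: M0 Yc; rewrite aE !lee_fin => a0 ac.
by rewrite powR_mulrn // ler_pXn2r ?nnegrE // (le_trans a0).
Qed.

Lemma enorm_measurable (Y : T -> 'rV[R]_p) : random_vector Y ->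
  measurable_fun setT (fun w => enorm (Y w)).
Proof.
move=> rY; apply: (random_vector_measurable (phi := @enorm R p)) => //.
apply: (@lipschitz_continuous _ _ _ 1) => u v.
by rewrite mul1r; exact: ler_dist_enorm.
Qed.

Lemma lipschitz_second_moment phi (L B : R) : 0 <= L ->
  (forall u v, `|phi u - phi v| <= L * enorm (u - v)) ->
  (forall k, (\int[P]_w (enorm (z k w) ^+ 2)%:E <= B%:E)%E) ->
  bounded_second_moment phi (2 * phi 0 ^+ 2 + 2 * L ^+ 2 * B).
Proof.
move=> L0 Lphi zB k.
have mphi : measurable_fun setT (phi \o z k).
  by apply: random_vector_measurable => //; exact: lipschitz_continuous Lphi.
have mz := enorm_measurable (@rz k).
have [iz EzB] : L1 P (fun w => enorm (z k w) ^+ 2) /\ Ex P (fun w => enorm (z k w) ^+ 2) <= B.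
  by apply: Ex_le_bound => //; [exact: measurable_funX | move=> w; exact: sqr_ge0].
have bnd w : phi (z k w) ^+ 2 <= 2 * phi 0 ^+ 2 + 2 * L ^+ 2 * enorm (z k w) ^+ 2.
  have := Lphi (z k w) 0; rewrite subr0 => h.
  have : (phi (z k w) - phi 0) ^+ 2 <= (L * enorm (z k w)) ^+ 2.
    rewrite -[_ ^+ 2](real_normK (num_real _)) ler_pXn2r ?nnegrE ?mulr_ge0 //.
  have := sqr_ge0 (phi (z k w) - 2 * phi 0); rewrite exprMn.
  by move: (phi (z k w)) (phi 0) => a c; rewrite !expr2; lra.
have ib : L1 P (fun w => 2 * phi 0 ^+ 2 + 2 * L ^+ 2 * enorm (z k w) ^+ 2).
  by apply: L1D; [exact: (L1_cst P (2 * phi 0 ^+ 2)) | exact: L1Z].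
have i2 : L1 P (fun w => phi (z k w) ^+ 2).
  apply: L1_le ib; first exact: measurable_funX.
  by move=> w; rewrite ger0_norm ?sqr_ge0.
split; first by split.
apply: le_trans (Ex_le i2 ib bnd) _.
rewrite (ExD (X := cst (2 * phi 0 ^+ 2))) ?Ex_cst; [|exact: L1_cst|exact: L1Z].
by rewrite ExZ // lerD2l ler_wpM2l // mulr_ge0 // sqr_ge0.
Qed.

(** Summable mixing coefficients tend to 0. The Lipschitz bound carries the approximation of [z k]
    over to [phi], so only the approximation error contributes to the covariance. *)
Lemma L_mixing_decorrelated phi (L : R) : 0 <= L ->
  (forall u v, `|phi u - phi v| <= L * enorm (u - v)) ->
  L_mixing P z -> decorrelated phi.
Proof.
move=> L0 Lphi [F [Fp [zc [sub mono ind cond mom]]]].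
have [supm sumpsi] := mom 2 (ler1n _ 2).
have cphi : continuous phi by exact: lipschitz_continuous Lphi.
have [K K0 HK] : exists2 K : R, 0 <= K & forall k, (moment P 2 (z k) <= K%:E)%E.
  set s := ereal_sup _ in supm.
  have ms k : (moment P 2 (z k) <= s)%E by apply: ereal_sup_ubound; exists k.
  have s0 : (0 <= s)%E by apply: le_trans (ms 0%N); exact: moment_ge0.
  exists (fine s); first exact: fine_ge0.
  by move=> k; rewrite fineK // ge0_fin_numE.
have mB := lipschitz_second_moment L0 Lphi (fun k => moment2_le (HK k)).
set B := (2 * _ + _) in mB.
have B0 : 0 <= B.
  by have [_] := mB 0%N; apply: le_trans; apply: Ex_ge0 => w; exact: sqr_ge0.
pose psi t := mixing_coef P z zc 2 t.
have psi_ge t k : (t <= k)%N -> (moment P 2 (fun w => (z k w - zc k (k - t)%N w)%R) <= psi t)%E.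
  by move=> tk; apply: ereal_sup_ubound; exists k.
have psi0 t : (0 <= psi t)%E.
  by apply: le_trans (psi_ge t t (leqnn t)); exact: moment_ge0.
have psifin t : psi t \is a fin_num.
  rewrite ge0_fin_numE //; apply: le_lt_trans sumpsi.
  apply: le_trans (nneseries_lim_ge t.+1 _) => [|i _ _]; last exact: psi0.
  by rewrite big_nat_recr //= leeDr // sume_ge0.
pose psir t := fine (psi t).
have psir0 t : 0 <= psir t by exact: fine_ge0.
have [A A0 HA] : exists2 A : R, 0 <= A & forall N, \sum_(0 <= t < N) psir t <= A.
  apply: nneseries_partial_bound => //.
  by under eq_eseriesr do rewrite fineK //.
(* The term [t.+1%:R^-1] keeps the weight in [Ex_mul_le] positive when the mixing coefficient
   vanishes. *)
pose rho t := (psir t + t.+1%:R^-1) * (B + L ^+ 2).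
exists B, rho; split => // [l k lk|e e0]; last first.
  pose D := B + L ^+ 2 + 1.
  have D0 : 0 < D by rewrite /D ltr_wpDl // addr_ge0 // sqr_ge0.
  have eD : 0 < e / (2 * D) by rewrite divr_gt0 // mulr_gt0.
  have [s1 H1] := bounded_series_cvg0 psir0 HA eD.
  have [s2 H2] : exists s, forall t, (s <= t)%N -> t.+1%:R^-1 <= e / (2 * D).
    exists (Num.truncn (e / (2 * D))^-1) => t st.
    rewrite -[leRHS]invrK lef_pV2 ?posrE ?invr_gt0 ?ltr0n //.
    apply: ltW; apply: lt_le_trans (truncnS_gt _) _; by rewrite ler_nat ltnS.
  exists (maxn s1 s2) => t; rewrite geq_max => /andP[/H1 h1 /H2 h2].
  apply: (@le_trans _ _ ((e / (2 * D) + e / (2 * D)) * (B + L ^+ 2))).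
    by apply: ler_wpM2r; [rewrite addr_ge0 // sqr_ge0 | exact: lerD].
  have : e / (2 * D) * (2 * D) = e by rewrite divfK // mulf_neq0 // gt_eqF.
  by rewrite /D; move: eD; nra.
(* Up to an error psi_2(k - l), z_k is the F^+_l-measurable variable [zc k l],
   which is independent of z_l. *)
have [cmeas ci ceq] := cond k l.
have rzc : random_vector (zc k l).
  by move=> S HS; have [_ [_ +]] := sub l; apply; exact: cmeas.
pose m := Ex P (phi \o z k).
(* [m] is the mean of [phi \o z k], not of [phi \o zc k l]; the product with the independent
   [centered phi l] still has mean 0, because that factor is centred. *)
pose V' w := phi (zc k l w) - m.
pose Dz w := z k w - zc k l w.
have mDz : measurable_fun setT (fun w => phi (zc k l w)).
  exact: random_vector_measurable.
have mD : measurable_fun setT (fun w => enorm (Dz w)).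
  have -> : (fun w => enorm (Dz w)) = (fun w => Num.sqrt (\sum_(i < p) (z k w 0 i - zc k l w 0 i) ^+ 2)).
    apply/funext => w; rewrite /enorm /dot; congr Num.sqrt; apply: eq_bigr => i _.
    by rewrite /Dz !mxE expr2.
  have cc i : continuous (fun u : 'rV[R]_p => u 0 i).
    apply: (@lipschitz_continuous _ _ _ 1) => u v.
    by rewrite mul1r; have := enorm_coord (u - v) i; rewrite !mxE.
  apply: measurableT_comp.
    by apply: continuous_measurable_fun; exact: sqrt_continuous.
  apply: measurable_sum => i; apply: measurable_funX; apply: measurable_funB.
    exact: (random_vector_measurable (cc i) (@rz k)).
  exact: (random_vector_measurable (cc i) rzc).
have [iD ED] : L1 P (fun w => enorm (Dz w) ^+ 2) /\
    Ex P (fun w => enorm (Dz w) ^+ 2) <= psir (k - l)%N ^+ 2.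
  apply: Ex_le_bound; [exact: measurable_funX | by move=> w; exact: sqr_ge0 |].
  apply: moment2_le; rewrite fineK //.
  by have := psi_ge (k - l)%N k (leq_subr _ _); rewrite subKn // ltnW.
have LVl := L2_centered l mB; have LVk := L2_centered k mB.
have LDz : L2 P (fun w => L * enorm (Dz w)) by apply: L2Z; split.
have Ldiff : L2 P (fun w => centered phi k w - V' w).
  apply: L2_le LDz => [|w]; last first.
    by rewrite /centered /V' opprB addrA subrK; exact: Lphi.
  apply: measurable_funB; first by case: LVk.
  by apply: measurable_funB => //; exact: measurable_cst.
have LV' : L2 P V'.
  have := L2B LVk Ldiff; congr L2; apply/funext => w; by rewrite subKr.
have E0 : Ex P (fun w => centered phi l w * V' w) = 0.
  rewrite Ex_independent_mul //; first by rewrite (Ex_centered _ mB) mul0r.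
  move=> S S' mS mS'; have [indl Fl] := ind l; apply: indl.
    apply: Fl; pose f := fun u => phi u - Ex P (phi \o z l).
    by apply: (sigma_of_preimage (phi := f)) => //; exact: continuous_shift.
  apply: cmeas; pose f := fun u => phi u - m.
  by apply: (sigma_of_preimage (phi := f)) => //; exact: continuous_shift.
have -> : Ex P (fun w => centered phi l w * centered phi k w) =
    Ex P (fun w => centered phi l w * (centered phi k w - V' w)).
  rewrite -[RHS]addr0 -E0 -ExD; [|exact: L2M|exact: L2M].
  by congr (Ex P _); apply/funext => w; ring.
pose t := psir (k - l)%N + (k - l)%N.+1%:R^-1.
have t0 : 0 < t by rewrite /t ltr_wpDl // invr_gt0 ltr0n.
apply: le_trans (Ex_mul_le t0 LVl Ldiff) _.
have h1 : Ex P (fun w => (centered phi k w - V' w) ^+ 2) <= L ^+ 2 * t ^+ 2.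
  apply: (@le_trans _ _ (Ex P (fun w => L ^+ 2 * enorm (Dz w) ^+ 2))).
    apply: Ex_le; [exact: (proj2 Ldiff) | exact: L1Z |] => w.
    rewrite -exprMn -[leLHS](real_normK (num_real _)) ler_pXn2r ?nnegrE ?mulr_ge0 //.
    by rewrite /centered /V' opprB addrA subrK; exact: Lphi.
  have pt : psir (k - l)%N <= t by rewrite /t lerDl invr_ge0.
  by rewrite ExZ // ler_wpM2l ?sqr_ge0 // (le_trans ED) // ler_pXn2r ?nnegrE // ltW.
have h2 := Ex_centered_sqr l mB.
rewrite /rho -/t mulrDr; apply: lerD; first by rewrite ler_wpM2l // ltW.
have -> : t * L ^+ 2 = t^-1 * (L ^+ 2 * t ^+ 2) by field; rewrite gt_eqF.
by rewrite ler_wpM2l // invr_ge0 ltW.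
Qed.

End Decorrelation.

(** * Convergence of expectations *)

Section LowerIntegral.
Import HBNNSimple.
Context {d : measure_display} {T : measurableType d} {R : realType}.
Variable P : probability T R.
Implicit Types f h : T -> R.

(* The library integral of a nonnegative function is a supremum over simple
   minorants, so no measurability of [f] is needed. *)
Lemma lower_integral_le f h : (forall w, 0 <= f w) -> (forall w, f w <= h w) -> L1 P h ->
  (\int[P]_w (f w)%:E <= (Ex P h)%:E)%E.
Proof.
move=> f0 fh ih; rewrite EFin_Ex //.
rewrite !ge0_integralTE; [|by move=> w; rewrite lee_fin (le_trans (f0 w))|by move=> w; rewrite lee_fin].
apply: ereal_sup_le => _ [g /= gf <-]; exists g => // w.
by apply: le_trans (gf w) _; rewrite lee_fin.
Qed.

(** A simple minorant that nearly attains the supremum; the bound [c] makes this supremum finite. *)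
Lemma lower_integral_approx f (c e : R) : (forall w, 0 <= f w <= c) -> 0 < e ->
  exists h, [/\ L1 P h, forall w, 0 <= h w, forall w, h w <= f w &
    (\int[P]_w (f w)%:E <= (Ex P h + e)%:E)%E].
Proof.
move=> fc e0; have f0 w : 0 <= f w by case/andP: (fc w).
have ub : (\int[P]_w (f w)%:E <= c%:E)%E.
  rewrite -[c in leRHS](Ex_cst P); apply: lower_integral_le => // [w|]; last exact: L1_cst.
  by case/andP: (fc w).
have lb : (0 <= \int[P]_w (f w)%:E)%E by apply: integral_ge0 => w _; rewrite lee_fin.
have fin : (\int[P]_w (f w)%:E)%E \is a fin_num.
  by rewrite ge0_fin_numE // (le_lt_trans ub) // ltry.
move: fin; rewrite ge0_integralTE; last by move=> w; rewrite lee_fin.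
move=> fin; have [_ [g /= gf <-] gs] := ub_ereal_sup_adherent e0 fin.
have gf' w : g w <= f w by have := gf w; rewrite lee_fin.
have g0 w : 0 <= g w by exact: fun_ge0.
have ig : L1 P g.
  apply: (L1_le (Y := cst c)) => [|w|]; [exact: measurable_funP | | exact: L1_cst].
  by rewrite ger0_norm // (le_trans (gf' w)) //; case/andP: (fc w).
exists g; split => //; rewrite EFinD EFin_Ex // -leeBlDr // integral_nnsfun // patch_setT.
exact: ltW.
Qed.

(** Lower integrals are superadditive, which is the direction needed: the weighted sum of almost
    optimal measurable minorants stays below [h]. *)
Lemma lower_integral_sum (f : nat -> T -> R) (alpha : nat -> R) (c : R) h (N : nat) :
  (forall k, 0 <= alpha k) -> (forall k w, 0 <= f k w <= c) -> L1 P h ->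
  (forall w, \sum_(0 <= k < N) alpha k * f k w <= h w) ->
  (\sum_(0 <= k < N) (alpha k)%:E * \int[P]_w (f k w)%:E <= (Ex P h)%:E)%E.
Proof.
move=> a0 fc ih fh.
pose v k := fine (\int[P]_w (f k w)%:E)%E.
have vE k : (\int[P]_w (f k w)%:E)%E = (v k)%:E.
  rewrite fineK // ge0_fin_numE; last first.
    by apply: integral_ge0 => w _; rewrite lee_fin; case/andP: (fc k w).
  have [g [_ _ _ /le_lt_trans]] := lower_integral_approx (fc k) ltr01.
  by apply; rewrite ltry.
under eq_bigr do rewrite vE -EFinM.
rewrite sumEFin lee_fin.
have tN : 0 <= tau alpha N by apply: sumr_ge0 => k _.
apply/ler_addgt0Pr => e e0.
pose e' := e / (tau alpha N + 1).
have t1 : 0 < tau alpha N + 1 by rewrite ltr_wpDl.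
have e'0 : 0 < e' by rewrite divr_gt0.
have /choice [g Hg] : forall k, exists g, [/\ L1 P g, forall w, 0 <= g w,
    forall w, g w <= f k w & (\int[P]_w (f k w)%:E <= (Ex P g + e')%:E)%E].
  by move=> k; exact: lower_integral_approx (fc k) e'0.
have h1 : \sum_(0 <= k < N) alpha k * v k <=
    \sum_(0 <= k < N) alpha k * Ex P (g k) + tau alpha N * e'.
  rewrite /tau mulr_suml -big_split; apply: ler_sum => k _ /=.
  by rewrite -mulrDr ler_wpM2l // -lee_fin -vE; have [] := Hg k.
apply: le_trans h1 _; apply: lerD; last first.
  have : e' * (tau alpha N + 1) = e by rewrite divfK // gt_eqF.
  by move: (ltW e'0); lra.
have ig k : L1 P (fun w => alpha k * g k w) by apply: L1Z; have [] := Hg k.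
have -> : \sum_(0 <= k < N) alpha k * Ex P (g k) =
    Ex P (fun w => \sum_(0 <= k < N) alpha k * g k w).
  by rewrite Ex_sum //; apply: eq_bigr => k _; rewrite ExZ //; have [] := Hg k.
apply: Ex_le => //; first exact: L1_sum.
move=> w; apply: le_trans (fh w); apply: ler_sum => k _.
by rewrite ler_wpM2l //; have [] := Hg k.
Qed.

End LowerIntegral.

Lemma ereal_cvg0 (R : realType) (u : nat -> \bar R) : (forall k, (0 <= u k)%E) ->
  (forall e : R, 0 < e -> exists k0, forall k, (k0 <= k)%N -> (u k <= e%:E)%E) ->
  u @ \oo --> 0%E.
Proof.
move=> u0 H; have [k1 H1] := H 1 ltr01.
apply/fine_cvgP; split.
  exists k1 => // k /= /H1 uk; rewrite ge0_fin_numE //.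
  by apply: le_lt_trans uk _; rewrite ltry.
apply/cvgrPdist_le => e e0; have [k0 Hk0] := H _ e0.
exists (maxn k0 k1) => // k /=; rewrite geq_max => /andP[/Hk0 uk /H1 uk1].
rewrite sub0r normrN ger0_norm; last exact: fine_ge0.
rewrite -lee_fin fineK // ge0_fin_numE //.
by apply: le_lt_trans uk1 _; rewrite ltry.
Qed.

Lemma real_cvg0 (R : realType) (u : nat -> R) : (forall k, 0 <= u k) ->
  (forall e : R, 0 < e -> exists k0, forall k, (k0 <= k)%N -> u k <= e) ->
  u @ \oo --> 0.
Proof.
move=> u0 H; apply/cvgrPdist_le => e e0; have [k0 Hk0] := H _ e0.
by exists k0 => // k /= /Hk0 uk; rewrite sub0r normrN ger0_norm.
Qed.

Lemma convex_grad_lipschitz (R : realType) (n : nat) (X : set 'rV[R]_n)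
    (phi : 'rV[R]_n -> R) (U : R) :
  @convex_set R 'rV[R]_n X -> (forall s, X s -> differentiable phi s) ->
  (forall s, X s -> enorm (grad phi s) <= U) ->
  forall s s', X s -> X s' -> `|phi s - phi s'| <= U * enorm (s - s').
Proof.
move=> cX dphi gU s s' Xs Xs'.
pose line t := s' + t *: (s - s').
have Xl (t : R) : t \in `[0, 1]%R -> X (line t).
  by rewrite in_itv /= => t01; exact: (convex_setE cX).
have dline (t : R) : is_derive t (1 : R) line (s - s').
  have -> : line = cst s' + (fun t => t *: (s - s')) by [].
  rewrite -[s - s' in X in is_derive _ _ _ X]add0r; apply: is_deriveD.
  apply: DeriveDef; first exact/derivable1_diffP/differentiableZl.
  apply: lim_near_cst => //; near=> h.
  have h0 : h != 0 by near: h; exact: nbhs_dnbhs_neq.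
  by rewrite /= -scalerBl addrK scalerA [_ *: 1]mulr1 mulVf // scale1r.
have dpl (t : R) : t \in `[0, 1]%R -> is_derive t (1 : R) (phi \o line) (dot (grad phi (line t)) (s - s')).
  move=> t01; have dl : differentiable line t by apply/derivable1_diffP; case: (dline t).
  have dp := dphi _ (Xl t t01).
  apply: DeriveDef; first exact/derivable1_diffP/differentiable_comp.
  rewrite deriveE; last exact: differentiable_comp.
  have E : 'd line t (1 : R) = s - s' by rewrite -deriveE //; case: (dline t).
  by rewrite diff_comp //= E -deriveE // derive_grad.
pose dphil t := dot (grad phi (line t)) (s - s').
have H1 (t : R) : t \in `]0, 1[%R -> is_derive t 1 (phi \o line) (dphil t).
  by move=> t01; apply: dpl; exact: subset_itv_oo_cc t01.
have H2 : {within `[0, 1], continuous (phi \o line)}.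
  by apply: derivable_within_continuous => t t01; case: (dpl t t01).
have [t t01 E] := MVT_segment ler01 H1 H2.
move: E; rewrite /line /= scale0r addr0 scale1r [s' + _]addrC subrK subr0 mulr1 => ->.
apply: le_trans (cauchy_schwarz_abs _ _) _.
by rewrite ler_wpM2r // gU //; exact: Xl.
Unshelve. all: by end_near. Qed.

(** * Noise of the stochastic gradient *)

Section Noise.
Context {R : realType} {d : measure_display} {T : measurableType d} {n p : nat}.
Variables (P : probability T R) (X : set 'rV[R]_n).
Variables (G : 'rV[R]_n -> 'rV[R]_p -> 'rV[R]_n) (phi : 'rV[R]_n -> R) (l : R).
Variables (z : nat -> T -> 'rV[R]_p).
Local Notation g := (grad phi).
Hypothesis compX : compact X.
Hypothesis cX : @convex_set R 'rV[R]_n X.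
Hypothesis X0 : X 0.
Hypothesis G_lip_x : forall s s' u, X s -> X s' ->
  enorm (G s u - G s' u) <= l * enorm (s - s').
Hypothesis G_lip_u : forall s u u', X s ->
  enorm (G s u - G s u') <= l * enorm (u - u').
Hypothesis rz : forall k, random_vector (z k).
Hypothesis phi_diff : forall s, X s -> differentiable phi s.
Hypothesis G_mean : forall s k, X s -> vintegrable P (fun w => G s (z k w)) /\
  vmean P (fun w => G s (z k w)) = g s.

Lemma Ex_abs_le (Y : T -> R) (c : R) : L1 P Y -> (forall w, `|Y w| <= c) -> `|Ex P Y| <= c.
Proof.
move=> iY Yc; rewrite ler_norml; apply/andP; split.
  rewrite -(Ex_cst P (- c)); apply: Ex_le => //; first exact: L1_cst.
  by move=> w; have := Yc w; rewrite ler_norml => /andP[].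
rewrite -[leRHS](Ex_cst P c); apply: Ex_le => //; first exact: L1_cst.
by move=> w; have := Yc w; rewrite ler_norml => /andP[].
Qed.

Lemma L1_noise_coord s k c : X s -> L1 P (fun w => G s (z k w) 0 c).
Proof. by move=> Xs; have [/(_ c)] := G_mean k Xs. Qed.

Lemma Ex_noise_coord s k c : X s -> Ex P (fun w => G s (z k w) 0 c) = g s 0 c.
Proof. by move=> Xs; have [_ <-] := G_mean k Xs; rewrite mxE unlock. Qed.

Lemma problem_constants : exists M : R, [/\ 1 <= M,
   forall s s', X s -> X s' -> enorm (s - s') <= M,
   forall s, X s -> enorm (g s) <= M &
   [/\ forall s s', X s -> X s' -> enorm (g s - g s') <= M * enorm (s - s'),
   forall s s' u, X s -> X s' -> enorm (G s u - G s' u) <= M * enorm (s - s'),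
   forall s u u', X s -> enorm (G s u - G s u') <= M * enorm (u - u') &
   forall s s', X s -> X s' -> `|phi s - phi s'| <= M * enorm (s - s')]].
Proof.
have [D D0 XD] := compact_enorm_bounded compX.
(* The bound for [g] is derived coordinate by coordinate from expectations, which costs a factor
   [n]; [l] comes without a sign. *)
pose Lg := n%:R * `|l|.
have Lg0 : 0 <= Lg by rewrite mulr_ge0.
have glip s s' : X s -> X s' -> enorm (g s - g s') <= Lg * enorm (s - s').
  move=> Xs Xs'; apply: le_trans (enorm_sum_coord _) _.
  have -> : Lg * enorm (s - s') = \sum_(c < n) `|l| * enorm (s - s').
    by rewrite sumr_const card_ord -[RHS]mulr_natl /Lg mulrA.
  apply: ler_sum => c _; rewrite [in leLHS]mxE [X in _ + X]mxE.
  rewrite -(Ex_noise_coord 0 c Xs) -(Ex_noise_coord 0 c Xs').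
  rewrite -ExB; [|exact: L1_noise_coord|exact: L1_noise_coord].
  apply: Ex_abs_le.
    have := L1D (L1_noise_coord 0 c Xs) (L1Z (-1) (L1_noise_coord 0 c Xs')).
    by congr (L1 _ _); apply/funext => w; rewrite mulN1r.
  move=> w; have := enorm_coord (G s (z 0%N w) - G s' (z 0%N w)) c; rewrite !mxE => H.
  apply: le_trans H _; apply: le_trans (G_lip_x _ Xs Xs') _.
  by rewrite ler_wpM2r // ler_norm.
pose U := enorm (g 0) + Lg * D.
have U0 : 0 <= U by rewrite addr_ge0 // mulr_ge0 // ltW.
have gU s : X s -> enorm (g s) <= U.
  move=> Xs; have := glip s 0 Xs X0; rewrite subr0 => H.
  have := ler_enorm_dist (g 0) (g s) 0; rewrite !subr0.
  have : Lg * enorm s <= Lg * D by rewrite ler_wpM2l // XD.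
  by rewrite /U; lra.
have Ul := convex_grad_lipschitz cX phi_diff gU.
pose M := 1 + 2 * D + Lg + `|l| + U.
have l0 := normr_ge0 l.
have LgM : Lg <= M by rewrite /M; lra.
have lM : `|l| <= M by rewrite /M; lra.
have UM : U <= M by rewrite /M; lra.
exists M; split; [by rewrite /M; lra | | |split].
- move=> s s' Xs Xs'; apply: le_trans (ler_enormB _ _) _.
  by have := XD _ Xs; have := XD _ Xs'; rewrite /M; lra.
- by move=> s /gU /le_trans; apply.
- move=> s s' Xs Xs'; apply: le_trans (glip _ _ Xs Xs') _.
  by rewrite ler_wpM2r.
- move=> s s' u Xs Xs'; apply: le_trans (G_lip_x _ Xs Xs') _.
  by rewrite ler_wpM2r // (le_trans (ler_norm l)).
- move=> s u u' Xs; apply: le_trans (G_lip_u _ _ Xs) _.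
  by rewrite ler_wpM2r // (le_trans (ler_norm l)).
- move=> s s' Xs Xs'; apply: le_trans (Ul _ _ Xs Xs') _.
  by rewrite ler_wpM2r.
Qed.

Variable M : R.
Hypothesis M1 : 1 <= M.
Hypothesis X_diam : forall s s', X s -> X s' -> enorm (s - s') <= M.
Hypothesis g_bnd : forall s, X s -> enorm (g s) <= M.
Hypothesis g_lip : forall s s', X s -> X s' -> enorm (g s - g s') <= M * enorm (s - s').
Hypothesis G_lip : forall s s' u, X s -> X s' ->
  enorm (G s u - G s' u) <= M * enorm (s - s').
Hypothesis G_lipu : forall s u u', X s ->
  enorm (G s u - G s u') <= M * enorm (u - u').

Let M0 : 0 <= M.
Proof. exact: le_trans ler01 M1. Qed.

Definition noise_coord s (c : 'I_n) u : R := (G s u - g s) 0 c.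

(** One bound for the noise and the gradient at every state, in terms of the datum at state 0:
    changing the state costs [2 M ^+ 2], and the last [M] accounts for [g]. It is Lipschitz in [u],
    so it decorrelates like the noise itself. *)
Definition noise_size u : R := enorm (G 0 u - g 0) + (2 * M ^+ 2 + M).

Lemma noise_coord_lip s c : X s -> forall u u',
  `|noise_coord s c u - noise_coord s c u'| <= M * enorm (u - u').
Proof.
move=> Xs u u'; apply: le_trans (G_lipu _ _ Xs).
by have := enorm_coord (G s u - G s u') c; rewrite /noise_coord !mxE opprB addrA subrK.
Qed.

Lemma noise_size_lip u u' : `|noise_size u - noise_size u'| <= M * enorm (u - u').
Proof.
apply: le_trans (G_lipu _ _ X0).
rewrite /noise_size opprD addrACA subrr addr0.
by apply: le_trans (ler_dist_enorm _ _) _; rewrite opprB addrA subrK.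
Qed.

Lemma noise_size_ge u : M <= noise_size u.
Proof.
have m0 := M0; have : 0 <= M ^+ 2 by exact: sqr_ge0.
by have := enorm_ge0 (G 0 u - g 0); rewrite /noise_size; lra.
Qed.

Lemma noise_size_W s u : X s -> enorm (G s u - g s) <= noise_size u.
Proof.
move=> Xs; have m0 := M0.
have -> : G s u - g s = (G 0 u - g 0) + ((G s u - G 0 u) - (g s - g 0)).
  by apply/rowP => j; rewrite !mxE; ring.
apply: le_trans (ler_enormD _ _) _; rewrite /noise_size lerD2l.
apply: le_trans (ler_enormB _ _) _.
have sM : M * enorm (s - 0) <= M * M by rewrite ler_wpM2l // X_diam.
by have := G_lip u Xs X0; have := g_lip Xs X0; rewrite expr2; lra.
Qed.

Lemma noise_size_G s u : X s -> enorm (G s u) <= noise_size u.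
Proof.
move=> Xs; have m0 := M0.
have -> : G s u = (G 0 u - g 0) + (((G s u - G 0 u) - (g s - g 0)) + g s).
  by apply/rowP => j; rewrite !mxE; ring.
apply: le_trans (ler_enormD _ _) _; rewrite /noise_size lerD2l.
apply: le_trans (ler_enormD _ _) _; apply: lerD; last exact: g_bnd.
apply: le_trans (ler_enormB _ _) _.
have sM : M * enorm (s - 0) <= M * M by rewrite ler_wpM2l // X_diam.
by have := G_lip u Xs X0; have := g_lip Xs X0; rewrite expr2; lra.
Qed.

Lemma Ex_noise_coord0 s c k : X s -> Ex P (noise_coord s c \o z k) = 0.
Proof.
move=> Xs; rewrite -(subrr (g s 0 c)) -{1}(Ex_noise_coord k c Xs).
rewrite -(Ex_cst P (g s 0 c)) -ExB; [|exact: L1_noise_coord|exact: L1_cst].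
by congr (Ex P _); apply/funext => w; rewrite /noise_coord /= !mxE.
Qed.

Lemma centered_noise_coord s c k : X s -> centered P z (noise_coord s c) k = noise_coord s c \o z k.
Proof. by move=> Xs; apply/funext => w; rewrite /centered Ex_noise_coord0 // subr0. Qed.

Definition decorrelated_noise := (forall s c, X s -> decorrelated P z (noise_coord s c)) /\
  decorrelated P z noise_size.

Lemma A3_decorrelated : L_mixing P z -> decorrelated_noise.
Proof.
move=> mix; split => [s c Xs|].
  by apply: (L_mixing_decorrelated rz M0 _ mix); exact: noise_coord_lip.
by apply: (L_mixing_decorrelated rz M0 _ mix); exact: noise_size_lip.
Qed.

Lemma A2_bounded_second_moment : assumption_A2 P X G g z -> exists B : R,
  (forall s c, X s -> bounded_second_moment P z (noise_coord s c) B) /\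
  bounded_second_moment P z noise_size B.
Proof.
move=> [_ [sigma Hs]].
pose c0 := 2 * M ^+ 2 + M.
have cW s : X s -> continuous (fun u => enorm (G s u - g s)).
  move=> Xs; apply: (@lipschitz_continuous _ _ _ M) => u u'.
  apply: le_trans (ler_dist_enorm _ _) _; rewrite opprB addrA subrK.
  exact: G_lipu.
have mW s k : X s -> measurable_fun setT (fun w => enorm (G s (z k w) - g s)).
  by move=> Xs; apply: (random_vector_measurable (cW s Xs) (@rz k)).
have W2 s k : X s -> L1 P (fun w => enorm (G s (z k w) - g s) ^+ 2) /\
    Ex P (fun w => enorm (G s (z k w) - g s) ^+ 2) <= sigma ^+ 2.
  move=> Xs; apply: Ex_le_bound; [|by move=> w; exact: sqr_ge0|].
    by apply: measurable_funX; exact: mW.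
  by have := Hs s k Xs; rewrite unlock.
have s20 : 0 <= sigma ^+ 2 by exact: sqr_ge0.
have c20 : 0 <= c0 ^+ 2 by exact: sqr_ge0.
exists (2 * sigma ^+ 2 + 2 * c0 ^+ 2); split => [s c Xs k|k].
  have [iW EW] := W2 s k Xs.
  have mc : measurable_fun setT (noise_coord s c \o z k).
    apply: random_vector_measurable (@rz k).
    by apply: lipschitz_continuous (noise_coord_lip c Xs).
  have L : L2 P (noise_coord s c \o z k).
    apply: (L2_le (Y := fun w => enorm (G s (z k w) - g s))) => //.
      by move=> w; exact: enorm_coord.
    by split; first exact: mW.
  split => //; apply: (@le_trans _ _ (sigma ^+ 2)); last by lra.
  apply: le_trans EW; apply: Ex_le => //; first exact: (proj2 L).
  move=> w; rewrite -[leLHS](real_normK (num_real _)) ler_pXn2r ?nnegrE //.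
  exact: enorm_coord.
have [iW EW] := W2 0 k X0.
have LW : L2 P (fun w => enorm (G 0 (z k w) - g 0)) by split; first exact: mW.
have L : L2 P (noise_size \o z k) by exact: (L2D LW (L2_cst P c0)).
split => //.
apply: (@le_trans _ _ (Ex P (fun w => 2 * enorm (G 0 (z k w) - g 0) ^+ 2 + cst (2 * c0 ^+ 2) w))).
  apply: Ex_le; [exact: (proj2 L)|by apply: L1D; [exact: L1Z|exact: L1_cst]|] => w.
  rewrite /noise_size -/c0 /=; have := sqr_ge0 (enorm (G 0 (z k w) - g 0) - c0).
  by move: (enorm _) => a; rewrite !expr2; lra.
rewrite ExD; [|exact: L1Z|exact: L1_cst]; rewrite ExZ // Ex_cst; lra.
Qed.

Lemma A2_decorrelated : assumption_A2 P X G g z -> decorrelated_noise.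
Proof.
move=> A2; have [B [Bc Bs]] := A2_bounded_second_moment A2; have [ind _] := A2.
split => [s c Xs|].
  apply: independent_decorrelated (Bc s c Xs) => //.
  by apply: lipschitz_continuous (noise_coord_lip c Xs).
apply: independent_decorrelated Bs => //.
by apply: lipschitz_continuous noise_size_lip.
Qed.

End Noise.

(** The exponential moments at plus and minus the coordinate vectors control the second moment of
    each coordinate, since [a ^+ 2 <= 4 * (expR a + expR (- a))]; this gives the constant 8. *)
Lemma A1_A2 (R : realType) (d : measure_display) (T : measurableType d) (n p : nat)
  (P : probability T R) (X : set 'rV[R]_n) (G : 'rV[R]_n -> 'rV[R]_p -> 'rV[R]_n)
  (g : 'rV[R]_n -> 'rV[R]_n) (x0 : T -> 'rV[R]_n) (z : nat -> T -> 'rV[R]_p) :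
  (forall k, random_vector (z k)) ->
  assumption_A1 P X G g x0 z -> assumption_A2 P X G g z.
Proof.
move=> rz [[e Ge] [ind _] _ _ [sigma s0 Hexp]]; split => //.
subst p; pose E := expR (2^-1 * sigma ^+ 2 : R).
have E0 : 0 <= E by exact: expR_ge0.
exists (Num.sqrt (n%:R * (8 * E))) => x k Xx.
rewrite sqr_sqrtr ?mulr_ge0 // unlock.
have mz c : measurable_fun setT (fun w => z k w 0 c).
  have cc : continuous (fun u : 'rV[R]_n => u 0 c).
    apply: (@lipschitz_continuous _ _ _ 1) => u v.
    by rewrite mul1r; have := enorm_coord (u - v) c; rewrite !mxE.
  exact: (random_vector_measurable cc (@rz k)).
have coord (c : 'I_n) : L1 P (fun w => z k w 0 c ^+ 2) /\ Ex P (fun w => z k w 0 c ^+ 2) <= 8 * E.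
  have expo (sg : R) : sg ^+ 2 = 1 -> L1 P (fun w => expR (sg * z k w 0 c)) /\
      Ex P (fun w => expR (sg * z k w 0 c)) <= E.
    move=> sg2; apply: Ex_le_bound => [|w|]; [|exact: expR_ge0|].
      by apply: measurableT_comp => //; exact: measurable_funM.
    have := Hexp k (sg *: delta_mx 0 c); rewrite unlock enorm2 !dotE mulrA -expr2 sg2 mul1r.
    have dd v : dot (delta_mx 0 c : 'rV[R]_n) v = v 0 c.
      rewrite /dot (bigD1 c) //= big1 => [|j jc]; first by rewrite mxE !eqxx mul1r addr0.
      by rewrite mxE (negbTE jc) mul0r.
    rewrite dd mxE !eqxx mulr1 => H; apply: le_trans H; rewrite le_eqVlt; apply/orP; left; apply/eqP.
    by apply: eq_integral => w _; rewrite dotZl dd.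
  have [i1 E1] := expo 1 (expr1n _ 2); have [i2 E2] := expo (-1) (etrans (sqrrN 1) (expr1n _ 2)).
  have le w : z k w 0 c ^+ 2 <= 4 * (expR (1 * z k w 0 c) + expR (-1 * z k w 0 c)).
    rewrite mul1r mulN1r; move: (z k w 0 c) => a.
    (* [expR b] is the square of [expR (b / 2)], which is at least [1 + b / 2]. *)
    have half (b : R) : 0 <= b -> b ^+ 2 <= 4 * expR b.
      move=> b0; have := expR_ge1Dx (b / 2); have -> : expR b = expR (b / 2) ^+ 2.
        by rewrite expr2 -expRD; congr expR; lra.
      by move: (expR _) => r; nra.
    have := expR_ge0 a; have := expR_ge0 (- a).
    have [a0|a0] := leP 0 a; first by have := half a a0; lra.
    by have := half (- a); rewrite sqrrN oppr_ge0 (ltW a0) => /(_ isT); lra.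
  have i12 := L1Z 4 (L1D i1 i2).
  have i : L1 P (fun w => z k w 0 c ^+ 2).
    apply: L1_le i12 => [|w]; first exact: measurable_funX.
    by rewrite ger0_norm ?sqr_ge0.
  split => //; apply: le_trans (Ex_le i i12 le) _; rewrite ExZ; last exact: L1D.
  by rewrite ExD //; lra.
have -> : (\int[P]_w (enorm (G x (z k w) - g x) ^+ 2)%:E =
    \int[P]_w (\sum_(c < n) z k w 0 c ^+ 2)%:E)%E.
  apply: eq_integral => w _; rewrite Ge // addrC addKr castmx_id enorm2.
  by congr EFin; apply: eq_bigr => c _; rewrite expr2.
have i c := (coord c).1.
rewrite -EFin_Ex ?lee_fin; last exact: L1_sum.
rewrite Ex_sum // -[n in leRHS]card_ord mulr_natl -sumr_const.
by apply: ler_sum => c _; have [] := coord c.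
Qed.

(** * Convergence of projected SGD *)

Lemma common_threshold (I : eqType) (s : seq I) (Q : I -> nat -> Prop) :
  (forall x, x \in s -> exists k0, forall k, (k0 <= k)%N -> Q x k) ->
  exists k0, forall x, x \in s -> forall k, (k0 <= k)%N -> Q x k.
Proof.
elim: s => [|x s IH] H; first by exists 0%N.
have [k1 H1] := H x (mem_head _ _).
have [|k2 H2] := IH; first by move=> y ys; apply: H; rewrite inE ys orbT.
exists (maxn k1 k2) => y; rewrite inE => /orP[/eqP ->|ys] k; rewrite geq_max => /andP[? ?].
  exact: H1.
exact: H2.
Qed.

Lemma ler_sum_term (R : numDomainType) (I : eqType) (s : seq I) (F : I -> R) (x : I) :
  (forall y, 0 <= F y) -> x \in s -> F x <= \sum_(y <- s) F y.
Proof.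
by move=> F0 xs; rewrite (big_rem x xs) /= lerDl; apply: sumr_ge0.
Qed.

Section SumExpectation.
Context {d : measure_display} {T : measurableType d} {R : realType}.
Variable P : probability T R.

Lemma Ex_big_le (I : eqType) (s : seq I) (H : I -> T -> R) (e : R) :
  (forall x, x \in s -> L1 P (H x) /\ Ex P (H x) <= e) ->
  L1 P (fun w => \sum_(x <- s) H x w) /\
  Ex P (fun w => \sum_(x <- s) H x w) <= (size s)%:R * e.
Proof.
elim: s => [|x s IH] Hs.
  under eq_fun do rewrite big_nil.
  by split; [exact: (L1_cst P 0) | rewrite (Ex_cst P 0) mul0r].
have [i1 E1] := Hs x (mem_head _ _).
have [|i2 E2] := IH; first by move=> y ys; apply: Hs; rewrite inE ys orbT.
under eq_fun do rewrite big_cons.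
by split; [exact: L1D | rewrite ExD //= -natr1 mulrDl mul1r addrC lerD].
Qed.

(** By monotone convergence the series of the [Z i] is integrable, hence almost surely finite, and
    the terms of a convergent series tend to 0. *)
Lemma ae_summable_cvg0 (Z : nat -> T -> R) (A : R) :
  (forall i, L1 P (Z i)) -> (forall i w, 0 <= Z i w) ->
  (forall N, \sum_(0 <= i < N) Ex P (Z i) <= A) ->
  {ae P, forall w, forall e, 0 < e -> exists i0, forall i, (i0 <= i)%N -> Z i w <= e}.
Proof.
move=> iZ Z0 HA.
have mZ i : measurable_fun setT (fun w => (Z i w)%:E).
  by apply/measurable_EFinP; exact: L1_measurable (iZ i).
have Z0' i w : (0 <= (Z i w)%:E)%E by rewrite lee_fin.
have E : (\int[P]_w (\sum_(0 <= i <oo) (Z i w)%:E) <= A%:E)%E.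
  rewrite integral_nneseries //.
  apply: lime_le.
    by apply: is_cvg_nneseries => i _ _; apply: integral_ge0 => w _.
  apply: nearW => N; under eq_bigr do rewrite -EFin_Ex //.
  by rewrite sumEFin lee_fin.
have iS : P.-integrable setT (fun w => \sum_(0 <= i <oo) (Z i w)%:E)%E.
  apply/integrableP; split.
    by apply: ge0_emeasurable_sum => // i _; exact: mZ.
  under eq_integral do rewrite gee0_abs ?nneseries_ge0 //.
  by apply: le_lt_trans E _; rewrite ltry.
have [N [mN N0 HN]] := integrable_ae measurableT iS.
exists N; split => // w nw; apply: HN => H; have fin := H I; apply: nw => e e0.
have soo : (\sum_(0 <= i <oo) (Z i w)%:E < +oo)%E by rewrite ltey_eq fin.
have [B B0 HB] := nneseries_partial_bound (fun i => Z0 i w) soo.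
exact: bounded_series_cvg0 HB e e0.
Qed.

End SumExpectation.

(** * Fluctuations along the windows: decay and summability of their expectations *)

Section Tracking.
Context {R : realType} {d : measure_display} {T : measurableType d} {n p : nat}.
Variables (P : probability T R) (X : set 'rV[R]_n).
Variables (G : 'rV[R]_n -> 'rV[R]_p -> 'rV[R]_n) (phi : 'rV[R]_n -> R).
Variables (z : nat -> T -> 'rV[R]_p) (x0 : T -> 'rV[R]_n) (alpha : nat -> R).
Variables (xC : nat -> R -> T -> 'rV[R]_n) (M : R) (K : nat -> nat).
Local Notation g := (grad phi).
Local Notation tau := (tau alpha).
Let x w := psgd alpha X G (x0 w) (z ^~ w).
Hypothesis compX : compact X.
Hypothesis cX : @convex_set R 'rV[R]_n X.
Hypothesis X0 : X 0.
Hypothesis rz : forall k, random_vector (z k).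
Hypothesis G_mean : forall s k, X s -> vintegrable P (fun w => G s (z k w)) /\
  vmean P (fun w => G s (z k w)) = g s.
Hypothesis M1 : 1 <= M.
Hypothesis X_diam : forall s s', X s -> X s' -> enorm (s - s') <= M.
Hypothesis g_bnd : forall s, X s -> enorm (g s) <= M.
Hypothesis g_lip : forall s s', X s -> X s' -> enorm (g s - g s') <= M * enorm (s - s').
Hypothesis G_lip : forall s s' u, X s -> X s' ->
  enorm (G s u - G s' u) <= M * enorm (s - s').
Hypothesis G_lipu : forall s u u', X s ->
  enorm (G s u - G s u') <= M * enorm (u - u').
Hypothesis x0X : forall w, X (x0 w).
Hypothesis alpha_bnd : forall k, 0 < alpha k <= 2^-1.
Hypothesis alpha0 : forall e, 0 < e -> exists k0, forall k, (k0 <= k)%N -> alpha k <= e.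
Hypothesis K0 : K 0%N = 0%N.
Hypothesis KS : forall i, (K i < K i.+1)%N.
Hypothesis Kt : forall i, 2^-1 <= tau (K i.+1) - tau (K i) <= 1.
Hypothesis flow : forall i w, projected_gradient_flow X g
  (tau (K i)) (tau (K i.+1)) (fun t => xC i t w).
Hypothesis xCK : forall i w, xC i (tau (K i)) w = x w (K i).

Let clX : closed X.
Proof. exact: compact_closed (@norm_hausdorff _ _) compX. Qed.

Let K_ge i : (i <= K i)%N.
Proof. by elim: i => // i IH; rewrite (leq_ltn_trans IH). Qed.

Let alpha_ge0 k : 0 <= alpha k.
Proof. by case/andP: (alpha_bnd k) => /ltW. Qed.

Definition path_fluctuation (a : nat -> nat) (J : nat) (F : seq 'rV[R]_n) w :=
  fluctuation alpha G g (z ^~ w) (fun k => noise_size G phi M (z k w))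
    (fun k => Ex P (noise_size G phi M \o z k)) a J F.

Lemma path_fluctuation_ge0 a J F w : 0 <= path_fluctuation a J F w.
Proof.
apply: sumr_ge0 => q _; rewrite addr_ge0 ?sqr_ge0 //.
by do 2 (apply: sumr_ge0 => ? _); exact: sqr_ge0.
Qed.

(** [J], [F] and [C] are the same for all windows and all sample points, so one decay statement for
    [path_fluctuation] serves both modes of convergence. *)
Lemma tracking_fluctuation (Mg eta : R) : 0 <= Mg ->
  (forall k, Ex P (noise_size G phi M \o z k) <= Mg) -> 0 < eta ->
  exists (J : nat) (F : seq 'rV[R]_n) (C : R) (i0 : nat) (bd : nat -> nat -> nat),
  [/\ 0 <= C, forall s, s \in F -> X s,
      forall i, [/\ bd i 0%N = K i, bd i J = K i.+1 &
         forall q, (bd i q <= bd i q.+1)%N] &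
      forall i w m, (i0 <= i)%N -> (K i <= m <= K i.+1)%N ->
        enorm (x w m - xC i (tau m) w) <= eta + C * path_fluctuation (bd i) J F w].
Proof.
move=> Mg0 HMg eta0; have m1 := M1; have m0 : 0 < M by lra.
pose E := expR (4 * M); have E0 : 0 < E by exact: expR_gt0.
pose a0 := 120 * M * Mg ^+ 2 + 4 * M * Mg.
have a00 : 0 <= a0 by rewrite addr_ge0 ?mulr_ge0 ?sqr_ge0 ?(ltW m0).
have t0 : 0 < eta ^+ 2 / 3 by rewrite divr_gt0 // exprn_gt0.
(* The three deterministic terms, governed by [J], [eps] and [kappa], each receive a third of
   [eta ^+ 2]. *)
set t := eta ^+ 2 / 3 in t0.
have [J J0 HJ] : exists2 J, (0 < J)%N & a0 * J%:R^-1 * E <= t.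
  exists (Num.truncn (a0 * E / t)).+1 => //.
  rewrite mulrAC ler_pdivrMr ?ltr0n // [t * _]mulrC -ler_pdivrMr //.
  exact/ltW/truncnS_gt.
have Jr : 0 < J%:R^-1 :> R by rewrite invr_gt0 ltr0n.
have [eps eps0 Heps] : exists2 eps, 0 < eps & 4 * M ^+ 2 * eps * E <= t.
  have c0 : 0 < 4 * M ^+ 2 * E by rewrite !mulr_gt0 // exprn_gt0.
  exists (t / (4 * M ^+ 2 * E)); first by rewrite divr_gt0.
  by rewrite mulrAC mulrC divfK // gt_eqF.
have [F [FX net]] := compact_net compX eps0.
have [kappa k0 Hkappa] : exists2 kappa, 0 < kappa &
    2 * M * (J%:R * (size F)%:R * n%:R + 1) * kappa * E <= t.
  have c0 : 0 < 2 * M * (J%:R * (size F)%:R * n%:R + 1) * E.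
    by rewrite !mulr_gt0 // ltr_wpDl // !mulr_ge0.
  exists (t / (2 * M * (J%:R * (size F)%:R * n%:R + 1) * E)); first by rewrite divr_gt0.
  by rewrite mulrAC mulrC divfK // gt_eqF.
have [i0 Hi0] := alpha0 Jr.
(* From [i0] on the steps are at most [1 / J], so the pieces are at most [2 / J] long. Earlier
   windows are cut with the crude step bound 1/2, only to make [bd] total. *)
have /choice [bd Hbd] : forall i, exists a : nat -> nat, [/\ a 0%N = K i, a J = K i.+1,
    forall q, (a q <= a q.+1)%N &
    (i0 <= i)%N -> forall q, tau (a q.+1) - tau (a q) <= 2 * J%:R^-1].
  move=> i; have /andP[_ ti] := Kt i.
  have [i0i|ii0] := leqP i0 i.
    have [k ik|a [a1 a2 a3 a4]] := window_pieces alpha_bnd (ltnW (KS i)) J0 ti (ltW Jr).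
      by apply: Hi0; rewrite (leq_trans i0i) // (leq_trans (K_ge i)).
    by exists a; split => // _ q; apply: le_trans (a4 q) _; lra.
  have h2 : 0 <= 2^-1 :> R by lra.
  have [k ik|a [a1 a2 a3 a4]] := window_pieces alpha_bnd (ltnW (KS i)) J0 ti h2.
    by case/andP: (alpha_bnd k).
  by exists a; split => // /(leq_ltn_trans)/(_ ii0); rewrite ltnn.
pose C1 := (30 * M + 2 * M / kappa) * E.
have C10 : 0 <= C1.
  by rewrite mulr_ge0 ?(ltW E0) // addr_ge0 // ?divr_ge0 ?mulr_ge0 ?(ltW m0) ?(ltW k0).
(* The square root of [eta ^+ 2 + C1 * Z] is at most [eta + C1 / eta * Z]. *)
exists J, F, (C1 / eta), i0, bd; split => //.
- by rewrite divr_ge0 // ltW.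
- by move=> i; have [] := Hbd i.
move=> i w m i0i Km; have [b1 b2 b3 b4] := Hbd i; have /andP[_ ti] := Kt i.
have xS k : x w k.+1 = eproj X (x w k - alpha k *: G (x w k) (z k w)) by [].
have := window_tracking_fluctuation (z := z ^~ w) (x := x w)
   (Gam := fun k => noise_size G phi M (z k w))
   (mG := fun k => Ex P (noise_size G phi M \o z k))
   alpha_bnd clX cX M1 X_diam g_bnd g_lip G_lip
   (fun k => noise_size_ge G phi M1 (z k w))
   (fun s k Xs => noise_size_G X0 M1 X_diam g_bnd g_lip G_lip (z k w) Xs)
   (fun s k Xs => noise_size_W X0 M1 X_diam g_lip G_lip (z k w) Xs)
   (x0X w) xS (flow i w) (xCK i w) (ltW eps0) k0 Mg0 J0 HMg FX net ti b1 b2 b3 (b4 i0i) Km.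
rewrite -/a0 -/E -/(path_fluctuation (bd i) J F w).
have Z0 := path_fluctuation_ge0 (bd i) J F w.
set Z := path_fluctuation _ _ _ _ in Z0 * => H.
have {}H : enorm (x w m - xC i (tau m) w) ^+ 2 <= eta ^+ 2 + C1 * Z.
  apply: le_trans H _; rewrite 3!(mulrDl _ _ E) [_ * Z * E]mulrAC -/C1.
  have -> : eta ^+ 2 = t + t + t by rewrite /t; lra.
  by rewrite lerD2r lerD // lerD.
have c0 : 0 <= C1 / eta * Z by rewrite mulr_ge0 // divr_ge0 // ltW.
rewrite -(@ler_pXn2r _ 2%N) ?nnegrE //; last by rewrite addr_ge0 // ltW.
apply: le_trans H _; rewrite sqrrD.
have -> : eta * (C1 / eta * Z) = C1 * Z by rewrite mulrA mulrCA divff ?gt_eqF // mulr1.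
have CZ : 0 <= C1 * Z by rewrite mulr_ge0.
by have := sqr_ge0 (C1 / eta * Z); lra.
Qed.

Lemma Ex_path_fluctuation_le (a : nat -> nat) (J : nat) (F : seq 'rV[R]_n) (e : R) :
  decorrelated_noise P X G phi z M -> (forall s, s \in F -> X s) ->
  (forall q, (q < J)%N ->
     Ex P (fun w => weighted_sum alpha (centered P z (noise_size G phi M)) (a q) (a q.+1) w ^+ 2) <= e) ->
  (forall q s c, (q < J)%N -> s \in F ->
     Ex P (fun w => weighted_sum alpha (centered P z (noise_coord G phi s c)) (a q) (a q.+1) w ^+ 2) <= e) ->
  L1 P (path_fluctuation a J F) /\
  Ex P (path_fluctuation a J F) <= J%:R * (e + (size F)%:R * (n%:R * e)).
Proof.
move=> [dc [B [rho [ms _ _]]]] FX Hs Hc.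
have := @Ex_big_le _ _ _ P _ (index_iota 0 J) (fun q w =>
  size_part alpha (fun k => noise_size G phi M (z k w))
    (fun k => Ex P (noise_size G phi M \o z k)) (a q) (a q.+1) ^+ 2 +
    \sum_(s <- F) \sum_(c < n) noise_part alpha G g (z ^~ w) (a q) (a q.+1) s c ^+ 2)
  (e + (size F)%:R * (n%:R * e)).
rewrite size_iota subn0; apply=> q; rewrite mem_index_iota => /andP[_ qJ].
have iS : L1 P (fun w => size_part alpha (fun k => noise_size G phi M (z k w))
    (fun k => Ex P (noise_size G phi M \o z k)) (a q) (a q.+1) ^+ 2).
  have L k : L2 P (centered P z (noise_size G phi M) k) by exact: L2_centered ms.
  exact: (proj2 (L2_weighted_sum alpha L (a q) (a q.+1))).
suff HN s : s \in F -> L1 P (fun w => \sum_(c < n)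
      noise_part alpha G g (z ^~ w) (a q) (a q.+1) s c ^+ 2) /\
    Ex P (fun w => \sum_(c < n)
      noise_part alpha G g (z ^~ w) (a q) (a q.+1) s c ^+ 2) <= n%:R * e.
  have [iN EN] := Ex_big_le HN; split; first exact: L1D.
  by rewrite ExD //; apply: lerD => //; exact: Hs.
move=> sF; have Xs := FX s sF.
have := @Ex_big_le _ _ _ P _ (index_enum 'I_n) (fun c w =>
   noise_part alpha G g (z ^~ w) (a q) (a q.+1) s c ^+ 2) e.
have -> : size (index_enum 'I_n) = n by rewrite -[RHS]card_ord cardT enumT.
apply=> c _; have [Bc [rhoc [msc _ _]]] := dc s c Xs.
have L k : L2 P (centered P z (noise_coord G phi s c) k) by exact: L2_centered msc.
have E : (fun w => noise_part alpha G g (z ^~ w) (a q) (a q.+1) s c ^+ 2) =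
    (fun w => weighted_sum alpha (centered P z (noise_coord G phi s c)) (a q) (a q.+1) w ^+ 2).
  apply/funext => w; congr (_ ^+ 2); apply: eq_bigr => k _; congr (_ * _).
  by rewrite (centered_noise_coord G_mean _ _ Xs).
rewrite E; split; first exact: (proj2 (L2_weighted_sum alpha L (a q) (a q.+1))).
exact: Hc.
Qed.

Let piece_sum_le1 (a : nat -> nat) J i q : a 0%N = K i -> a J = K i.+1 ->
  (forall q, (a q <= a q.+1)%N) -> (q < J)%N ->
  (K i <= a q)%N /\ \sum_(a q <= k < a q.+1) alpha k <= 1.
Proof.
move=> a0 aJ aS qJ; have ale := homo_leq (@leqnn) leq_trans aS.
have Ka : (K i <= a q)%N by rewrite -a0 ale.
have aK : (a q.+1 <= K i.+1)%N by rewrite -aJ ale.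
split => //; rewrite -tauB //; have /andP[_ ti] := Kt i.
apply: le_trans ti; have : tau (K i) <= tau (a q) by rewrite tau_le.
have : tau (a q.+1) <= tau (K i.+1) by rewrite tau_le.
lra.
Qed.

Lemma Ex_fluctuation_cvg0 (J : nat) (F : seq 'rV[R]_n) (bd : nat -> nat -> nat) :
  decorrelated_noise P X G phi z M -> (forall s, s \in F -> X s) ->
  (forall i, [/\ bd i 0%N = K i, bd i J = K i.+1 & forall q, (bd i q <= bd i q.+1)%N]) ->
  (forall i, L1 P (path_fluctuation (bd i) J F)) /\
  forall e, 0 < e -> exists i0, forall i, (i0 <= i)%N ->
    Ex P (path_fluctuation (bd i) J F) <= e.
Proof.
move=> dn FX Hbd; have [dc ds] := dn.
have small f : decorrelated P z f -> forall e, 0 < e -> exists k0, forall k, (k0 <= k)%N ->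
    forall i j, (k <= i)%N -> \sum_(i <= l < j) alpha l <= 1 ->
    Ex P (fun w => weighted_sum alpha (centered P z f) i j w ^+ 2) <= e.
  move=> [B [rho [ms cr r0]]] e e0.
  have [k0 Hk0] := Ex_decorrelated_sum alpha_ge0 (fun k => L2_centered k ms)
    (fun k => Ex_centered_sqr k ms) cr r0 alpha0 e0.
  by exists k0 => k kk i j ki; apply: Hk0; exact: leq_trans ki.
have main e : 0 < e -> exists i0, forall i, (i0 <= i)%N ->
    L1 P (path_fluctuation (bd i) J F) /\
    Ex P (path_fluctuation (bd i) J F) <= J%:R * (e + (size F)%:R * (n%:R * e)).
  move=> e0; have [k1 H1] := small _ ds e e0.
  have [k2 H2] : exists k0, forall s, s \in F -> forall k, (k0 <= k)%N ->
      forall c i j, (k <= i)%N -> \sum_(i <= l < j) alpha l <= 1 ->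
      Ex P (fun w => weighted_sum alpha (centered P z (noise_coord G phi s c)) i j w ^+ 2) <= e.
    apply: common_threshold => s sF.
    have [k0 H] : exists k0, forall c, c \in index_enum 'I_n -> forall k, (k0 <= k)%N ->
        forall i j, (k <= i)%N -> \sum_(i <= l < j) alpha l <= 1 ->
        Ex P (fun w => weighted_sum alpha (centered P z (noise_coord G phi s c)) i j w ^+ 2) <= e.
      apply: common_threshold => c _.
      exact: (small (noise_coord G phi s c) (dc s c (FX s sF)) e e0).
    by exists k0 => k kk c; apply: H => //; exact: mem_index_enum.
  exists (maxn k1 k2) => i; rewrite geq_max => /andP[k1i k2i].
  have [b1 b2 b3] := Hbd i.
  apply: Ex_path_fluctuation_le => // [q qJ|q s c qJ sF].
    have [Ka s1] := piece_sum_le1 b1 b2 b3 qJ.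
    apply: (H1 _ (leqnn _)) => //.
    by rewrite (leq_trans k1i) // (leq_trans (K_ge i)).
  have [Ka s1] := piece_sum_le1 b1 b2 b3 qJ.
  apply: (H2 s sF _ (leqnn _)) => //.
  by rewrite (leq_trans k2i) // (leq_trans (K_ge i)).
split => [i|e e0].
  pose sq f q := Ex P (fun w => weighted_sum alpha (centered P z f) (bd i q) (bd i q.+1) w ^+ 2).
  have sq0 f q : 0 <= sq f q by apply: Ex_ge0 => w; exact: sqr_ge0.
  (* Integrability is wanted for every window, including early ones: the total of all the variances
     involved serves as the bound. *)
  pose e := \sum_(0 <= q < J) (sq (noise_size G phi M) q +
     \sum_(s <- F) \sum_(c < n) sq (noise_coord G phi s c) q).
  have term q : (q < J)%N -> sq (noise_size G phi M) q +
     \sum_(s <- F) \sum_(c < n) sq (noise_coord G phi s c) q <= e.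
    move=> qJ; rewrite /e (bigD1_seq q) /= ?iota_uniq ?mem_index_iota ?qJ // lerDl.
    apply: sumr_ge0 => q' _; rewrite addr_ge0 //.
    by do 2 (apply: sumr_ge0 => ? _).
  have [] := @Ex_path_fluctuation_le (bd i) J F e dn FX _ _ => // [q qJ|q s c qJ sF].
    apply: le_trans (term q qJ); rewrite lerDl.
    by do 2 (apply: sumr_ge0 => ? _).
  apply: (@le_trans _ _ (\sum_(c < n) sq (noise_coord G phi s c) q)).
    exact: (ler_sum_term (fun c => sq0 (noise_coord G phi s c) q) (mem_index_enum c)).
  apply: (@le_trans _ _ (\sum_(s <- F) \sum_(c < n) sq (noise_coord G phi s c) q)).
    apply: (ler_sum_term (F := fun s => \sum_(c < n) sq (noise_coord G phi s c) q)) => //.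
    by move=> s'; apply: sumr_ge0.
  by apply: le_trans (term q qJ); rewrite lerDr.
pose D := J%:R * (1 + (size F)%:R * n%:R) + 1 : R.
have D0 : 0 < D by rewrite /D ltr_wpDl // mulr_ge0 // addr_ge0 // mulr_ge0.
have [i0 H] := main (e / D) (divr_gt0 e0 D0).
exists i0 => i /H [_] Hi; apply: le_trans Hi _.
have eD : 0 < e / D by rewrite divr_gt0.
have : e / D * D = e by rewrite divfK // gt_eqF.
by rewrite /D; lra.
Qed.

(** For uncorrelated terms, the variance on a piece is at most a multiple of the sum of
    [alpha k ^+ 2] there. The windows partition the steps, so these sums add up to at most [A]. *)
Lemma Ex_fluctuation_summable (J : nat) (F : seq 'rV[R]_n) (bd : nat -> nat -> nat) (A : R) :
  assumption_A2 P X G g z -> (forall s, s \in F -> X s) ->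
  (forall i, [/\ bd i 0%N = K i, bd i J = K i.+1 & forall q, (bd i q <= bd i q.+1)%N]) ->
  (forall N, \sum_(0 <= k < N) alpha k ^+ 2 <= A) ->
  exists A', forall N, \sum_(0 <= i < N) Ex P (path_fluctuation (bd i) J F) <= A'.
Proof.
move=> A2 FX Hbd HA.
have dn := A2_decorrelated X0 rz G_lipu A2.
have [B [Bc Bs]] := A2_bounded_second_moment X0 rz G_lipu A2; have [ind _] := A2.
have var f C : continuous f -> bounded_second_moment P z f C -> forall i j,
    Ex P (fun w => weighted_sum alpha (centered P z f) i j w ^+ 2) <=
    C * \sum_(i <= k < j) alpha k ^+ 2.
  move=> cf mC i j; apply: Ex_uncorrelated_sum => [k|k|].
  - exact: L2_centered mC.
  - exact: Ex_centered_sqr mC.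
  - exact: independent_uncorrelated mC.
have cs : continuous (noise_size G phi M).
  by exact: lipschitz_continuous (noise_size_lip phi X0 G_lipu).
have cc s c : X s -> continuous (noise_coord G phi s c).
  by move=> Xs; exact: lipschitz_continuous (noise_coord_lip phi G_lipu c Xs).
have B0 : 0 <= B.
  by have [_] := Bs 0%N; apply: le_trans; apply: Ex_ge0 => w; exact: sqr_ge0.
have step i : Ex P (path_fluctuation (bd i) J F) <=
    J%:R * (1 + (size F)%:R * n%:R) * B * \sum_(K i <= k < K i.+1) alpha k ^+ 2.
  have [b1 b2 b3] := Hbd i.
  have ale := homo_leq (@leqnn) leq_trans b3.
  set S := \sum_(K i <= k < K i.+1) alpha k ^+ 2.
  have sub q : (q < J)%N -> B * \sum_(bd i q <= k < bd i q.+1) alpha k ^+ 2 <= B * S.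
    move=> qJ; rewrite ler_wpM2l //.
    have h1 : (K i <= bd i q)%N by rewrite -b1 ale.
    have h2 : (bd i q.+1 <= K i.+1)%N by rewrite -b2 ale.
    rewrite /S (big_cat_nat h1 (leq_trans (b3 q) h2)) /=.
    rewrite [X in _ <= _ + X](big_cat_nat (b3 q) h2) /= addrCA lerDl addr_ge0 //;
      by apply: sumr_ge0 => k _; exact: sqr_ge0.
  have [||_] := @Ex_path_fluctuation_le (bd i) J F (B * S) dn FX.
  - by move=> q qJ; apply: le_trans (var _ _ cs Bs _ _) _; exact: sub.
  - move=> q s c qJ sF; have Xs := FX s sF.
    by apply: le_trans (var _ _ (cc s c Xs) (Bc s c Xs) _ _) _; exact: sub.
  by lra.
exists (J%:R * (1 + (size F)%:R * n%:R) * B * A) => N.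
apply: (@le_trans _ _ (\sum_(0 <= i < N) (J%:R * (1 + (size F)%:R * n%:R) * B *
    \sum_(K i <= k < K i.+1) alpha k ^+ 2))).
  by apply: ler_sum => i _; exact: step.
rewrite -mulr_sumr -window_sum_split // ler_wpM2l //.
by rewrite mulr_ge0 // mulr_ge0 // addr_ge0 // mulr_ge0.
Qed.

End Tracking.

(** * Convergence in expectation and almost surely *)

Section Convergence.
Context {R : realType} {d : measure_display} {T : measurableType d} {n p : nat}.
Variables (P : probability T R) (X : set 'rV[R]_n).
Variables (G : 'rV[R]_n -> 'rV[R]_p -> 'rV[R]_n) (phi : 'rV[R]_n -> R).
Variables (z : nat -> T -> 'rV[R]_p) (x0 : T -> 'rV[R]_n) (alpha : nat -> R).
Variables (xC : nat -> R -> T -> 'rV[R]_n) (M : R) (K wi : nat -> nat).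
Local Notation g := (grad phi).
Local Notation tau := (tau alpha).
Let x w := psgd alpha X G (x0 w) (z ^~ w).
Let b k w := deviation alpha (x w) (fun i t => xC i t w) k.
Let gap k w := dist_to (- g (x w k)) (goldstein_indicator X (b k w) (x w k)).
Hypothesis compX : compact X.
Hypothesis cX : @convex_set R 'rV[R]_n X.
Hypothesis X0 : X 0.
Hypothesis rz : forall k, random_vector (z k).
Hypothesis G_mean : forall s k, X s -> vintegrable P (fun w => G s (z k w)) /\
  vmean P (fun w => G s (z k w)) = g s.
Hypothesis phi_diff : forall s, X s -> differentiable phi s.
Hypothesis M1 : 1 <= M.
Hypothesis X_diam : forall s s', X s -> X s' -> enorm (s - s') <= M.
Hypothesis g_bnd : forall s, X s -> enorm (g s) <= M.
Hypothesis g_lip : forall s s', X s -> X s' -> enorm (g s - g s') <= M * enorm (s - s').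
Hypothesis G_lip : forall s s' u, X s -> X s' ->
  enorm (G s u - G s' u) <= M * enorm (s - s').
Hypothesis G_lipu : forall s u u', X s ->
  enorm (G s u - G s u') <= M * enorm (u - u').
Hypothesis phi_lip : forall s s', X s -> X s' -> `|phi s - phi s'| <= M * enorm (s - s').
Hypothesis x0X : forall w, X (x0 w).
Hypothesis alpha_bnd : forall k, 0 < alpha k <= 2^-1.
Hypothesis tau_unbounded : forall B, exists N, B < tau N.
Variable A : R.
Hypothesis alpha2 : forall N, \sum_(0 <= k < N) alpha k ^+ 2 <= A.
Hypothesis K0 : K 0%N = 0%N.
Hypothesis KS : forall i, (K i < K i.+1)%N.
Hypothesis KE : forall i, breakpoint alpha i = tau (K i).
Hypothesis Kt : forall i, 2^-1 <= tau (K i.+1) - tau (K i) <= 1.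
Hypothesis Kwi : forall k, (K (wi k) <= k < K (wi k).+1)%N.
Hypothesis flow : forall i w, projected_gradient_flow X g
  (tau (K i)) (tau (K i.+1)) (fun t => xC i t w).
Hypothesis xCK : forall i w, xC i (tau (K i)) w = x w (K i).

Let M0 : 0 <= M.
Proof. exact: le_trans ler01 M1. Qed.

Let alpha_gt0 k : 0 < alpha k.
Proof. by case/andP: (alpha_bnd k). Qed.

Let alpha0 : forall e, 0 < e -> exists k0, forall k, (k0 <= k)%N -> alpha k <= e.
Proof. exact: (square_summable_cvg0 alpha_gt0 alpha2). Qed.

Let xX w k : X (x w k).
Proof.
have clX : closed X by exact: compact_closed (@norm_hausdorff _ _) compX.
exact: (psgd_mem (z := z ^~ w) (alpha := alpha) (G := G) clX cX (x0X w)).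
Qed.

Let wi_ge i k : (K i <= k)%N -> (i <= wi k)%N.
Proof.
move=> ik; rewrite leqNgt; apply/negP => wk.
have Kle := homo_leq (@leqnn) leq_trans (fun i => ltnW (KS i)).
have /andP[_ kw] := Kwi k.
by have := leq_trans (Kle _ _ wk) ik; rewrite leqNgt kw.
Qed.

Let gap_ge0 k w : 0 <= gap k w.
Proof. exact: dist_to_ge0. Qed.

Let b_ge0 k w : 0 <= b k w.
Proof.
exact: (deviation_ge0 alpha_bnd X_diam (xX w) KS KE Kwi (fun i => flow i w) k).
Qed.

Let b_le k w (rho : nat -> R) :
  (forall i m, (K i <= m <= K i.+1)%N -> enorm (x w m - xC i (tau m) w) <= rho i) ->
  b k w <= rho (wi k) + M * alpha k.
Proof.
move=> H; have /andP[k1 k2] := Kwi k.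
apply: le_trans (deviation_tracking alpha_bnd cX M1 X_diam g_bnd (xX w) KS KE Kwi
  (fun i => flow i w) k) _.
by rewrite lerD2r H // k1 ltnW.
Qed.

(** The vector 0 is normal at [x w k], so the gap is at most the norm of the gradient. Such a
    uniform bound is a hypothesis of [lower_integral_sum]. *)
Let gap_sq_bnd k w : 0 <= gap k w ^+ 2 <= M ^+ 2.
Proof.
rewrite sqr_ge0 /= ler_pXn2r ?nnegrE ?gap_ge0 //.
apply: le_trans (@dist_to_le _ _ _ 0 _ _) _; last by rewrite subr0 enormN g_bnd.
apply: sub_gen_smallest; exists (x w k); first by rewrite /= subrr enorm0 b_ge0.
by split => // a _; rewrite !dot0l.
Qed.

Let gap_sum_le w (rho : nat -> R) N :
  (forall i m, (K i <= m <= K i.+1)%N -> enorm (x w m - xC i (tau m) w) <= rho i) ->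
  \sum_(0 <= k < N) alpha k * gap k w ^+ 2 <=
  6 * M ^+ 4 * (1 + \sum_(0 <= k < N) alpha k * (rho (wi k) + alpha k)).
Proof.
move=> H; exact: (gap_sum alpha_bnd cX M1 X_diam g_bnd g_lip phi_lip phi_diff (xX w)
  K0 KS KE Kt Kwi (fun i => flow i w) (fun i => xCK i w) H).
Qed.

Let tracking_diam i w m : (K i <= m <= K i.+1)%N -> enorm (x w m - xC i (tau m) w) <= M.
Proof.
move=> /andP[im mi]; apply: X_diam => //.
by apply: (flow_mem (flow i w)); rewrite !tau_le // im.
Qed.

Let size_mean_bnd : decorrelated P z (noise_size G phi M) ->
  exists2 Mg, 0 <= Mg & forall k, Ex P (noise_size G phi M \o z k) <= Mg.
Proof.
move=> [B [_ [ms _ _]]].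
have B0 : 0 <= B.
  by have [_] := ms 0%N; apply: le_trans; apply: Ex_ge0 => w; exact: sqr_ge0.
(* A first moment is bounded through [a <= a ^+ 2 + 1]. *)
exists (B + 1) => [|k]; first by rewrite addr_ge0.
have [L LB] := ms k.
apply: (@le_trans _ _ (Ex P (fun w => noise_size G phi M (z k w) ^+ 2 + cst 1 w))).
  apply: Ex_le; [exact: L2_L1 | by apply: L1D; [exact: (proj2 L) | exact: L1_cst]|].
  move=> w /=; move: (noise_size _ _ _ _) => a.
  by have := sqr_ge0 (a - 2^-1); rewrite !expr2; nra.
by rewrite ExD ?Ex_cst ?lerD2r //; [exact: (proj2 L) | exact: L1_cst].
Qed.

(** The tracking error is not assumed measurable, so it is majorised by an integrable [rho i], equal
    to the diameter bound [M] on the early windows. *)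
Lemma expected_tracking eta : decorrelated_noise P X G phi z M -> 0 < eta ->
  exists (rho : nat -> T -> R) (i1 : nat), [/\ forall i, L1 P (rho i),
    forall i w m, (K i <= m <= K i.+1)%N -> enorm (x w m - xC i (tau m) w) <= rho i w,
    forall i, Ex P (rho i) <= M + eta & forall i, (i1 <= i)%N -> Ex P (rho i) <= eta].
Proof.
move=> dn e0; have [_ ds] := dn; have [Mg Mg0 HMg] := size_mean_bnd ds.
have e20 : 0 < eta / 2 by lra.
have [J [F [C [i0 [bd [C0 FX Hbd Htr]]]]]] := tracking_fluctuation compX cX X0 M1 X_diam
  g_bnd g_lip G_lip x0X alpha_bnd alpha0 KS Kt flow xCK Mg0 HMg e20.
have C1 : 0 < C + 1 by rewrite ltr_wpDl.
have [iZ EZ] := Ex_fluctuation_cvg0 G_mean alpha_bnd alpha0 KS Kt dn FX Hbd.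
have [i1 Hi1] := EZ (eta / 2 / (C + 1)) (divr_gt0 e20 C1).
pose Z i := path_fluctuation P G phi z alpha M (bd i) J F.
pose rho i := if (i < maxn i0 i1)%N then cst M else fun w => eta / 2 + C * Z i w.
have irho i : L1 P (rho i).
  rewrite /rho; case: ifP => _; first exact: (L1_cst P M).
  by apply: L1D; [exact: (L1_cst P (eta / 2)) | apply: L1Z; exact: iZ].
have Erho i : (maxn i0 i1 <= i)%N -> Ex P (rho i) <= eta.
  move=> ii; rewrite /rho ltnNge ii /=.
  rewrite (ExD (X := cst (eta / 2))) ?Ex_cst; [|exact: L1_cst|by apply: L1Z; exact: iZ].
  rewrite ExZ; last exact: iZ.
  move: ii; rewrite geq_max => /andP[_ /Hi1 EZi].
  have : C * Ex P (Z i) <= (C + 1) * (eta / 2 / (C + 1)).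
    apply: le_trans (ler_wpM2l C0 EZi) _.
    by rewrite ler_wpM2r ?lerDl // ltW // divr_gt0.
  have : (C + 1) * (eta / 2 / (C + 1)) = eta / 2 by rewrite mulrC divfK // gt_eqF.
  lra.
exists rho, (maxn i0 i1); split => // [i w m im|i].
  rewrite /rho; case: ltnP => [_|]; first exact: tracking_diam.
  by rewrite geq_max => /andP[i0i _]; exact: Htr.
have [ii|ii] := ltnP i (maxn i0 i1); last first.
  by apply: le_trans (Erho i ii) _; rewrite lerDr.
by rewrite /rho ii (Ex_cst P M) lerDl ltW.
Qed.

Lemma almost_sure_tracking : assumption_A2 P X G g z ->
  {ae P, forall w, forall eta, 0 < eta -> exists i1, forall i m, (i1 <= i)%N ->
    (K i <= m <= K i.+1)%N -> enorm (x w m - xC i (tau m) w) <= eta}.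
Proof.
move=> A2; have dn := A2_decorrelated X0 rz G_lipu A2; have [_ ds] := dn.
have [Mg Mg0 HMg] := size_mean_bnd ds.
(* Restricting [eta] to the values [j.+1%:R^-1] leaves countably many null sets to collect. *)
suff H (j : nat) : {ae P, forall w, exists i1, forall i m, (i1 <= i)%N ->
    (K i <= m <= K i.+1)%N -> enorm (x w m - xC i (tau m) w) <= j.+1%:R^-1}.
  have := ae_foralln H; apply: filterS => w Hw eta eta0.
  have [i1 Hi1] := Hw (Num.truncn eta^-1); exists i1 => i m ii im.
  apply: le_trans (Hi1 i m ii im) _.
  rewrite -[leRHS]invrK lef_pV2 ?posrE ?invr_gt0 ?ltr0n //.
  exact/ltW/truncnS_gt.
have e20 : 0 < j.+1%:R^-1 / 2 :> R by rewrite divr_gt0 // invr_gt0 ltr0n.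
have [J [F [C [i0 [bd [C0 FX Hbd Htr]]]]]] := tracking_fluctuation compX cX X0 M1 X_diam
  g_bnd g_lip G_lip x0X alpha_bnd alpha0 KS Kt flow xCK Mg0 HMg e20.
have C1 : 0 < C + 1 by rewrite ltr_wpDl.
have [iZ _] := Ex_fluctuation_cvg0 G_mean alpha_bnd alpha0 KS Kt dn FX Hbd.
have [A' HA'] := Ex_fluctuation_summable X0 rz G_mean G_lipu K0 KS A2 FX Hbd alpha2.
have := ae_summable_cvg0 iZ (fun i w => path_fluctuation_ge0 _ _ _ _ _ _ _ _ _ w) HA'.
apply: filterS => w /(_ (j.+1%:R^-1 / 2 / (C + 1)) (divr_gt0 e20 C1)) [i1 Hi1].
exists (maxn i0 i1) => i m; rewrite geq_max => /andP[i0i i1i] im.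
apply: le_trans (Htr i w m i0i im) _.
have e1 := ltW (divr_gt0 e20 C1).
have E : (C + 1) * (j.+1%:R^-1 / 2 / (C + 1)) = j.+1%:R^-1 / 2.
  by rewrite mulrC divfK // gt_eqF.
have := Hi1 i i1i; move: e1 E; move: (_ / (C + 1)) => q q0 E.
move: (path_fluctuation _ _ _ _ _ _ _ _ _ _) => Zi /(ler_wpM2l C0) h.
move: E; move: (j.+1%:R^-1) => r E; lra.
Qed.

Lemma expected_convergence : decorrelated_noise P X G phi z M ->
  (fun N : nat => (((tau N)^-1)%:E *
      \sum_(0 <= k < N) (alpha k)%:E * \int[P]_w (gap k w ^+ 2)%:E)%E) @ \oo --> 0%E /\
  (fun k : nat => \int[P]_w (b k w)%:E)%E @ \oo --> 0%E.
Proof.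
move=> dn; have a0 k : 0 <= alpha k by exact: ltW.
have tau0 N : 0 <= (tau N)^-1 by rewrite invr_ge0 tau_ge0.
split; apply: ereal_cvg0 => [N|e e0].
- rewrite mule_ge0 ?lee_fin //; apply: sume_ge0 => k _.
  rewrite mule_ge0 ?lee_fin //; apply: integral_ge0 => w _.
  by rewrite lee_fin sqr_ge0.
- pose D := 6 * M ^+ 4.
  have D0 : 0 < D by rewrite mulr_gt0 // exprn_gt0 //; exact: lt_le_trans M1.
  (* [weighted_cesaro] at level [2 * eta] returns [4 * eta], and the factor [D] of [gap_sum] turns
     this into [e]. *)
  pose eta := e / (4 * D); have eta0 : 0 < eta by rewrite divr_gt0 // mulr_gt0.
  have [rho [i1 [irho rho_ge rhoM rhoe]]] := expected_tracking dn eta0.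
  have [k0 Hk0] := alpha0 eta0.
  have c1 k : Ex P (rho (wi k)) + alpha k <= M + eta + 1.
    by have := rhoM (wi k); case/andP: (alpha_bnd k); lra.
  have c2 k : (maxn (K i1) k0 <= k)%N -> Ex P (rho (wi k)) + alpha k <= 2 * eta.
    by rewrite geq_max => /andP[/wi_ge/rhoe h1 /Hk0 h2]; lra.
  have eta2 : 0 < 2 * eta by lra.
  have [N1 HN1] := weighted_cesaro 1 alpha_gt0 tau_unbounded eta2 c1 c2.
  exists N1 => N N1N.
  have := @lower_integral_sum _ _ _ P (fun k w => gap k w ^+ 2) alpha (M ^+ 2)
    (fun w => D * (1 + \sum_(0 <= k < N) alpha k * (rho (wi k) w + alpha k))) N
    a0 gap_sq_bnd.
  have ik k : L1 P (fun w => alpha k * (rho (wi k) w + alpha k)).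
    by apply: L1Z; apply: L1D => //; exact: (L1_cst P (alpha k)).
  have is_ : L1 P (fun w => \sum_(0 <= k < N) alpha k * (rho (wi k) w + alpha k)).
    exact: L1_sum.
  have i1s : L1 P (fun w => 1 + \sum_(0 <= k < N) alpha k * (rho (wi k) w + alpha k)).
    by apply: L1D => //; exact: (L1_cst P 1).
  move=> /(_ (L1Z D i1s) _) H.
  apply: le_trans (lee_wpmul2l _ (H _)) _; first by rewrite lee_fin.
    by move=> w; exact: (gap_sum_le N (fun i m => rho_ge i w m)).
  rewrite ExZ // (ExD (X := cst 1)) ?Ex_cst //; last exact: L1_cst.
  rewrite Ex_sum // -EFinM lee_fin.
  have -> : \sum_(0 <= k < N) Ex P (fun w => alpha k * (rho (wi k) w + alpha k)) =
      \sum_(0 <= k < N) alpha k * (Ex P (rho (wi k)) + alpha k).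
    apply: eq_bigr => k _; rewrite ExZ.
      by rewrite (ExD (Y := cst (alpha k))) ?Ex_cst //; exact: L1_cst.
    by apply: L1D => //; exact: (L1_cst P (alpha k)).
  rewrite mulrCA; have := ler_wpM2l (ltW D0) (HN1 N N1N).
  move/le_trans; apply; rewrite /eta.
  have : e / (4 * D) * (4 * D) = e by rewrite divfK // gt_eqF // mulr_gt0.
  lra.
- by apply: integral_ge0 => w _; rewrite lee_fin.
have e20 : 0 < e / 2 by lra.
have [rho [i1 [irho rho_ge rhoM rhoe]]] := expected_tracking dn e20.
have eM : 0 < e / 2 / M by rewrite divr_gt0 //; exact: lt_le_trans M1.
have [k0 Hk0] := alpha0 eM.
exists (maxn (K i1) k0) => k; rewrite geq_max => /andP[/wi_ge/rhoe h1 /Hk0 h2].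
have ir : L1 P (fun w => rho (wi k) w + M * alpha k).
  by apply: L1D => //; exact: (L1_cst P (M * alpha k)).
apply: le_trans (lower_integral_le _ _ ir) _ => // [w|].
  exact: (b_le k (rho := fun i => rho i w) (fun i m => rho_ge i w m)).
rewrite lee_fin (ExD (Y := cst (M * alpha k))) ?Ex_cst //; last exact: L1_cst.
have : M * alpha k <= e / 2.
  by move: h2; rewrite ler_pdivlMr 1?mulrC //; exact: lt_le_trans M1.
lra.
Qed.

Lemma almost_sure_convergence : assumption_A2 P X G g z ->
  {ae P, forall w,
     (fun N : nat => (tau N)^-1 * \sum_(0 <= k < N) alpha k * gap k w ^+ 2) @ \oo --> 0 /\
     b ^~ w @ \oo --> 0}.
Proof.
move=> /almost_sure_tracking; apply: filterS => w Hw.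
have rhoP eta : 0 < eta -> exists i1, forall i m, (K i <= m <= K i.+1)%N ->
    enorm (x w m - xC i (tau m) w) <= (if (i < i1)%N then M else eta).
  move=> /Hw [i1 Hi1]; exists i1 => i m im; case: ltnP => ii.
    exact: tracking_diam.
  exact: Hi1.
split; apply: real_cvg0 => [N|e e0].
- apply: mulr_ge0; first by rewrite invr_ge0; exact: tau_ge0.
  by apply: sumr_ge0 => k _; apply: mulr_ge0; [exact: ltW | exact: sqr_ge0].
- pose D := 6 * M ^+ 4.
  have D0 : 0 < D by rewrite mulr_gt0 // exprn_gt0 //; exact: lt_le_trans M1.
  pose eta := e / (4 * D); have eta0 : 0 < eta by rewrite divr_gt0 // mulr_gt0.
  have [i1 Hi1] := rhoP _ eta0.
  have [k0 Hk0] := alpha0 eta0.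
  have c1 k : (if (wi k < i1)%N then M else eta) + alpha k <= M + eta + 1.
    case/andP: (alpha_bnd k) => _ ak; have m0 := M0; case: ifP => _; lra.
  have c2 k : (maxn (K i1) k0 <= k)%N ->
      (if (wi k < i1)%N then M else eta) + alpha k <= 2 * eta.
    rewrite geq_max => /andP[/wi_ge h1 /Hk0 h2]; rewrite ltnNge h1 /=; lra.
  have eta2 : 0 < 2 * eta by lra.
  have [N1 HN1] := weighted_cesaro 1 alpha_gt0 tau_unbounded eta2 c1 c2.
  exists N1 => N N1N.
  apply: le_trans (ler_wpM2l _ (gap_sum_le N Hi1)) _; first by rewrite invr_ge0 tau_ge0.
  rewrite mulrCA; have := ler_wpM2l (ltW D0) (HN1 N N1N).
  move/le_trans; apply; rewrite /eta.
  have : e / (4 * D) * (4 * D) = e by rewrite divfK // gt_eqF // mulr_gt0.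
  lra.
- exact: b_ge0.
have e20 : 0 < e / 2 by lra.
have [i1 Hi1] := rhoP _ e20.
have eM : 0 < e / 2 / M by rewrite divr_gt0 //; exact: lt_le_trans M1.
have [k0 Hk0] := alpha0 eM.
exists (maxn (K i1) k0) => k; rewrite geq_max => /andP[/wi_ge h1 /Hk0 h2].
apply: le_trans (b_le k Hi1) _; rewrite ltnNge h1 /=.
have : M * alpha k <= e / 2.
  by move: h2; rewrite ler_pdivlMr 1?mulrC //; exact: lt_le_trans M1.
lra.
Qed.

End Convergence.

Theorem corollary6 (R : realType) (d : measure_display) (T : measurableType d)
  (P : probability T R) (n p : nat)
  (X : set 'rV[R]_n) (r l : R)
  (f : 'rV[R]_n -> 'rV[R]_p -> R)
  (zgen : T -> 'rV[R]_p) (z : nat -> T -> 'rV[R]_p) (x0 : T -> 'rV[R]_n)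
  (alpha : nat -> R) (xC : nat -> R -> T -> 'rV[R]_n)
  (fbar := mean_fun P f zgen)
  (x := fun (w : T) => psgd alpha X (gradx f) (x0 w) (z ^~ w))
  (b := fun (k : nat) (w : T) =>
     deviation alpha (x w) (fun i t => xC i t w) k)
  (gap := fun (k : nat) (w : T) =>
     dist_to (- grad fbar (x w k)) (goldstein_indicator X (b k w) (x w k))) :
  compact X -> @convex_set R 'rV[R]_n X ->
  0 < r -> (forall y, enorm y <= r -> X y) ->
  (forall y u, X y -> differentiable (fun y' => f y' u) y) ->
  (forall y1 y2 u, X y1 -> X y2 ->
     enorm (gradx f y1 u - gradx f y2 u) <= l * enorm (y1 - y2)) ->
  (forall y u1 u2, X y ->
     enorm (gradx f y u1 - gradx f y u2) <= l * enorm (u1 - u2)) ->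
  random_vector zgen -> (forall k, random_vector (z k)) -> random_vector x0 ->
  (forall y, X y -> \forall y' \near y,
     P.-integrable setT (fun w => (f y' (zgen w))%:E)) ->
  (forall y, X y -> differentiable fbar y) ->
  (forall y k, X y -> vintegrable P (fun w => gradx f y (z k w)) /\
     vmean P (fun w => gradx f y (z k w)) = grad fbar y) ->
  (forall w, X (x0 w)) ->
  independent_systems P (sigma_of x0) (sigma_of_seq z) ->
  (forall i w,
     projected_gradient_flow X (grad fbar)
       (breakpoint alpha i) (breakpoint alpha i.+1) (fun t => xC i t w) /\
     xC i (breakpoint alpha i) w = embed alpha (x w) (breakpoint alpha i)) ->
  (forall k, 0 < alpha k <= 2^-1) ->
  (\sum_(0 <= k <oo) (alpha k)%:E = +oo)%E ->
  (\sum_(0 <= k <oo) (alpha k ^+ 2)%:E < +oo)%E ->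
  ((assumption_A1 P X (gradx f) (grad fbar) x0 z \/
    assumption_A2 P X (gradx f) (grad fbar) z \/
    assumption_A3 P x0 z) ->
   (fun N : nat => (((tau alpha N)^-1)%:E *
      \sum_(0 <= k < N) (alpha k)%:E * 'E_P[(fun w => gap k w ^+ 2)%R])%E)
     @ \oo --> 0%E /\
   (fun k : nat => 'E_P[b k]%E) @ \oo --> 0%E) /\
  (assumption_A1 P X (gradx f) (grad fbar) x0 z ->
   {ae P, forall w,
     (fun N : nat => (tau alpha N)^-1 *
        \sum_(0 <= k < N) alpha k * gap k w ^+ 2) @ \oo --> 0 /\
     b ^~ w @ \oo --> 0}).
Proof.
move=> compX cX r0 ball fdiff Glx Glu rzg rz rx0 _ phidiff Gmean x0X ind flowH abnd asum asq.
have X0 : X 0 by apply: ball; rewrite enorm0 ltW.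
have Gm s k Xs := Gmean s k Xs.
have [M [M1 XD gB [gL GL GLu phiL]]] :=
  problem_constants compX cX X0 Glx Glu phidiff (fun s k => @Gmean s k).
have a0 k : 0 < alpha k by have /andP[] := abnd k.
have tauU := series_pinfty_unbounded a0 asum.
have [A _ HA] := nneseries_partial_bound (fun k => sqr_ge0 (alpha k)) asq.
have [K [wi [K0 KS KE Kt Kwi]]] := windows abnd tauU.
have flow i w : projected_gradient_flow X (grad fbar)
    (tau alpha (K i)) (tau alpha (K i.+1)) (fun t => xC i t w).
  by rewrite -!KE; exact: (flowH i w).1.
have xCK i w : xC i (tau alpha (K i)) w = x w (K i).
  by have := (flowH i w).2; rewrite KE embed_tau.
split=> [A123|/(A1_A2 rz) A2]; last first.
  exact: (almost_sure_convergence compX cX X0 rz Gm phidiff M1 XD gB gL GL GLu phiL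
    x0X abnd tauU HA K0 KS KE Kt Kwi flow xCK A2).
(* The three assumptions meet here. The almost sure part goes through A2 instead, because it needs
   variances that are summable over the windows. *)
have dn : decorrelated_noise P X (gradx f) fbar z M.
  case: A123 => [/(A1_A2 rz) A2|[A2|[_ mix]]].
  - exact: (A2_decorrelated X0 rz GLu A2).
  - exact: (A2_decorrelated X0 rz GLu A2).
  - exact: (A3_decorrelated fbar X0 rz M1 GLu mix).
have [c1 c2] := expected_convergence compX cX X0 Gm phidiff M1 XD gB gL GL phiL
  x0X abnd tauU HA K0 KS KE Kt Kwi flow xCK dn.
have EE (Y : T -> R) : 'E_P[Y]%E = (\int[P]_w (Y w)%:E)%E by rewrite unlock.
split; last by under eq_fun do rewrite EE.
by under eq_fun do under eq_bigr do rewrite EE.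
Qed.
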